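(* Let $n=2$. A continuous, translation invariant Minkowski valuation $\Phi:\mathcal{K}^2\to\mathcal{K}^2$ satisfies (VC) and is $\mathrm{SO}(2)$-covariant if and only if there are $g\in\mathrm{SO}(2)$ and $a,b\geq 0$ with $a+b>0$ such that $\Phi(K)=a\,g(K-s(K))+b\,g(-K+s(K))$ for all $K\in\mathcal{K}^2$.
   Context: $\mathcal{K}^2$ is the space of convex bodies in $\mathbb{R}^2$ with Hausdorff metric and Minkowski addition; $-K=\{-x:x\in K\}$. A Minkowski valuation satisfies $\Phi(K)+\Phi(L)=\Phi(K\cup L)+\Phi(K\cap L)$ whenever $K,L,K\cup L\in\mathcal{K}^2$. Translation invariant: $\Phi(K+t)=\Phi(K)$; $\mathrm{SO}(2)$-covariant: $\Phi(gK)=g\Phi(K)$ for all $g\in\mathrm{SO}(2)$. The Steiner point is $s(K)=\frac{1}{\pi}\int_{\mathbb{S}^{1}}h(K,u)u\,du$ with $h(K,u)=\max_{x\in K}\langle u,x\rangle$. (VC): there are $c,C>0$ with $cV_2(K)\le V_2(\Phi(K))\le CV_2(K)$ for all $K$, $V_2$ the area. *)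

(* Defs.v *)
From HB Require Import structures.
From mathcomp Require Import all_boot all_order all_algebra.
From mathcomp Require Import all_classical all_reals all_analysis.
Set Implicit Arguments. Unset Strict Implicit. Unset Printing Implicit Defensive.
Import Order.TTheory GRing.Theory Num.Theory.
Import numFieldNormedType.Exports.
Local Open Scope classical_set_scope.
Local Open Scope ring_scope.

Section Plane.
Variable R : realType.
Definition pt := (R * R)%type.

Definition padd (p q : pt) : pt := (p.1 + q.1, p.2 + q.2).
Definition pscale (a : R) (p : pt) : pt := (a * p.1, a * p.2).
Definition popp (p : pt) : pt := (- p.1, - p.2).
Definition pdot (p q : pt) : R := p.1 * q.1 + p.2 * q.2.

Definition convex_set (K : set pt) : Prop :=
  forall x y t, K x -> K y -> 0 <= t <= 1 ->
    K (padd (pscale t x) (pscale (1 - t) y)).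
Definition convex_body (K : set pt) : Prop :=
  K !=set0 /\ compact K /\ convex_set K.

Definition ksum (K L : set pt) : set pt :=
  [set z | exists x y, K x /\ L y /\ z = padd x y].
Definition kscale (a : R) (K : set pt) : set pt := pscale a @` K.
Definition krefl (K : set pt) : set pt := popp @` K.
Definition ktrans (K : set pt) (t : pt) : set pt := (padd ^~ t) @` K.

Definition unit_disk : set pt := [set p | p.1 ^+ 2 + p.2 ^+ 2 <= 1].

Definition hausdorff (K L : set pt) : R :=
  inf [set r : R | 0 <= r /\ K `<=` ksum L (kscale r unit_disk)
                          /\ L `<=` ksum K (kscale r unit_disk)].

Definition rot (c s : R) (p : pt) : pt := (c * p.1 - s * p.2, s * p.1 + c * p.2).
Definition is_SO2 (c s : R) : Prop := c ^+ 2 + s ^+ 2 = 1.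
Definition krot (c s : R) (K : set pt) : set pt := rot c s @` K.

Definition support (K : set pt) (u : pt) : R := sup [set pdot u x | x in K].

(* Steiner point s(K) = 1/pi \int_{S^1} h(K,u) u du, S^1 parametrized by arc length *)
Definition steiner (K : set pt) : pt :=
  (pi^-1 * \int[lebesgue_measure]_(t in `[0, 2 * pi]%classic)
               (support K (cos t, sin t) * cos t),
   pi^-1 * \int[lebesgue_measure]_(t in `[0, 2 * pi]%classic)
               (support K (cos t, sin t) * sin t)).

Definition area (K : set pt) : \bar R :=
  ((@lebesgue_measure R) \x (@lebesgue_measure R))%E K.

Definition maps_bodies (Phi : set pt -> set pt) : Prop :=
  forall K, convex_body K -> convex_body (Phi K).

Definition hcontinuous (Phi : set pt -> set pt) : Prop :=
  forall K, convex_body K -> forall eps : R, 0 < eps -> exists2 delta : R, 0 < delta &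
    forall L, convex_body L -> hausdorff K L < delta -> hausdorff (Phi K) (Phi L) < eps.

Definition translation_invariant (Phi : set pt -> set pt) : Prop :=
  forall K t, convex_body K -> Phi (ktrans K t) = Phi K.

Definition minkowski_valuation (Phi : set pt -> set pt) : Prop :=
  forall K L, convex_body K -> convex_body L -> convex_body (K `|` L) ->
    ksum (Phi K) (Phi L) = ksum (Phi (K `|` L)) (Phi (K `&` L)).

Definition SO2_covariant (Phi : set pt -> set pt) : Prop :=
  forall c s, is_SO2 c s -> forall K, convex_body K -> Phi (krot c s K) = krot c s (Phi K).

Definition volume_comparable (Phi : set pt -> set pt) : Prop :=
  exists c C : R, 0 < c /\ 0 < C /\
    forall K, convex_body K ->
      ((c%:E * area K <= area (Phi K)) /\ (area (Phi K) <= C%:E * area K))%E.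

End Plane.

(* Main.v *)
Require Import Defs.
From HB Require Import structures.
From mathcomp Require Import all_boot all_order all_algebra.
From mathcomp Require Import all_classical all_reals all_analysis.
From mathcomp Require Import measurable_realfun ring lra.
(* Imported again so that [support] is not the notation of ssralg. *)
Import Defs.
Set Implicit Arguments. Unset Strict Implicit. Unset Printing Implicit Defensive.
Import Order.TTheory GRing.Theory Num.Theory.
Import numFieldNormedType.Exports.
Local Open Scope classical_set_scope.
Local Open Scope ring_scope.

(* Let Phi satisfy (VC) and be SO(2)-covariant. Cutting boxes shows that the
   support function of Phi([0,s] x [0,t]) is a bilinear polynomial in s and t.
   Its st-coefficient vanishes, for otherwise the area of Phi([0,s]^2), a body
   invariant under quarter-turns, would grow like s^4. By (VC) a segment is
   mapped to a body without area, hence to a segment, so that Phi acts on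
   segments and boxes as a nonzero complex multiplication V^T = r g. After
   factoring out V, halving boxes and cutting along altitudes gives the even
   part of h(Phi T, .) for every triangle T, and forces h(Phi T, .) to be linear
   on six cones. So Phi T is (1 - A) T + (1 + A) (-T) up to a translation, and
   the cut of a triangle through a vertex shows that A does not depend on T.

   What remains, after adding the Steiner point, is a vector valued valuation
   which vanishes on segments, is translation invariant, rotation covariant and
   continuous. On right triangles it is given by a function zeta of the angle;
   dissections give zeta(pi/2 - t) = - zeta(t) and zeta(2t) = 2 zeta(t), so
   zeta = 0 because it is bounded. Triangles generate all polygons by cuts, and
   polygons are dense.

   Conversely, area(Phi K) is compared with area K after a shear that puts K
   between two axis-parallel boxes of comparable size. *)

(** * Convex bodies and support functions *)

(** Support functions turn Minkowski sums into sums of reals and rotations into changes of argument.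
    The obstacle is that cuts determine the image of a triangle only up to a translation which may
    vary with the triangle: the even part of the support function is rigid, while the odd part
    carries the free parameter A and an uncontrolled linear term. The parameter is therefore read
    off from kinks, where linear terms are invisible. The Steiner point is the right correction
    because it is itself additive under cuts, continuous, and covariant under translations and
    rotations; subtracting the expected formula thus leaves a functional with every symmetry of the
    problem that is linear on each triangle. Sublinearity yields -1 <= A <= 1, which is the
    nonnegativity of a = (1 - A) r and b = (1 + A) r. Of the two bounds in (VC), the upper one
    removes the bilinear term and flattens the images of segments; the lower one makes V nonzero. *)

Lemma continuous_fst (T U : topologicalType) : continuous (@fst T U).
Proof. by move=> [a b]; exact: (@cvg_fst _ _ (nbhs a) (nbhs b)). Qed.

Lemma continuous_snd (T U : topologicalType) : continuous (@snd T U).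
Proof. by move=> [a b]; exact: (@cvg_snd _ _ (nbhs a) (nbhs b)). Qed.

Lemma continuous_pair (S T U : topologicalType) (f : S -> T) (g : S -> U) :
  continuous f -> continuous g -> continuous (fun p => (f p, g p)).
Proof.
move=> cf cg p; apply: (@cvg_pair _ _ _ (nbhs p) (nbhs (f p)) (nbhs (g p))).
  exact: cf.
exact: cg.
Qed.

Section Bodies.
Variable R : realType.
Implicit Types (K L : set (pt R)) (u p q x y : pt R).

Lemma pt_eq p q : p.1 = q.1 -> p.2 = q.2 -> p = q.
Proof. by case: p q => [a b] [c d] /= -> ->. Qed.

Lemma continuous_affine (a b c : R) :
  continuous (fun p : pt R => a * p.1 + b * p.2 + c).
Proof.
move=> p; apply: cvgD; last exact: cvg_cst.
apply: cvgD; (apply: cvgM; first exact: cvg_cst).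
  exact: continuous_fst.
exact: continuous_snd.
Qed.

Lemma continuous_affine_map (a b c a' b' c' : R) : continuous (fun p : pt R =>
  (a * p.1 + b * p.2 + c, a' * p.1 + b' * p.2 + c')).
Proof. by apply: continuous_pair; exact: continuous_affine. Qed.

Lemma compact_affine_image (f : pt R -> pt R) a b c a' b' c' K :
  (forall p, f p = (a * p.1 + b * p.2 + c, a' * p.1 + b' * p.2 + c')) ->
  compact K -> compact (f @` K).
Proof.
move=> fE cK; apply: continuous_compact => //.
apply: continuous_subspaceT; rewrite (_ : f = fun p => (a * p.1 + b * p.2 + c, a' * p.1 + b' * p.2 + c')).
  exact: continuous_affine_map.
by apply/funext.
Qed.

Lemma body_affine_image (f : pt R -> pt R) a b c a' b' c' K :
  (forall p, f p = (a * p.1 + b * p.2 + c, a' * p.1 + b' * p.2 + c')) ->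
  convex_body K -> convex_body (f @` K).
Proof.
move=> fE [[x0 Kx0] [cK vK]]; split; first by exists (f x0), x0.
split; first exact: compact_affine_image fE cK.
move=> _ _ t [x Kx <-] [y Ky <-] t01.
exists (padd (pscale t x) (pscale (1 - t) y)); first exact: vK.
by rewrite !fE; apply: pt_eq => /=; ring.
Qed.

Lemma body_kscale a K : convex_body K -> convex_body (kscale a K).
Proof.
apply: (@body_affine_image _ a 0 0 0 a 0) => p.
by rewrite /pscale; apply: pt_eq => /=; ring.
Qed.

Lemma body_krot c s K : convex_body K -> convex_body (krot c s K).
Proof.
apply: (@body_affine_image _ c (- s) 0 s c 0) => p.
by rewrite /rot; apply: pt_eq => /=; ring.
Qed.

Lemma body_krefl K : convex_body K -> convex_body (krefl K).
Proof.
apply: (@body_affine_image _ (-1) 0 0 0 (-1) 0) => p.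
by rewrite /popp; apply: pt_eq => /=; ring.
Qed.

Lemma body_ktrans K t : convex_body K -> convex_body (ktrans K t).
Proof.
apply: (@body_affine_image _ 1 0 t.1 0 1 t.2) => p.
by rewrite /padd; apply: pt_eq => /=; ring.
Qed.

Lemma body_ksum K L : convex_body K -> convex_body L -> convex_body (ksum K L).
Proof.
move=> [[x0 Kx0] [cK vK]] [[y0 Ly0] [cL vL]].
split; first by exists (padd x0 y0), x0, y0.
split.
  have -> : ksum K L = (fun z : pt R * pt R => padd z.1 z.2) @` (K `*` L).
    apply/seteqP; split => [z [x [y [Kx [Ly ->]]]]|_ [[x y] [Kx Ly] <-]].
      by exists (x, y).
    by exists x, y.
  apply: continuous_compact; last exact: compact_setX.
  apply: continuous_subspaceT => -[x y] /=.
  have h1 : continuous (fun z : pt R * pt R => z.1.1 + z.2.1).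
    move=> z; apply: cvgD.
      exact: (@continuous_comp _ _ _ fst fst _ (@continuous_fst _ _ _) (@continuous_fst _ _ _)).
    exact: (@continuous_comp _ _ _ snd fst _ (@continuous_snd _ _ _) (@continuous_fst _ _ _)).
  have h2 : continuous (fun z : pt R * pt R => z.1.2 + z.2.2).
    move=> z; apply: cvgD.
      exact: (@continuous_comp _ _ _ fst snd _ (@continuous_fst _ _ _) (@continuous_snd _ _ _)).
    exact: (@continuous_comp _ _ _ snd snd _ (@continuous_snd _ _ _) (@continuous_snd _ _ _)).
  exact: (continuous_pair h1 h2).
move=> _ _ t [x [y [Kx [Ly ->]]]] [x' [y' [Kx' [Ly' ->]]]] t01.
exists (padd (pscale t x) (pscale (1 - t) x')), (padd (pscale t y) (pscale (1 - t) y')).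
split; first exact: vK.
by split; [exact: vL | apply: pt_eq => /=; ring].
Qed.

Lemma support_max K u : convex_body K -> exists2 x, K x & support K u = pdot u x.
Proof.
move=> [K0 [cK _]].
have cu : {within K, continuous (pdot u)}.
  apply: continuous_subspaceT.
  rewrite (_ : pdot u = fun p => u.1 * p.1 + u.2 * p.2 + 0).
    exact: continuous_affine.
  by apply/funext => p; rewrite addr0.
have [x /set_mem Kx xmax] := compact_EVT_max K0 cK cu.
exists x => //; apply/eqP; rewrite eq_le; apply/andP; split.
  apply: ge_sup; first by exists (pdot u x), x.
  by move=> _ [y Ky <-]; apply: xmax; rewrite inE.
apply: sup_ubound; last by exists x.
by exists (pdot u x) => _ [y Ky <-]; apply: xmax; rewrite inE.
Qed.

Lemma support_ub K u x : convex_body K -> K x -> pdot u x <= support K u.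
Proof.
move=> [K0 [cK vK]] Kx; apply: sup_ubound; last by exists x.
have cu : {within K, continuous (pdot u)}.
  apply: continuous_subspaceT.
  rewrite (_ : pdot u = fun p => u.1 * p.1 + u.2 * p.2 + 0).
    exact: continuous_affine.
  by apply/funext => p; rewrite addr0.
have [z /set_mem Kz zmax] := compact_EVT_max K0 cK cu.
by exists (pdot u z) => _ [y Ky <-]; apply: zmax; rewrite inE.
Qed.

Lemma supportE K u x : convex_body K -> K x ->
  (forall y, K y -> pdot u y <= pdot u x) -> support K u = pdot u x.
Proof.
move=> bK Kx h; apply/eqP; rewrite eq_le support_ub// andbT.
by have [y Ky ->] := support_max u bK; exact: h.
Qed.

Lemma support_image (f : pt R -> pt R) K u v c : convex_body K -> convex_body (f @` K) ->
  (forall x, pdot u (f x) = pdot v x + c) -> support (f @` K) u = support K v + c.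
Proof.
move=> bK bf fE; have [x Kx hx] := support_max v bK.
rewrite hx -fE; apply: supportE => //.
by move=> _ [y Ky <-]; rewrite !fE lerD2r -hx; exact: support_ub.
Qed.

Lemma support_kscale a K u : 0 <= a -> convex_body K ->
  support (kscale a K) u = a * support K u.
Proof.
move=> a0 bK; have [x Kx hx] := support_max u bK.
have e y : pdot u (pscale a y) = a * pdot u y by rewrite /pdot/=; ring.
rewrite hx -e; apply: supportE; [exact: body_kscale| by exists x|].
by move=> _ [y Ky <-]; rewrite !e ler_wpM2l// -hx; exact: support_ub.
Qed.

Lemma support_krot c s K u : convex_body K ->
  support (krot c s K) u = support K (rot c (- s) u).
Proof.
move=> bK; rewrite -[RHS]addr0; apply: support_image => //; first exact: body_krot.
by move=> x; rewrite /pdot/=; ring.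
Qed.

Lemma support_krefl K u : convex_body K -> support (krefl K) u = support K (popp u).
Proof.
move=> bK; rewrite -[RHS]addr0; apply: support_image => //; first exact: body_krefl.
by move=> x; rewrite /pdot/=; ring.
Qed.

Lemma support_ktrans K t u : convex_body K -> support (ktrans K t) u = support K u + pdot u t.
Proof.
move=> bK; apply: support_image => //; first exact: body_ktrans.
by move=> x; rewrite /pdot/=; ring.
Qed.

Lemma support_ksum K L u : convex_body K -> convex_body L ->
  support (ksum K L) u = support K u + support L u.
Proof.
move=> bK bL; have [x Kx hx] := support_max u bK; have [y Ly hy] := support_max u bL.
have e p q : pdot u (padd p q) = pdot u p + pdot u q by rewrite /pdot/=; ring.
rewrite hx hy -e; apply: supportE; [exact: body_ksum| by exists x, y|].
move=> _ [x' [y' [Kx' [Ly' ->]]]]; rewrite !e lerD//; [rewrite -hx|rewrite -hy]; exact: support_ub.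
Qed.

Lemma supportZ K u a : 0 <= a -> convex_body K -> support K (pscale a u) = a * support K u.
Proof.
move=> a0 bK; have [x Kx hx] := support_max u bK.
have e y : pdot (pscale a u) y = a * pdot u y by rewrite /pdot/=; ring.
rewrite hx -e; apply: supportE => // y Ky; rewrite !e ler_wpM2l// -hx; exact: support_ub.
Qed.

Lemma supportD K u v : convex_body K -> support K (padd u v) <= support K u + support K v.
Proof.
move=> bK; have [x Kx ->] := support_max (padd u v) bK.
have -> : pdot (padd u v) x = pdot u x + pdot v x by rewrite /pdot/=; ring.
by apply: lerD; exact: support_ub.
Qed.

(* The point of L nearest to x has the normal of a separating line as its offset. *)
Lemma support_sub K L : convex_body K -> convex_body L ->
  (forall u, support K u <= support L u) -> K `<=` L.
Proof.
move=> bK bL hKL x Kx; apply: contrapT => nLx.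
have [L0 [cL vL]] := bL.
have cd : {within L, continuous (fun y : pt R =>
    (y.1 - x.1) * (y.1 - x.1) + (y.2 - x.2) * (y.2 - x.2))}.
  apply: continuous_subspaceT => y.
  by apply: cvgD; apply: cvgM; (apply: cvgB; last exact: cvg_cst);
    (exact: continuous_fst || exact: continuous_snd).
have [y /set_mem Ly ymin] := compact_EVT_min L0 cL cd.
pose u := (x.1 - y.1, x.2 - y.2).
have key z : L z -> pdot u z <= pdot u y.
  move=> Lz; rewrite leNgt; apply/negP => lt.
  set a := pdot u z - pdot u y.
  set b := (z.1 - y.1) ^+ 2 + (z.2 - y.2) ^+ 2.
  have a0 : 0 < a by rewrite subr_gt0.
  have b0 : 0 <= b by rewrite addr_ge0// sqr_ge0.
  (* Moving from y towards z by the fraction t lowers the squared distance to x by t(2a - tb), which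
     is positive for this t. *)
  pose t := a / (a + b).
  have ab0 : 0 < a + b by lra.
  have t0 : 0 < t by exact: divr_gt0.
  have t1 : t <= 1 by rewrite ler_pdivrMr// mul1r; lra.
  have Lw : L (padd (pscale t z) (pscale (1 - t) y)) by apply: vL => //; lra.
  have := ymin _ (mem_set Lw) => /=.
  have -> : (t * z.1 + (1 - t) * y.1 - x.1) * (t * z.1 + (1 - t) * y.1 - x.1) +
    (t * z.2 + (1 - t) * y.2 - x.2) * (t * z.2 + (1 - t) * y.2 - x.2) =
    (y.1 - x.1) * (y.1 - x.1) + (y.2 - x.2) * (y.2 - x.2) - t * (2 * a - t * b).
    by rewrite /a /b /pdot /u/=; ring.
  have tb : t * b < 2 * a.
    have h1 : t * b <= b by rewrite ler_piMl.
    have : t * (a + b) = a by rewrite /t divfK// gt_eqF.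
    nra.
  have : 0 < t * (2 * a - t * b) by apply: mulr_gt0 => //; lra.
  lra.
have hx := support_ub u bK Kx; have := le_trans hx (hKL u).
rewrite (supportE bL Ly key) => h.
have : (x.1 - y.1) ^+ 2 + (x.2 - y.2) ^+ 2 <= 0 by move: h; rewrite /pdot/=; nra.
have h1 := sqr_ge0 (x.1 - y.1); have h2 := sqr_ge0 (x.2 - y.2) => h3.
have e1 : (x.1 - y.1) ^+ 2 = 0 by lra.
have e2 : (x.2 - y.2) ^+ 2 = 0 by lra.
move/eqP: e1; rewrite sqrf_eq0 subr_eq0 => /eqP e1.
move/eqP: e2; rewrite sqrf_eq0 subr_eq0 => /eqP e2.
by apply: nLx; rewrite (pt_eq e1 e2).
Qed.

Lemma support_inj K L : convex_body K -> convex_body L ->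
  (forall u, support K u = support L u) -> K = L.
Proof.
by move=> bK bL h; apply/seteqP; split; apply: support_sub => // u; rewrite h.
Qed.

End Bodies.

(** * Cuts along lines and Hausdorff distance *)

Section Cuts.
Variable R : realType.
Implicit Types (K L : set (pt R)) (u n p q x y z a b w : pt R).

Definition half_le n (c : R) : set (pt R) := [set x | pdot n x <= c].
Definition half_ge n (c : R) : set (pt R) := [set x | c <= pdot n x].
Definition line n (c : R) : set (pt R) := [set x | pdot n x = c].

Definition seg a b : set (pt R) :=
  [set z | exists t, 0 <= t <= 1 /\ z = padd (pscale t a) (pscale (1 - t) b)].

Lemma continuous_pdot n : continuous (pdot n : pt R -> R).
Proof.
rewrite (_ : pdot n = fun p => n.1 * p.1 + n.2 * p.2 + 0); first exact: continuous_affine.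
by apply/funext => p; rewrite addr0.
Qed.

Lemma half_leE n c : half_le n c = half_ge (popp n) (- c).
Proof.
apply/seteqP; split => x; rewrite /half_le /half_ge /pdot/= => h.
  by rewrite !mulNr -opprD lerN2.
by move: h; rewrite !mulNr -opprD lerN2.
Qed.

Lemma half_geE n c : half_ge n c = half_le (popp n) (- c).
Proof.
apply/seteqP; split => x; rewrite /half_le /half_ge /pdot/= => h.
  by rewrite !mulNr -opprD lerN2.
by move: h; rewrite !mulNr -opprD lerN2.
Qed.

Lemma lineE n c : line n c = line (popp n) (- c).
Proof.
apply/seteqP; split => x; rewrite /line /pdot/= => h.
  by rewrite !mulNr -opprD h.
by move: h; rewrite !mulNr -opprD => /oppr_inj.
Qed.

Lemma body_half_le K n c : convex_body K -> K `&` half_le n c !=set0 ->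
  convex_body (K `&` half_le n c).
Proof.
move=> [_ [cK vK]] K0; split => //; split.
  apply: compact_closedI => //.
  apply: (@closed_comp _ _ (pdot n) [set t | t <= c]); last exact: closed_le.
  by move=> x _; exact: continuous_pdot.
move=> x y t [Kx hx] [Ky hy] t01; split; first exact: vK.
move: hx hy; rewrite /half_le /pdot/=; case/andP: t01 => t0 t1; nra.
Qed.

Lemma body_half_ge K n c : convex_body K -> K `&` half_ge n c !=set0 ->
  convex_body (K `&` half_ge n c).
Proof. rewrite half_geE; exact: body_half_le. Qed.

Lemma line_setI n c : line n c = half_le n c `&` half_ge n c.
Proof.
apply/seteqP; split => x; rewrite /line /half_le /half_ge /=.
  by move=> ->.
by move=> [h1 h2]; apply/eqP; rewrite eq_le h1.
Qed.

Lemma body_line K n c : convex_body K -> K `&` line n c !=set0 ->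
  convex_body (K `&` line n c).
Proof.
rewrite line_setI setIA => bK [x xK]; apply: body_half_ge; last by exists x.
by apply: body_half_le => //; exists x; case: xK.
Qed.

(** The crossing point divides ab in the ratio of [al] and [be], the distances of the end points to
    the line up to a factor. If both vanish, the segment lies on the line and z itself serves as
    w. *)
Lemma seg_cross n c a b z : pdot n a <= c -> c <= pdot n b -> seg a b z -> pdot n z <= c ->
  exists w, [/\ seg a b w, pdot n w = c & seg a w z].
Proof.
move=> ha hb [t [/andP[t0 t1] ze]] hz.
set al := c - pdot n a; set be := pdot n b - c.
have al0 : 0 <= al by rewrite subr_ge0.
have be0 : 0 <= be by rewrite subr_ge0.
have ez : pdot n z = t * pdot n a + (1 - t) * pdot n b by rewrite ze /pdot/=; ring.
have hzt : (1 - t) * be <= t * al by rewrite /al /be; move: hz; rewrite ez; lra.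
have [al_eq0|al_neq0] := eqVneq al 0.
  have [be_eq0|be_neq0] := eqVneq be 0.
    exists z; split.
    - by exists t; rewrite t0 t1.
    - by rewrite ez; move: al_eq0 be_eq0; rewrite /al /be => h1 h2; nra.
    - by exists 0; split; [lra | apply: pt_eq => /=; ring].
  have t1' : 1 - t = 0.
    have be_gt0 : 0 < be by rewrite lt_neqAle eq_sym be_neq0.
    move: hzt; rewrite al_eq0 mulr0 pmulr_lle0// => h; lra.
  exists a; split.
  - by exists 1; split; [lra | apply: pt_eq => /=; ring].
  - by move/eqP: al_eq0; rewrite subr_eq0 => /eqP.
  - have e : t = 1 by lra.
    by exists 1; split; [lra | rewrite ze e; apply: pt_eq => /=; ring].
have al_gt0 : 0 < al by rewrite lt_neqAle eq_sym al_neq0.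
have ab0 : al + be != 0 by rewrite gt_eqF//; lra.
exists (padd (pscale (be / (al + be)) a) (pscale (1 - be / (al + be)) b)); split.
- exists (be / (al + be)); split => //.
  by rewrite divr_ge0//= ?ler_pdivrMr; lra.
- transitivity (be / (al + be) * pdot n a + (1 - be / (al + be)) * pdot n b).
    by rewrite /pdot/=; ring.
  have -> : pdot n a = c - al by rewrite /al; ring.
  have -> : pdot n b = c + be by rewrite /be; ring.
  by field.
- exists (1 - (1 - t) * (al + be) / al); split.
    have h : 0 <= (1 - t) * (al + be) / al by apply: divr_ge0 => //; apply: mulr_ge0; lra.
    have : (1 - t) * (al + be) / al <= 1 by rewrite ler_pdivrMr//; lra.
    lra.
  by rewrite ze; apply: pt_eq => /=; field; rewrite ab0 al_neq0.
Qed.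

Lemma seg_sub K a b : convex_set K -> K a -> K b -> seg a b `<=` K.
Proof. by move=> vK Ka Kb _ [t [t01 ->]]; exact: vK. Qed.

Lemma segL a b : seg a b a.
Proof. by exists 1; split; [rewrite ler01 lexx | apply: pt_eq => /=; ring]. Qed.

Lemma segR a b : seg a b b.
Proof. by exists 0; split; [rewrite ler01 lexx | apply: pt_eq => /=; ring]. Qed.

Lemma cut_line_nonempty K n c : convex_set K -> K `&` half_le n c !=set0 ->
  K `&` half_ge n c !=set0 -> K `&` line n c !=set0.
Proof.
move=> vK [x [Kx hx]] [y [Ky hy]].
have [w [sw ew _]] := seg_cross hx hy (segL x y) hx.
by exists w; split => //; exact: seg_sub sw.
Qed.

Lemma support_le K L u : convex_body K -> convex_body L -> K `<=` L ->
  support K u <= support L u.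
Proof.
by move=> bK bL KL; have [x Kx ->] := support_max u bK; apply: support_ub => //; exact: KL.
Qed.

(** A maximizer z of u over K lies in one of the halves, which then has the support value of K. For
    any y in the other half, the segment zy meets the line at a point where u is at least as large
    as at y, so that half has the support value of the section. *)
Lemma support_cut K n c u : convex_body K -> K `&` half_le n c !=set0 ->
  K `&` half_ge n c !=set0 ->
  support (K `&` half_le n c) u + support (K `&` half_ge n c) u =
  support K u + support (K `&` line n c) u.
Proof.
have main n' c' : convex_body K -> K `&` half_le n' c' !=set0 ->
    K `&` half_ge n' c' !=set0 -> forall z, K z -> support K u = pdot u z ->
    pdot n' z <= c' ->
    support (K `&` half_le n' c') u + support (K `&` half_ge n' c') u =
    support K u + support (K `&` line n' c') u.
  move=> bK K1 K2 z Kz ez hz; have [_ [_ vK]] := bK.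
  have b1 := body_half_le bK K1; have b2 := body_half_ge bK K2.
  have b3 := body_line bK (cut_line_nonempty vK K1 K2).
  have -> : support (K `&` half_le n' c') u = support K u.
    by rewrite ez; apply: supportE => // y [Ky _]; rewrite -ez; exact: support_ub.
  congr (_ + _); apply/eqP; rewrite eq_le; apply/andP; split; last first.
    by apply: support_le => // x [Kx /=]; rewrite /line /half_ge /= => ->.
  have [y [Ky hy] ey] := support_max u b2; rewrite ey.
  have [w [sw ew _]] := seg_cross hz hy (segL z y) hz.
  have Kw : (K `&` line n' c') w by split => //; exact: (seg_sub vK Kz Ky sw).
  apply: le_trans (support_ub u b3 Kw).
  have [t [/andP[t0 t1] ->]] := sw.
  have zy : pdot u y <= pdot u z by rewrite -ez; exact: support_ub.
  by move: zy; rewrite /pdot /=; nra.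
move=> bK K1 K2; have [z Kz ez] := support_max u bK.
have [hz|/ltW hz] := leP (pdot n z) c; first exact: main ez hz.
rewrite addrC half_leE half_geE lineE.
rewrite half_leE in K1; rewrite half_geE in K2.
by apply: (main _ _ _ _ _ z) => //; move: hz; rewrite /pdot/=; lra.
Qed.

(** The valuation property enters the proof in this form only: for the two parts of a body on either
    side of a line, and read on support functions. *)
Lemma valuation_cut (Phi : set (pt R) -> set (pt R)) K n c u :
  maps_bodies Phi -> minkowski_valuation Phi ->
  convex_body K -> K `&` half_le n c !=set0 -> K `&` half_ge n c !=set0 ->
  support (Phi (K `&` half_le n c)) u + support (Phi (K `&` half_ge n c)) u =
  support (Phi K) u + support (Phi (K `&` line n c)) u.
Proof.
move=> mP vP bK K1 K2; have [_ [_ vK]] := bK.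
have b1 := body_half_le bK K1; have b2 := body_half_ge bK K2.
have b3 := body_line bK (cut_line_nonempty vK K1 K2).
have eU : (K `&` half_le n c) `|` (K `&` half_ge n c) = K.
  apply/seteqP; split => [x [[]|[]]//|x Kx].
  by have [h|/ltW h] := leP (pdot n x) c; [left|right].
have eI : (K `&` half_le n c) `&` (K `&` half_ge n c) = K `&` line n c.
  by rewrite line_setI setIACA setIid.
have := vP _ _ b1 b2; rewrite eU eI => /(_ bK) e.
by rewrite -!support_ksum ?e//; exact: mP.
Qed.

End Cuts.

Section Distance.
Variable R : realType.
Implicit Types (K L : set (pt R)) (u n p q x y z a b w : pt R).

Definition sqdist x y : R := (x.1 - y.1) ^+ 2 + (x.2 - y.2) ^+ 2.

Lemma continuous_sqdist y : continuous (fun x => sqdist x y).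
Proof.
rewrite (_ : (fun x => _) = fun x : pt R =>
    (x.1 - y.1) * (x.1 - y.1) + (x.2 - y.2) * (x.2 - y.2)).
  move=> x; apply: cvgD; apply: cvgM; (apply: cvgB; last exact: cvg_cst);
    (exact: continuous_fst || exact: continuous_snd).
by apply/funext => x; rewrite /sqdist !expr2.
Qed.

(** A bound on the Hausdorff distance with explicit witnesses. It can be checked vertex by vertex on
    hulls, whereas [hausdorff] is an infimum. *)
Definition close K L (r : R) : Prop := [/\ 0 <= r,
  forall x, K x -> exists2 y, L y & sqdist x y <= r ^+ 2 &
  forall x, L x -> exists2 y, K y & sqdist x y <= r ^+ 2].

Lemma close_sub K L r : 0 <= r ->
  (forall x, K x -> exists2 y, L y & sqdist x y <= r ^+ 2) ->
  K `<=` ksum L (kscale r (@unit_disk R)).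
Proof.
move=> r0 h x Kx; have [y Ly d] := h x Kx.
have [re|rn] := eqVneq r 0.
  exists y, (0, 0); split => //; split.
    by exists (0, 0); [rewrite /unit_disk/= expr0n/= addr0 ler01 | rewrite /pscale/= mulr0].
  move: d; rewrite re /sqdist expr0n/= => d.
  have h1 := sqr_ge0 (x.1 - y.1); have h2 := sqr_ge0 (x.2 - y.2).
  have e1 : (x.1 - y.1) ^+ 2 = 0 by lra.
  have e2 : (x.2 - y.2) ^+ 2 = 0 by lra.
  move/eqP: e1; rewrite sqrf_eq0 subr_eq0 => /eqP e1.
  move/eqP: e2; rewrite sqrf_eq0 subr_eq0 => /eqP e2.
  by apply: pt_eq; rewrite /padd/= addr0.
exists y, (x.1 - y.1, x.2 - y.2); split => //; split; last first.
  by apply: pt_eq => /=; ring.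
exists (r^-1 * (x.1 - y.1), r^-1 * (x.2 - y.2)); last first.
  by apply: pt_eq; rewrite /pscale/= mulrA divff// mul1r.
rewrite /unit_disk/= !exprMn -mulrDr exprVn mulrC ler_pdivrMr ?mul1r//.
by rewrite exprn_gt0// lt_neqAle eq_sym rn.
Qed.

Lemma close_hausdorff K L r : close K L r -> hausdorff K L <= r.
Proof.
move=> [r0 h1 h2]; apply: ge_inf.
  by exists 0 => t [].
by split => //; split; exact: close_sub.
Qed.

(** The sum of moduli is a crude substitute for the Euclidean norm of u: both coordinates of a point
    of the unit disk have modulus at most 1. *)
Lemma ksum_disk_support K L r u : convex_body K -> convex_body L -> 0 <= r ->
  K `<=` ksum L (kscale r (@unit_disk R)) ->
  support K u <= support L u + r * (`|u.1| + `|u.2|).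
Proof.
move=> bK bL r0 h; have [x Kx ->] := support_max u bK.
have [y [_ [Ly [[d hd <-] ->]]]] := h x Kx.
have -> : pdot u (padd y (pscale r d)) = pdot u y + r * pdot u d by rewrite /pdot/=; ring.
apply: lerD; first exact: support_ub.
apply: ler_wpM2l => //; rewrite /pdot.
move: hd; rewrite /unit_disk/= => hd.
have hle1 (a : R) : a ^+ 2 <= 1 -> `|a| <= 1.
  by move=> ha; rewrite -(@ler_pXn2r _ 2%N)// ?nnegrE// expr1n real_normK// num_real.
have d1 : `|d.1| <= 1 by apply: hle1; have := sqr_ge0 d.2; lra.
have d2 : `|d.2| <= 1 by apply: hle1; have := sqr_ge0 d.1; lra.
by apply: lerD; (apply: le_trans (ler_norm _) _; rewrite normrM ler_piMr).
Qed.

Lemma hausdorff_support K L r u : convex_body K -> convex_body L -> hausdorff K L < r ->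
  `|support K u - support L u| <= r * (`|u.1| + `|u.2|).
Proof.
move=> bK bL; rewrite /hausdorff; set S := (X in inf X) => hr.
have bnd K' y : convex_body K' -> exists2 B, 0 <= B & forall x, K' x -> sqdist x y <= B ^+ 2.
  move=> [K0 [cK _]].
  have cd := continuous_subspaceT (A := K') (@continuous_sqdist y).
  have [x0 _ hx] := compact_EVT_max K0 cK cd.
  (* For d >= 0 the square of 1 + d is at least d, so no square root is needed. *)
  exists (1 + sqdist x0 y) => [|x Kx]; rewrite /sqdist.
    by have := sqr_ge0 (x0.1 - y.1); have := sqr_ge0 (x0.2 - y.2); lra.
  have := hx x (mem_set Kx); rewrite /sqdist.
  by have := sqr_ge0 (x0.1 - y.1); have := sqr_ge0 (x0.2 - y.2); nra.
(* [inf] has a default value on the empty set, so an admissible radius must be exhibited: a bound on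
   the distances to one fixed point of the other body. *)
have S0 : has_inf S.
  split; last by exists 0 => t [].
  have [[x0 Kx0] _] := bK; have [[y0 Ly0] _] := bL.
  have [B B0 hB] := bnd _ y0 bK; have [C C0 hC] := bnd _ x0 bL.
  exists (B + C); split; first exact: addr_ge0.
  split; apply: close_sub => [|x Kx]; try exact: addr_ge0.
    exists y0 => //; apply: le_trans (hB _ Kx) _; nra.
  by exists x0 => //; apply: le_trans (hC _ Kx) _; nra.
have e0 : 0 < r - inf S by rewrite subr_gt0.
have [t [t0 [h1 h2]] tr] := inf_adherent e0 S0.
have {}tr : t < r by move: tr; rewrite addrC subrK.
have k1 := ksum_disk_support u bK bL t0 h1; have k2 := ksum_disk_support u bL bK t0 h2.
have n0 : 0 <= `|u.1| + `|u.2| by rewrite addr_ge0.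
by rewrite ler_norml; apply/andP; split; nra.
Qed.

Lemma close_support K L r u : convex_body K -> convex_body L -> close K L r ->
  `|support K u - support L u| <= r * (`|u.1| + `|u.2|).
Proof.
move=> bK bL [r0 h1 h2].
have k1 := ksum_disk_support u bK bL r0 (close_sub r0 h1).
have k2 := ksum_disk_support u bL bK r0 (close_sub r0 h2).
by rewrite ler_norml; apply/andP; split; lra.
Qed.

Lemma hcontinuous_support (Phi : set (pt R) -> set (pt R)) K u e :
  maps_bodies Phi -> hcontinuous Phi -> convex_body K -> 0 < e ->
  exists2 d, 0 < d & forall L r, convex_body L -> r < d -> close K L r ->
    `|support (Phi K) u - support (Phi L) u| < e.
Proof.
move=> mP cP bK e0.
have n0 : 0 <= `|u.1| + `|u.2| by rewrite addr_ge0.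
have e'0 : 0 < e / (1 + (`|u.1| + `|u.2|)) by apply: divr_gt0 => //; lra.
have [d d0 h] := cP K bK _ e'0.
exists d => // L r bL rd cl.
have /(hausdorff_support u (mP _ bK) (mP _ bL)) hh :=
  h L bL (le_lt_trans (close_hausdorff cl) rd).
apply: le_lt_trans hh _.
rewrite mulrAC ltr_pdivrMr ?ltr_pM2l//; lra.
Qed.

End Distance.

(** Cauchy's equation on the half-line. The difference [g] of f and the linear candidate is bounded
    on [0, 1] by smallness near 0, and has period 1, hence is bounded everywhere. As g(mt) = m g(t),
    it vanishes. *)
Lemma additive_linear (R : realType) (f : R -> R) :
  (forall s t, 0 <= s -> 0 <= t -> f (s + t) = f s + f t) ->
  (forall e, 0 < e -> exists2 d, 0 < d & forall t, 0 < t -> t < d -> `|f t| < e) ->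
  forall t, 0 <= t -> f t = t * f 1.
Proof.
move=> fD fc.
have f0 : f 0 = 0 by have := fD 0 0 (lexx _) (lexx _); rewrite addr0; lra.
have fn (m : nat) t : 0 <= t -> f (m%:R * t) = m%:R * f t.
  move=> t0; elim: m => [|m IH]; first by rewrite !mul0r.
  by rewrite -natr1 !mulrDl !mul1r fD ?mulr_ge0// IH.
pose g t := f t - t * f 1.
have gD s t : 0 <= s -> 0 <= t -> g (s + t) = g s + g t.
  by move=> s0 t0; rewrite /g fD//; ring.
have gn (m : nat) t : 0 <= t -> g (m%:R * t) = m%:R * g t.
  by move=> t0; rewrite /g fn//; ring.
have g1 : g 1 = 0 by rewrite /g; ring.
have [B gB] : exists B, forall t, 0 <= t -> t <= 1 -> `|g t| <= B.
  have [d d0 hd] := fc 1 ltr01.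
  pose m := (Num.truncn d^-1).+1.
  have m0 : 0 < m%:R :> R by rewrite ltr0n.
  have hm : m%:R^-1 < d.
    rewrite invf_plt ?posrE//; exact: truncnS_gt.
  exists (m%:R + `|f 1|) => t t0 t1.
  have [->|tn] := eqVneq t 0.
    by rewrite /g f0 mul0r subr0 normr0 addr_ge0// ltW.
  have tm0 : 0 < t / m%:R by apply: divr_gt0 => //; rewrite lt_neqAle eq_sym tn.
  have tmd : t / m%:R < d.
    by apply: le_lt_trans hm; rewrite ler_piMl// invr_ge0 ltW.
  rewrite /g; apply: le_trans (ler_normB _ _) _; apply: lerD.
    have -> : t = m%:R * (t / m%:R) by field; rewrite gt_eqF.
    rewrite fn ?(ltW tm0)// normrM (ger0_norm (ltW m0)) -[leRHS]mulr1 ler_wpM2l// ?(ltW m0)//.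
    exact/ltW/hd.
  by rewrite normrM ger0_norm// ler_piMl.
move=> t t0; suff : g t = 0 by rewrite /g => /eqP; rewrite subr_eq0 => /eqP.
have key (m : nat) : m%:R * `|g t| <= B.
  have mt0 : 0 <= m%:R * t by rewrite mulr_ge0.
  have /andP[h1 h2] := truncn_itv mt0.
  set k := Num.truncn (m%:R * t) in h1 h2.
  rewrite -[X in X * `|g t|]normr_nat -normrM -gn//.
  rewrite -natr1 in h2.
  have -> : g (m%:R * t) = g (m%:R * t - k%:R).
    have {1}-> : m%:R * t = k%:R * 1 + (m%:R * t - k%:R) by ring.
    by rewrite gD ?gn ?g1 ?mulr0 ?add0r ?mulr1 ?subr_ge0.
  by apply: gB; lra.
apply/eqP; apply: contraT => gt; have g0 : 0 < `|g t| by rewrite normr_gt0.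
have := key (Num.truncn (B / `|g t|)).+1.
by rewrite -ler_pdivlMr// leNgt truncnS_gt.
Qed.

(** * Convex hulls of finite sets *)

Section Hulls.
Variable R : realType.
Implicit Types (K L C : set (pt R)) (u n p q x y z a b w : pt R) (l m : seq (pt R)).

(** Iterated joins of a point with the hull of the tail, so that proofs go by induction on the list
    without barycentric coordinates. The case z = x is what starts the recursion, since the hull of
    the empty list is empty. *)
Fixpoint hull (l : seq (pt R)) : set (pt R) :=
  if l is x :: l' then
    [set z | z = x \/ exists t y, [/\ 0 <= t <= 1, hull l' y & z = padd (pscale t x) (pscale (1 - t) y)]]
  else set0.

Lemma hull_sub l C : convex_set C -> (forall x, x \in l -> C x) -> hull l `<=` C.
Proof.
move=> vC; elim: l => [|x l IH] h //= z [->|[t [y [t01 ly ->]]]].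
  by apply: h; rewrite mem_head.
apply: vC => //; first by apply: h; rewrite mem_head.
by apply: IH ly => w wl; apply: h; rewrite in_cons wl orbT.
Qed.

Lemma mem_hull l x : x \in l -> hull l x.
Proof.
elim: l => [//|y l IH]; rewrite in_cons => /orP[/eqP->|/IH h]; first by left.
right; exists 0, x; split=> //; first by rewrite lexx ler01.
by apply: pt_eq => /=; ring.
Qed.

Lemma hull_convex l : convex_set (hull l).
Proof.
elim: l => [//|x l IH] z1 z2 s h1 h2 /andP[s0 s1].
have [s_eq0|s_neq0] := eqVneq s 0.
  rewrite (_ : padd _ _ = z2)//; apply: pt_eq => /=; rewrite s_eq0; ring.
have [s_eq1|s_neq1] := eqVneq s 1.
  rewrite (_ : padd _ _ = z1)//; apply: pt_eq => /=; rewrite s_eq1; ring.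
have {s0 s_neq0} s0 : 0 < s by rewrite lt_neqAle eq_sym s_neq0.
have {s1 s_neq1} s1 : s < 1 by rewrite lt_neqAle s_neq1.
case: h1 h2 => [->|[t1 [y1 [/andP[t10 t11] ly1 ->]]]] [->|[t2 [y2 [/andP[t20 t21] ly2 ->]]]].
- by left; apply: pt_eq => /=; ring.
- right; exists (s + (1 - s) * t2), y2; split => //; last by apply: pt_eq => /=; ring.
  by apply/andP; split; nra.
- right; exists (s * t1 + (1 - s)), y1; split => //; last by apply: pt_eq => /=; ring.
  by apply/andP; split; nra.
(* The weights of y1 and y2 in the combination; they merge into one point of the tail's hull, unless
   both vanish and only x is left. *)
set al := s * (1 - t1); set be := (1 - s) * (1 - t2).
have al0 : 0 <= al by apply: mulr_ge0; lra.
have be0 : 0 <= be by apply: mulr_ge0; lra.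
have [ab0|abn] := eqVneq (al + be) 0.
  have a0 : al = 0 by lra.
  have b0 : be = 0 by lra.
  move/eqP: a0; rewrite /al mulf_eq0 gt_eqF//= subr_eq0 => /eqP a0.
  move/eqP: b0; rewrite /be mulf_eq0 (gt_eqF (_ : 0 < 1 - s)) ?subr_gt0//= subr_eq0 => /eqP b0.
  by left; apply: pt_eq => /=; rewrite -a0 -b0; ring.
have abp : 0 < al + be by rewrite lt_neqAle eq_sym abn addr_ge0.
right; exists (1 - (al + be)), (padd (pscale (al / (al + be)) y1) (pscale (1 - al / (al + be)) y2)).
split.
- by rewrite /al /be in al0 be0 abp *; apply/andP; split; nra.
- by apply: IH => //; rewrite divr_ge0 ?ler_pdivrMr ?mul1r ?(ltW abp)//=; lra.
by apply: pt_eq => /=; rewrite /al /be; field; rewrite -/al -/be gt_eqF.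
Qed.

Lemma hull_seg a b : hull [:: a; b] = seg a b.
Proof.
apply/seteqP; split => [z [->|[t [y [t01 [->|[s [w [_ //]]]] ->]]]]|z [t [t01 ->]]].
- exact: segL.
- by exists t.
- right; exists t, b; split => //; by left.
Qed.

Lemma hull_incl l m : {subset l <= m} -> hull l `<=` hull m.
Proof.
by move=> h; apply: hull_sub; [exact: hull_convex | move=> x /h; exact: mem_hull].
Qed.

Lemma hull_compact l : compact (hull l).
Proof.
elim: l => [|x l IH]; first exact: compact0.
pose f (z : R * pt R) : pt R := (z.1 * x.1 + (1 - z.1) * z.2.1, z.1 * x.2 + (1 - z.1) * z.2.2).
rewrite (_ : hull (x :: l) = [set x] `|` f @` (`[0, 1]%classic `*` hull l)); last first.
  apply/seteqP; split => [z [->|[t [y [t01 ly ->]]]]|z [->|[[t y] [/= t01 ly] <-]]].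
  - by left.
  - by right; exists (t, y) => //; split => //=; rewrite in_itv.
  - by left.
  - by right; exists t, y; split => //; move: t01; rewrite in_itv.
apply: compactU; first exact: compact_set1.
apply: continuous_compact; last by apply: compact_setX => //; exact: segment_compact.
apply: continuous_subspaceT.
have c1 : continuous (fun z : R * pt R => z.2.1).
  by move=> z; exact: (@continuous_comp _ _ _ snd fst _ (@continuous_snd _ _ _) (@continuous_fst _ _ _)).
have c2 : continuous (fun z : R * pt R => z.2.2).
  by move=> z; exact: (@continuous_comp _ _ _ snd snd _ (@continuous_snd _ _ _) (@continuous_snd _ _ _)).
have c0 : continuous (fun z : R * pt R => z.1) by exact: continuous_fst.
apply: continuous_pair => z; apply: cvgD; apply: cvgM; try exact: cvg_cst; try exact: c0.
- by apply: cvgB; [exact: cvg_cst | exact: c0].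
- exact: c1.
- by apply: cvgB; [exact: cvg_cst | exact: c0].
- exact: c2.
Qed.

Lemma body_hull l : l != [::] -> convex_body (hull l).
Proof.
case: l => // x l _; split; first by exists x; left.
by split; [exact: hull_compact | exact: hull_convex].
Qed.

Lemma hull_cat l m z : hull (l ++ m) z -> [\/ hull l z, hull m z |
  exists a b, [/\ hull l a, hull m b & seg a b z]].
Proof.
elim: l z => [|x l IH] z /=; first by constructor 2.
case=> [->|[t [y [t01 hy ->]]]].
  by constructor 1; left.
have [t0 t1] := andP t01.
case: (IH _ hy) => [ly|my|[a [b [la mb [s [/andP[s0 s1] ->]]]]]].
- by constructor 1; right; exists t, y.
- constructor 3; exists x, y; split => //; first by left.
  by exists t.
constructor 3.
(* The joint weight of x and a, which are merged into one point of the hull of [x :: l]. *)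
set c := t + (1 - t) * s.
have c0 : 0 <= c by rewrite /c; nra.
have [ceq0|cn] := eqVneq c 0.
  exists x, b; split; [by left | by [] |].
  have te : t = 0 by move: ceq0; rewrite /c; nra.
  have se : s = 0 by move: ceq0; rewrite /c te; lra.
  by exists 0; split; [rewrite lexx ler01 | apply: pt_eq; rewrite te se /=; ring].
have cp : 0 < c by rewrite lt_neqAle eq_sym cn.
exists (padd (pscale (t / c) x) (pscale (1 - t / c) a)), b; split => //.
  right; exists (t / c), a; split => //.
  by rewrite divr_ge0//= ler_pdivrMr// mul1r /c; nra.
exists c; split.
  by rewrite c0/= /c; nra.
have hk (X Y : R) : c * (t / c * X + (1 - t / c) * Y) = t * X + (c - t) * Y by field.
by apply: pt_eq; rewrite /= hk /c; ring.
Qed.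

(** The last hypothesis says that the cut creates no new vertices. A point below the line lies on a
    segment from hull l1 to hull l2, before the crossing point w; as w lies in hull m, it is already
    in hull l1. *)
Lemma hull_cut l1 l2 m n c :
  (forall x, x \in l1 -> pdot n x <= c) -> (forall x, x \in l2 -> c <= pdot n x) ->
  {subset m <= l1} -> 
  hull (l1 ++ l2) `&` line n c `<=` hull m ->
  hull (l1 ++ l2) `&` half_le n c = hull l1.
Proof.
move=> h1 h2 ml1 hm.
have m1 : hull m `<=` hull l1 by exact: hull_incl.
apply/seteqP; split => [z [hz ez]|z hz]; last first.
  split; first by apply: hull_incl hz => x xl; rewrite mem_cat xl.
  by apply: hull_sub hz => // x y t; rewrite /half_le /pdot/= => hx hy /andP[t0 t1]; nra.
have L2 b : hull l2 b -> c <= pdot n b.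
  move=> hb; have : half_ge n c b; last by [].
  by apply: hull_sub hb => // x y t; rewrite /half_ge /pdot/= => hx hy /andP[t0 t1]; nra.
have L1 b : hull l1 b -> pdot n b <= c.
  move=> hb; have : half_le n c b; last by [].
  by apply: hull_sub hb => // x y t; rewrite /half_le /pdot/= => hx hy /andP[t0 t1]; nra.
case: (hull_cat hz) => [//|hz2|[a [b [la lb sz]]]].
  apply: m1; apply: hm; split => //; rewrite /line/=; apply/eqP.
  by rewrite eq_le L2// andbT.
have [w [sw ew sz']] := seg_cross (L1 a la) (L2 b lb) sz ez.
have hw : hull l1 w.
  apply: m1; apply: hm; split => //.
  apply: (seg_sub (@hull_convex _)) sw.
    by apply: hull_incl la => x xl; rewrite mem_cat xl.
  by apply: hull_incl lb => x xl; rewrite mem_cat xl orbT.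
exact: (seg_sub (@hull_convex _) la hw).
Qed.

Lemma hull_image (f : pt R -> pt R) l :
  (forall x y t, f (padd (pscale t x) (pscale (1 - t) y)) =
     padd (pscale t (f x)) (pscale (1 - t) (f y))) ->
  f @` hull l = hull (map f l).
Proof.
move=> fE; elim: l => [|x l IH] /=; first by rewrite image_set0.
apply/seteqP; split => [_ [z [->|[t [y [t01 ly ->]]]] <-]|z].
- by left.
- by right; exists t, (f y); split => //; rewrite -IH; exists y.
case=> [->|[t [y [t01 ly ->]]]]; first by exists x => //; left.
move: ly; rewrite -IH => -[y' ly' <-].
by exists (padd (pscale t x) (pscale (1 - t) y')) => //; right; exists t, y'.
Qed.

Lemma krot_hull c s l : krot c s (hull l) = hull (map (rot c s) l).
Proof. by apply: hull_image => x y t; apply: pt_eq => /=; ring. Qed.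

Lemma krefl_hull l : krefl (hull l) = hull (map (@popp R) l).
Proof. by apply: hull_image => x y t; apply: pt_eq => /=; ring. Qed.

Lemma ktrans_hull l v : ktrans (hull l) v = hull (map (@padd R ^~ v) l).
Proof. by apply: hull_image => x y t; apply: pt_eq => /=; ring. Qed.

(** The same convex combination is taken in both families, and the squared norm is convex. *)
Lemma hull_close (A : eqType) (s : seq A) (f g : A -> pt R) r : 0 <= r ->
  (forall i, i \in s -> sqdist (f i) (g i) <= r ^+ 2) ->
  close (hull (map f s)) (hull (map g s)) r.
Proof.
have main (f' g' : A -> pt R) : (forall i, i \in s -> sqdist (f' i) (g' i) <= r ^+ 2) ->
    forall x, hull (map f' s) x -> exists2 y, hull (map g' s) y & sqdist x y <= r ^+ 2.
  elim: s => [//|i s IH] h x /= [->|[t [y [/andP[t0 t1] ly ->]]]].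
    by exists (g' i); [left | apply: h; rewrite mem_head].
  have {ly}[|y' ly' hy'] := IH _ y ly.
    by move=> j js; apply: h; rewrite in_cons js orbT.
  exists (padd (pscale t (g' i)) (pscale (1 - t) y')).
    by right; exists t, y'; rewrite t0 t1.
  have := h i (mem_head _ _); move: hy'; rewrite /sqdist /=.
  set a := (f' i).1 - _; set b := (f' i).2 - _; set c := y.1 - _; set d := y.2 - _ => h1 h2.
  have -> : t * (f' i).1 + (1 - t) * y.1 - (t * (g' i).1 + (1 - t) * y'.1) = t * a + (1 - t) * c.
    by rewrite /a /c; ring.
  have -> : t * (f' i).2 + (1 - t) * y.2 - (t * (g' i).2 + (1 - t) * y'.2) = t * b + (1 - t) * d.
    by rewrite /b /d; ring.
  have -> : (t * a + (1 - t) * c) ^+ 2 + (t * b + (1 - t) * d) ^+ 2 =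
    t * (a ^+ 2 + b ^+ 2) + (1 - t) * (c ^+ 2 + d ^+ 2) -
    t * (1 - t) * ((a - c) ^+ 2 + (b - d) ^+ 2) by ring.
  have h3 : 0 <= t * (1 - t) * ((a - c) ^+ 2 + (b - d) ^+ 2).
    by rewrite mulr_ge0 ?addr_ge0 ?sqr_ge0// mulr_ge0// subr_ge0.
  have h4 : t * (a ^+ 2 + b ^+ 2) <= t * r ^+ 2 by apply: ler_wpM2l.
  have h5 : (1 - t) * (c ^+ 2 + d ^+ 2) <= (1 - t) * r ^+ 2 by apply: ler_wpM2l => //; rewrite subr_ge0.
  lra.
move=> r0 h; split=> //; first exact: main.
by apply: main => i /h; rewrite /sqdist; lra.
Qed.

Lemma support_hull_ub l u c : l != [::] -> (forall x, x \in l -> pdot u x <= c) ->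
  support (hull l) u <= c.
Proof.
move=> l0 h; have [x lx ->] := support_max u (body_hull l0).
have : half_le u c x; last by [].
by apply: hull_sub lx => // y z t; rewrite /half_le /pdot/= => hx hy /andP[t0 t1]; nra.
Qed.

End Hulls.

(** * Valuations vanishing on triangles *)

Section CutAdditive.
Variable R : realType.
Implicit Types (K L C : set (pt R)) (u n p q x y z a b c d w : pt R) (l m : seq (pt R)).

Definition cut_additive (v : set (pt R) -> R) := forall K n (c : R), convex_body K ->
  K `&` half_le n c !=set0 -> K `&` half_ge n c !=set0 ->
  v (K `&` half_le n c) + v (K `&` half_ge n c) = v K + v (K `&` line n c).

Definition cross p q : R := p.1 * q.2 - p.2 * q.1.
Definition psub p q : pt R := padd p (popp q).
Definition tri a b c : set (pt R) := hull [:: a; b; c].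

Variable v : set (pt R) -> R.
Hypothesis v_cut : cut_additive v.

Lemma cut_hull l1 l2 m n (c : R) : m != [::] ->
  (forall x, x \in l1 -> pdot n x <= c) -> (forall x, x \in l2 -> c <= pdot n x) ->
  {subset m <= l1} -> {subset m <= l2} ->
  hull (l1 ++ l2) `&` line n c `<=` hull m ->
  v (hull l1) + v (hull l2) = v (hull (l1 ++ l2)) + v (hull m).
Proof.
move=> m0 h1 h2 ml1 ml2 hm.
have [y ym] : exists y, y \in m by case: (m) m0 => // y s _; exists y; rewrite mem_head.
have le1 : hull (l1 ++ l2) `&` half_le n c = hull l1 by exact: (hull_cut (m := m)).
have hC : hull (l1 ++ l2) = hull (l2 ++ l1).
  by apply/seteqP; split; apply: hull_incl => x; rewrite !mem_cat orbC.
have ge1 : hull (l1 ++ l2) `&` half_ge n c = hull l2.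
  rewrite half_geE hC; apply: (hull_cut (m := m)) => //.
  - by move=> x /h2; rewrite /pdot/=; lra.
  - by move=> x /h1; rewrite /pdot/=; lra.
  - by rewrite -lineE -hC.
have ln1 : hull (l1 ++ l2) `&` line n c = hull m.
  apply/seteqP; split => // x hx; rewrite line_setI setIA le1.
  split; first exact: hull_incl hx.
  have : hull l2 x by exact: hull_incl hx.
  by rewrite -ge1 => -[].
rewrite -le1 -ge1 -ln1; apply: v_cut.
- by apply: body_hull; case: (l1) (ml1 _ ym).
- by exists y; rewrite le1; apply/mem_hull/ml1.
- by exists y; rewrite ge1; apply/mem_hull/ml2.
Qed.

Lemma tri_elim a b c z : tri a b c z -> exists t r, [/\ 0 <= t <= 1, 0 <= r <= 1 &
  z = padd (pscale t a) (pscale (1 - t) (padd (pscale r b) (pscale (1 - r) c)))].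
Proof.
case=> [->|[t [y [t01 hy ->]]]].
  exists 1, 0; split; rewrite ?ler01 ?lexx//.
  by apply: pt_eq => /=; ring.
have {hy} [r [r01 ->]] : seg b c y by rewrite -hull_seg.
by exists t, r.
Qed.

Lemma tri_permC a b c : tri a b c = tri b a c.
Proof. by apply/seteqP; split; apply: hull_incl => x; rewrite !inE orbCA. Qed.

Lemma tri_permR a b c : tri a b c = tri a c b.
Proof.
by apply/seteqP; split; apply: hull_incl => x; rewrite !inE [(x == b) || _]orbC.
Qed.

Lemma seg_sym a b : seg a b = seg b a.
Proof.
by rewrite -!hull_seg; apply/seteqP; split; apply: hull_incl => x; rewrite !inE orbC.
Qed.

Lemma tri_cut a b c d : cross (psub b a) (psub c a) != 0 -> seg b c d ->
  v (tri a b d) + v (tri a d c) = v (tri a b c) + v (seg a d).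
Proof.
have main b' c' : 0 < cross (psub b' a) (psub c' a) -> seg b' c' d ->
    v (tri a b' d) + v (tri a d c') = v (tri a b' c') + v (seg a d).
  move=> det [s [/andP[s0 s1] de]]; rewrite -hull_seg.
  have eK : hull ([:: a; b'; d] ++ [:: a; d; c']) = tri a b' c'.
    apply/seteqP; split; last by apply: hull_incl => x; rewrite !inE => /or3P[]->; rewrite ?orbT.
    apply: hull_sub; first exact: hull_convex.
    have hd : tri a b' c' d.
      rewrite de; apply: hull_convex; rewrite ?s0 ?s1//;
      by apply: mem_hull; rewrite !inE eqxx ?orbT.
    move=> x; rewrite !inE => /orP[/eqP->|/orP[/eqP->|/orP[/eqP->|/orP[/eqP->|/orP[/eqP->|/eqP->]]]]] //;
    by apply: mem_hull; rewrite !inE eqxx ?orbT.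
  (* d - a after a quarter-turn: the cut runs along the line through a and d, and the sign of the
     cross product puts b' and c' on opposite sides. *)
  rewrite -eK; pose n : pt R := (- (psub d a).2, (psub d a).1).
  have la : pdot n a = pdot n d by rewrite /n /pdot/=; ring.
  have lb : pdot n b' = pdot n a - (1 - s) * cross (psub b' a) (psub c' a).
    by rewrite /n de /pdot /cross/=; ring.
  have lc : pdot n c' = pdot n a + s * cross (psub b' a) (psub c' a).
    by rewrite /n de /pdot /cross/=; ring.
  apply: (cut_hull (n := n) (c := pdot n a)) => //.
  - by move=> x; rewrite !inE => /or3P[] /eqP-> //; rewrite ?lb ?la// -?la; nra.
  - by move=> x; rewrite !inE => /or3P[] /eqP-> //; rewrite ?lc ?la// -?la; nra.
  - by move=> x; rewrite !inE => /orP[] /eqP->; rewrite eqxx ?orbT.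
  - by move=> x; rewrite !inE => /orP[] /eqP->; rewrite eqxx ?orbT.
  rewrite eK => z [hz]; rewrite hull_seg /line/= => ez.
  have [t [r [t01 r01 ze]]] := tri_elim hz.
  have : (1 - t) * (s - r) * cross (psub b' a) (psub c' a) = 0.
    have <- : pdot n z - pdot n a = (1 - t) * (s - r) * cross (psub b' a) (psub c' a).
      transitivity ((1 - t) * (r * pdot n b' + (1 - r) * pdot n c' - pdot n a)).
        by rewrite ze /pdot/=; ring.
      by rewrite lb lc; ring.
    by rewrite ez subrr.
  move/eqP; rewrite !mulf_eq0 (gt_eqF det) orbF => /orP[/eqP t1|/eqP r1].
    have {}t1 : t = 1 by lra.
    exists 1; split; first by rewrite ler01 lexx.
    by rewrite ze t1; apply: pt_eq => /=; ring.
  exists t; split => //; rewrite ze de.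
  have -> : r = s by lra.
  by apply: pt_eq => /=; ring.
rewrite neq_lt => /orP[h|h] sd; last exact: main.
rewrite addrC (tri_permR a d c) (tri_permR a b d) (tri_permR a b c).
apply: main; last by rewrite seg_sym.
by move: h; rewrite /cross; lra.
Qed.

End CutAdditive.

Section Vanishing.
Variable R : realType.
Implicit Types (K L C M : set (pt R)) (u n p q x y z a b c d w : pt R) (l m : seq (pt R)).
Variable v : set (pt R) -> R.
Hypothesis v_cut : cut_additive v.
Hypothesis v_seg : forall a b, v (seg a b) = 0.
Hypothesis v_tri : forall a b c, v (tri a b c) = 0.

Lemma vertical_seg M (e : R) : convex_body M -> (forall x, M x -> x.1 = e) ->
  exists s t : R, s <= t /\ M = seg (e, s) (e, t).
Proof.
move=> bM hM; have [a Ma ea] := support_max (0, -1) bM; have [b Mb eb] := support_max (0, 1) bM.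
exists a.2, b.2.
have ax x : M x -> a.2 <= x.2.
  move=> Mx; have := support_ub (0, -1) bM Mx; rewrite ea /pdot/=; lra.
have bx x : M x -> x.2 <= b.2.
  move=> Mx; have := support_ub (0, 1) bM Mx; rewrite eb /pdot/=; lra.
split; first exact: ax.
have ea' : a = (e, a.2) by apply: pt_eq => //=; exact: hM.
have eb' : b = (e, b.2) by apply: pt_eq => //=; exact: hM.
apply/seteqP; split => [x Mx|]; last first.
  by rewrite -ea' -eb'; apply: seg_sub => //; have [_ []] := bM.
have h1 := ax x Mx; have h2 := bx x Mx.
have [ab|ab] := eqVneq a.2 b.2.
  have -> : x = (e, a.2) by apply: pt_eq => /=; [exact: hM | lra].
  exact: segL.
have ab' : 0 < b.2 - a.2 by rewrite subr_gt0 lt_neqAle ab ax.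
exists ((b.2 - x.2) / (b.2 - a.2)); split.
  by rewrite divr_ge0 ?subr_ge0 ?ax//= ler_pdivrMr//; lra.
apply: pt_eq => /=; first by rewrite hM//; ring.
by field; rewrite gt_eqF.
Qed.

Lemma vanish_columns (al be p1 p2 q1 q2 : R) : al < be -> p1 <= p2 -> q1 <= q2 ->
  v (hull [:: (al, p1); (al, p2); (be, q1); (be, q2)]) = 0.
Proof.
move=> ab p12 q12.
have -> : hull [:: (al, p1); (al, p2); (be, q1); (be, q2)] =
    hull ([:: (al, p1); (al, p2); (be, q1)] ++ [:: (al, p2); (be, q1); (be, q2)]).
  by apply/seteqP; split; apply: hull_incl => x; rewrite !inE;
    repeat case: eqP => //=.
(* Normal to the diagonal from (al, p2) to (be, q1), which splits the trapezoid into two possibly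
   degenerate triangles. *)
pose n : pt R := (p2 - q1, be - al).
have := @cut_hull _ _ v_cut [:: (al, p1); (al, p2); (be, q1)] [:: (al, p2); (be, q1); (be, q2)]
  [:: (al, p2); (be, q1)] n (pdot n (al, p2)).
have v_tri' a b c : v (hull [:: a; b; c]) = 0 by exact: v_tri.
rewrite !v_tri' hull_seg v_seg !addr0 => <- //.
- by move=> x; rewrite !inE => /or3P[] /eqP->; rewrite /pdot /n/=; nra.
- by move=> x; rewrite !inE => /or3P[] /eqP->; rewrite /pdot /n/=; nra.
- by move=> x; rewrite !inE => /orP[] /eqP->; rewrite eqxx ?orbT.
- by move=> x; rewrite !inE => /orP[] /eqP->; rewrite eqxx ?orbT.
move=> z [hz]; rewrite /line /pdot/= => ez.
have [za zb] : al <= z.1 /\ z.1 <= be.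
  have : [set z : pt R | al <= z.1 /\ z.1 <= be] z; last by [].
  apply: hull_sub hz => [x y t [x1 x2] [y1 y2] /andP[t0 t1]|x] /=; first by split; nra.
  by rewrite !inE; do 5 (case/orP; first (by move/eqP=> ->; split => /=; lra));
    move/eqP=> ->; split => /=; lra.
have dn : 0 < be - al by rewrite subr_gt0.
exists ((be - z.1) / (be - al)); split.
  by rewrite divr_ge0 ?subr_ge0 ?(ltW ab)//= ler_pdivrMr//; lra.
apply: pt_eq => /=; first by field; rewrite gt_eqF.
apply: (mulIf (negbT (gt_eqF dn))).
transitivity (al * (p2 - q1) + p2 * (be - al) - z.1 * (p2 - q1)); first by lra.
by field; rewrite gt_eqF.
Qed.

(** Induction on the number of distinct abscissas. A vertical cut at an abscissa e strictly between
    f and g gives a left part that misses g and a right part that misses f. With at most two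
    abscissas the hull is a vertical segment or a trapezoid with vertical sides. *)
Lemma vanish_hull l : l != [::] -> v (hull l) = 0.
Proof.
have [N] := ubnP (size (undup (map fst l))).
elim: N l => // N IH l hN l0.
have [[e [f [g [/mapP[x xl ex] /mapP[y yl ey] /mapP[w wl ew] ef eg]]]]|h] :=
    pselect (exists e f g : R, [/\ e \in map fst l, f \in map fst l, g \in map fst l,
      f < e & e < g]).
  have bl := body_hull l0.
  have xK := mem_hull xl; have yK := mem_hull yl; have wK := mem_hull wl.
  have pd (u : pt R) : pdot (1, 0) u = u.1 by rewrite /pdot/=; ring.
  have K1 : hull l `&` half_le (1, 0) e !=set0.
    by exists x; split => //; rewrite /half_le/= pd ex.
  have K2 : hull l `&` half_ge (1, 0) e !=set0.
    by exists x; split => //; rewrite /half_ge/= pd ex.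
  have K3 : hull l `&` line (1, 0) e !=set0.
    by exists x; split => //; rewrite /line/= pd ex.
  have hline z : (hull l `&` line (1, 0) e) z -> z.1 = e by move=> [_]; rewrite /line/= pd.
  have [s [t [st eM]]] := vertical_seg (body_line bl K3) hline.
  have := v_cut bl K1 K2; rewrite eM v_seg addr0 => <-.
  have sub : seg (e, s) (e, t) `<=` hull l by rewrite -eM => z [].
  (* The end points of the section are added to both parts. Their abscissa e already occurs, so the
     count does not grow. *)
  pose l1 := [seq z <- l | z.1 <= e] ++ [:: (e, s); (e, t)].
  pose l2 := [seq z <- l | e <= z.1] ++ [:: (e, s); (e, t)].
  have el : hull l = hull (l1 ++ l2).
    apply/seteqP; split.
      apply: hull_incl => z zl; rewrite !mem_cat !mem_filter zl !andbT.
      by have [h|/ltW h] := leP z.1 e; rewrite ?h ?orbT.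
    apply: hull_sub; first exact: hull_convex.
    move=> z; rewrite !mem_cat !mem_filter !inE.
    move=> /orP[/orP[/andP[_ h]|/orP[/eqP->|/eqP->]]|/orP[/andP[_ h]|/orP[/eqP->|/eqP->]]];
      try exact: mem_hull; apply: sub; (exact: segL || exact: segR).
  have m1 : {subset [:: (e, s); (e, t)] <= l1} by move=> z zm; rewrite mem_cat zm orbT.
  have m2 : {subset [:: (e, s); (e, t)] <= l2} by move=> z zm; rewrite mem_cat zm orbT.
  have hl1 z : z \in l1 -> pdot (1, 0) z <= e.
    by rewrite pd mem_cat mem_filter !inE => /orP[/andP[]//|/orP[]/eqP->].
  have hl2 z : z \in l2 -> e <= pdot (1, 0) z.
    by rewrite pd mem_cat mem_filter !inE => /orP[/andP[]//|/orP[]/eqP->].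
  have fin1 : hull (l1 ++ l2) `&` line (1, 0) e `<=` hull [:: (e, s); (e, t)].
    by rewrite -el eM hull_seg.
  have -> : hull l `&` half_le (1, 0) e = hull l1.
    by rewrite el; apply: (hull_cut (m := [:: (e, s); (e, t)])).
  have -> : hull l `&` half_ge (1, 0) e = hull l2.
    rewrite el half_geE (_ : hull (l1 ++ l2) = hull (l2 ++ l1)); last first.
      by apply/seteqP; split; apply: hull_incl => z; rewrite !mem_cat orbC.
    apply: (hull_cut (m := [:: (e, s); (e, t)])) => //.
    - by move=> z /hl2; rewrite /pdot/=; lra.
    - by move=> z /hl1; rewrite /pdot/=; lra.
    - rewrite -lineE (_ : hull (l2 ++ l1) = hull (l1 ++ l2))//.
      by apply/seteqP; split; apply: hull_incl => z; rewrite !mem_cat orbC.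
  have small l' o : o \in map fst l -> o \notin map fst l' ->
      {subset map fst l' <= map fst l} -> (size (undup (map fst l')) < N)%N.
    move=> ol ol' sub'; rewrite -ltnS; apply: leq_ltn_trans hN.
    suff : (size (o :: undup (map fst l')) <= size (undup (map fst l)))%N by [].
    apply: uniq_leq_size; first by rewrite /= mem_undup ol' undup_uniq.
    by move=> r; rewrite inE !mem_undup => /orP[/eqP->//|/sub'].
  have el' : e \in map fst l by rewrite ex map_f.
  rewrite !IH ?addr0//.
  - apply: (small _ f); first by rewrite ey map_f.
      apply/negP => /mapP[z zl ez]; have := hl2 _ zl; rewrite pd -ez; lra.
    move=> r /mapP[z]; rewrite mem_cat mem_filter !inE => /orP[/andP[_ zl]->|].
      exact: map_f.
    by case/orP=> /eqP-> ->.
  - by rewrite -size_eq0 /l2 size_cat addn2.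
  - apply: (small _ g); first by rewrite ew map_f.
      apply/negP => /mapP[z zl ez]; have := hl1 _ zl; rewrite pd -ez; lra.
    move=> r /mapP[z]; rewrite mem_cat mem_filter !inE => /orP[/andP[_ zl]->|].
      exact: map_f.
    by case/orP=> /eqP-> ->.
  - by rewrite -size_eq0 /l1 size_cat addn2.
have [x0 x0l] : exists x, x \in l by case: (l) l0 => // x s _; exists x; rewrite mem_head.
have [hall|/existsNP[y /not_implyP[yl yx]]] := pselect (forall x, x \in l -> x.1 = x0.1).
  have [|s [t [_ ->]]] := @vertical_seg (hull l) x0.1 (body_hull l0); last exact: v_seg.
  move=> z hz; have : [set z : pt R | z.1 = x0.1] z; last by [].
  apply: hull_sub hz => [a b t /= ha hb _|w /hall //].
  by rewrite ha hb; ring.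
have [al [be [ab [xa xb allab]]]] : exists al be : R, al < be /\
    [/\ exists2 x, x \in l & x.1 = al, exists2 x, x \in l & x.1 = be &
    forall x, x \in l -> x.1 = al \/ x.1 = be].
  (* A third abscissa would place one of the three strictly between the others, against [h]. *)
  have third z : z \in l -> z.1 = x0.1 \/ z.1 = y.1.
    move=> zl; apply: contrapT => /not_orP[n1 n2]; apply: h.
    have fz := map_f fst zl; have fy := map_f fst yl; have fx := map_f fst x0l.
    have [l1|l1|//] := ltgtP z.1 x0.1; have [l2|l2|//] := ltgtP z.1 y.1;
      have [l3|l3|//] := ltgtP y.1 x0.1;
    first
      [ by exists z.1, x0.1, y.1; split | by exists z.1, y.1, x0.1; split
      | by exists y.1, z.1, x0.1; split | by exists y.1, x0.1, z.1; split
      | by exists x0.1, z.1, y.1; split | by exists x0.1, y.1, z.1; split | exfalso; lra ].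
  have [lt|lt|//] := ltgtP y.1 x0.1.
    exists y.1, x0.1; split=> //; split; [by exists y| by exists x0|].
    by move=> z /third[]; [right|left].
  by exists x0.1, y.1; split=> //; split; [exists x0| exists y|].
have column (o : R) : (exists2 x, x \in l & x.1 = o) ->
    exists s t : R, s <= t /\ hull [seq z <- l | z.1 == o] = seg (o, s) (o, t).
  move=> [x xl xo]; apply: vertical_seg.
    apply: body_hull; apply/eqP => e0; have : x \in [seq z <- l | z.1 == o].
      by rewrite mem_filter xo eqxx.
    by rewrite e0.
  move=> z hz; have : [set z : pt R | z.1 = o] z; last by [].
  apply: hull_sub hz => [a b t /= ha hb _|w /=]; first by rewrite ha hb; ring.
  by rewrite mem_filter => /andP[/eqP].
have [p1 [p2 [p12 ep]]] := column _ xa; have [q1 [q2 [q12 eq]]] := column _ xb.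
rewrite (_ : hull l = hull [:: (al, p1); (al, p2); (be, q1); (be, q2)]).
  exact: vanish_columns.
have sub' (o s t : R) m : hull [seq z <- l | z.1 == o] = seg (o, s) (o, t) ->
    {subset [:: (o, s); (o, t)] <= m} -> forall x, x \in l -> x.1 = o -> hull m x.
  move=> eo om x xl xo; apply: (hull_incl om); rewrite hull_seg -eo.
  by apply: mem_hull; rewrite mem_filter xo eqxx.
have sup' (o s t : R) : hull [seq z <- l | z.1 == o] = seg (o, s) (o, t) ->
    seg (o, s) (o, t) `<=` hull l.
  by move=> <-; apply: hull_incl => z; rewrite mem_filter => /andP[].
apply/seteqP; split; apply: hull_sub; try exact: hull_convex.
  move=> x xl; case: (allab x xl) => xo.
    by apply: (sub' _ _ _ _ ep) => // z; rewrite !inE => /orP[]->; rewrite ?orbT.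
  by apply: (sub' _ _ _ _ eq) => // z; rewrite !inE => /orP[]->; rewrite ?orbT.
move=> x; rewrite !inE => /or4P[] /eqP->; [apply: (sup' _ _ _ ep)|apply: (sup' _ _ _ ep)|
  apply: (sup' _ _ _ eq)|apply: (sup' _ _ _ eq)]; (exact: segL || exact: segR).
Qed.

(** Along the filter of finite lists in K ordered by inclusion, compactness in its near-covering
    form yields a finite r-net of K. The hull of the net stays inside K by convexity. *)
Lemma hull_dense K (r : R) : convex_body K -> 0 < r ->
  exists l, [/\ l != [::] & close K (hull l) r].
Proof.
move=> [[x0 Kx0] [cK vK]] r0.
pose F : set_system (seq (pt R)) := [set S : set (seq (pt R)) |
  exists2 l0 : seq (pt R), (forall x, x \in l0 -> K x) & forall l, {subset l0 <= l} ->
    (forall x, x \in l -> K x) -> S l].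
have FF : Filter F.
  split; first by exists [::].
    move=> P Q [l1 k1 h1] [l2 k2 h2]; exists (l1 ++ l2).
      by move=> x; rewrite mem_cat => /orP[/k1|/k2].
    move=> l sl kl; split; [apply: h1|apply: h2] => // x xl; apply: sl;
    by rewrite mem_cat xl ?orbT.
  by move=> P Q PQ [l1 k1 h1]; exists l1 => // l sl kl; apply/PQ/h1.
move/compact_near_coveringP/(_ _ F (fun (l : seq (pt R)) x => exists2 y, y \in l & sqdist x y <= r ^+ 2) FF): cK.
case=> [x Kx|l0 k0 /(_ (x0 :: l0)) cov].
  exists ([set y | sqdist y x < r ^+ 2], [set l : seq (pt R) | x \in l /\ True]) => /=.
    split.
      apply: open_nbhs_nbhs; split; last by rewrite /= /sqdist !subrr expr0n/= addr0 exprn_gt0.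
      apply: (@open_comp _ _ (@sqdist R ^~ x) [set t | t < r ^+ 2]); last exact: open_lt.
      by move=> y _; exact: continuous_sqdist.
    exists [:: x] => [y|l sl _]; first by rewrite inE => /eqP->.
    by split => //; apply: sl; rewrite mem_head.
  by move=> [y l] /= [/ltW h [xl _]]; exists x.
exists (x0 :: l0); split => //.
have kl x : x \in x0 :: l0 -> K x by rewrite inE => /orP[/eqP->//|/k0].
split => [|x Kx|x hx]; first exact: ltW.
- have [|y yl hy] := cov _ kl x Kx; first by move=> y yl; rewrite inE yl orbT.
  by exists y => //; exact: mem_hull.
- exists x; last by rewrite /sqdist !subrr expr0n/= addr0 exprn_ge0 ?ltW.
  exact: hull_sub hx.
Qed.

Lemma vanish_body K : (forall e, 0 < e -> exists2 d, 0 < d & forall L r, convex_body L ->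
    r < d -> close K L r -> `|v K - v L| < e) ->
  convex_body K -> v K = 0.
Proof.
move=> cv bK; apply/eqP; apply: contraT => vn.
have vK0 : 0 < `|v K| by rewrite normr_gt0.
have [d d0 hd] := cv _ vK0.
have d20 : 0 < d / 2 by rewrite divr_gt0.
have [l [l0 cl]] := hull_dense bK d20.
have d2d : d / 2 < d by lra.
by have := hd _ _ (body_hull l0) d2d cl; rewrite vanish_hull// subr0 ltxx.
Qed.

End Vanishing.

(** * The Steiner point *)

Section PeriodicIntegral.
Variable R : realType.
Implicit Types f g : R -> R.
Notation mu := (@lebesgue_measure R).
Local Notation I a b f := (\int[mu]_(t in `[a, b]%classic) f t).

Lemma integrable_continuous f (a b : R) : continuous f -> mu.-integrable `[a, b] (EFin \o f).
Proof.
move=> cf; apply: continuous_compact_integrable; first exact: segment_compact.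
exact: continuous_subspaceT.
Qed.

Lemma integral_split f (a b c : R) : continuous f -> a <= b -> b <= c ->
  I a c f = I a b f + I b c f.
Proof.
move=> cf ab bc; have := @Rintegral_itvB R f (BLeft a) (BRight c) b (integrable_continuous _ _ cf).
rewrite !bnd_simp => /(_ ab bc); rewrite Rintegral_itv_obnd_cbnd => [<-|]; first by rewrite addrC subrK.
apply: integrableS (integrable_continuous b c cf) => //.
by apply: subset_itvr; rewrite bnd_simp.
Qed.

Lemma integral_shift f (a b r : R) : continuous f -> a <= b ->
  I a b (fun t => f (t + r)) = I (a + r) (b + r) f.
Proof.
move=> cf ab; have dF x : is_derive x (1 : R) (fun t : R => t + r) 1.
  by rewrite -[X in is_derive _ _ _ X]addr0; apply: is_deriveD.
have F' : derive1 (fun t : R => t + r) = cst 1.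
  by apply/funext => x; rewrite derive1E derive_val.
have cF : continuous (fun t : R => t + r).
  by move=> x; apply: cvgD; [exact: cvg_id | exact: cvg_cst].
rewrite /Rintegral (@integration_by_substitution_increasing _ (fun t => t + r) f a b) => //.
- by congr fine; apply: eq_integral => x _; rewrite F' /= mulr1.
- by move=> x y _ _ xy; rewrite ltrD2r.
- by rewrite F' => x _; exact: cvg_cst.
- by rewrite F'; exact: is_cvg_cst.
- by rewrite F'; exact: is_cvg_cst.
- split; first by move=> x _; exact: ex_derive.
  + exact/cvg_at_right_filter/cF.
  + exact/cvg_at_left_filter/cF.
- exact: continuous_subspaceT.
Qed.

Lemma integral_periodic f (p r : R) : continuous f -> 0 <= r -> r <= p ->
  (forall t, f (t + p) = f t) -> I 0 p (fun t => f (t + r)) = I 0 p f.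
Proof.
move=> cf r0 rp fp; rewrite integral_shift//; last exact: le_trans rp.
rewrite add0r (@integral_split _ r p)//; last by rewrite lerDl.
rewrite (@integral_split _ 0 r p)// addrC; congr (_ + _).
have -> : I p (p + r) f = I (0 + p) (r + p) f by rewrite add0r addrC.
rewrite -integral_shift//; by apply: eq_Rintegral => x _; rewrite fp.
Qed.

Lemma integral_FTC f F (a b : R) : a < b -> continuous f -> (forall x : R, is_derive x (1 : R) F (f x)) ->
  I a b f = F b - F a.
Proof.
move=> ab cf dF; have cF : continuous F.
  move=> x; apply: differentiable_continuous; apply/derivable1_diffP.
  exact: ex_derive.
rewrite /Rintegral (@continuous_FTC2 _ f F)//.
- exact: continuous_subspaceT.
- split; first by move=> x _; exact: ex_derive.
  + exact/cvg_at_right_filter/cF.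
  + exact/cvg_at_left_filter/cF.
- by move=> x _; rewrite derive1E derive_val.
Qed.

Lemma integral_linear f g (k : R) (a b : R) : continuous f -> continuous g ->
  I a b (fun t => f t + k * g t) = I a b f + k * I a b g.
Proof.
move=> cf cg; rewrite RintegralD//=.
- by rewrite RintegralZl//; exact: integrable_continuous.
- exact: integrable_continuous.
- apply: integrable_continuous => x; apply: cvgM; [exact: cvg_cst | exact: cg].
Qed.

Lemma integral_cos2 : I 0 (2 * pi) (fun t => cos t * cos t) = pi.
Proof.
have dF (x : R) : is_derive x (1 : R) (fun t : R => 2^-1 * (t + sin t * cos t)) (cos x * cos x).
  apply: is_derive_eq; rewrite /GRing.scale/=; have := cos2Dsin2 x; rewrite !expr2 => h.
  by rewrite ?mulrN; lra.
rewrite (integral_FTC _ _ dF).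
- by rewrite mulr_natl sin2pi sin0 !mul0r; lra.
- by rewrite mulr_gt0// pi_gt0.
- by move=> x; apply: cvgM; exact: continuous_cos.
Qed.

Lemma integral_sin2 : I 0 (2 * pi) (fun t => sin t * sin t) = pi.
Proof.
have dF (x : R) : is_derive x (1 : R) (fun t : R => 2^-1 * (t - sin t * cos t)) (sin x * sin x).
  apply: is_derive_eq; rewrite /GRing.scale/=; have := cos2Dsin2 x; rewrite !expr2 => h.
  by rewrite ?mulrN; lra.
rewrite (integral_FTC _ _ dF).
- by rewrite mulr_natl sin2pi sin0 !mul0r; lra.
- by rewrite mulr_gt0// pi_gt0.
- by move=> x; apply: cvgM; exact: continuous_sin.
Qed.

Lemma integral_cossin : I 0 (2 * pi) (fun t => cos t * sin t) = 0.
Proof.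
have dF (x : R) : is_derive x (1 : R) (fun t : R => 2^-1 * (sin t * sin t)) (cos x * sin x).
  by apply: is_derive_eq; rewrite /GRing.scale/=; field.
rewrite (integral_FTC _ _ dF).
- by rewrite mulr_natl sin2pi sin0; lra.
- by rewrite mulr_gt0// pi_gt0.
- by move=> x; apply: cvgM; [exact: continuous_cos | exact: continuous_sin].
Qed.

Lemma angle_exists (c s : R) : is_SO2 c s ->
  exists al, [/\ 0 <= al, al <= 2 * pi, cos al = c & sin al = s].
Proof.
rewrite /is_SO2 => cs; have c1 : -1 <= c <= 1.
  have := sqr_ge0 s; rewrite -ler_norml => s0.
  by rewrite -(@ler_pXn2r _ 2%N)// ?nnegrE// expr1n real_normK ?num_real//; lra.
have ccos := acosK (_ : c \in `[-1, 1]); rewrite in_itv/= in ccos.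
have es : Num.sqrt (1 - c ^+ 2) = `|s| by rewrite -sqrtr_sqr; congr Num.sqrt; lra.
have [s0|s0] := leP 0 s.
  exists (acos c); split; [exact: acos_ge0| |exact: ccos|].
  - by have := acos_lepi c1; have := @pi_ge0 R; lra.
  - by rewrite sin_acos// es ger0_norm.
exists (2 * pi - acos c); split.
- by have := acos_lepi c1; have := @pi_ge0 R; lra.
- by have := acos_ge0 c1; lra.
- by rewrite cosB mulr_natl cos2pi sin2pi ccos//; lra.
- by rewrite sinB mulr_natl cos2pi sin2pi sin_acos// es ltr0_norm//; lra.
Qed.

End PeriodicIntegral.

Section Steiner.
Variable R : realType.
Implicit Types (K L : set (pt R)) (u p q : pt R).
Notation mu := (@lebesgue_measure R).
Local Notation I f := (\int[mu]_(t in `[0, 2 * pi]%classic) f t).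

Definition circ K (t : R) : R := support K (cos t, sin t).

(** By sublinearity the support function is at most B times the l1 norm, with B read off from the
    four unit vectors of the axes. Subadditivity turns this bound into a Lipschitz estimate. *)
Lemma continuous_circ K : convex_body K -> continuous (circ K).
Proof.
move=> bK.
pose B := 1 + (`|support K (1, 0)| + `|support K (-1, 0)| + `|support K (0, 1)| + `|support K (0, -1)|).
have B0 : 0 < B by rewrite ltr_pwDl// !addr_ge0.
have bnd u : support K u <= B * (`|u.1| + `|u.2|).
  have -> : u = padd (u.1, 0) (0, u.2) by apply: pt_eq => /=; ring.
  rewrite /= addr0 add0r; apply: le_trans (supportD _ _ bK) _.
  have n1 := normr_ge0 u.1; have n2 := normr_ge0 u.2.
  have k1 := ler_norm (support K (1, 0)); have k2 := ler_norm (support K (-1, 0)).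
  have k3 := ler_norm (support K (0, 1)); have k4 := ler_norm (support K (0, -1)).
  have j1 := normr_ge0 (support K (1, 0)); have j2 := normr_ge0 (support K (-1, 0)).
  have j3 := normr_ge0 (support K (0, 1)); have j4 := normr_ge0 (support K (0, -1)).
  have h1 : support K (u.1, 0) <= B * `|u.1|.
    have [p0|p0] := leP 0 u.1.
      have -> : (u.1, 0) = pscale `|u.1| (1, 0) by rewrite ger0_norm//; apply: pt_eq => /=; ring.
      by rewrite supportZ// mulrC ler_wpM2r// /B; lra.
    have -> : (u.1, 0) = pscale `|u.1| (-1, 0) by rewrite ltr0_norm//; apply: pt_eq => /=; ring.
    by rewrite supportZ// mulrC ler_wpM2r// /B; lra.
  have h2 : support K (0, u.2) <= B * `|u.2|.
    have [p0|p0] := leP 0 u.2.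
      have -> : (0, u.2) = pscale `|u.2| (0, 1) by rewrite ger0_norm//; apply: pt_eq => /=; ring.
      by rewrite supportZ// mulrC ler_wpM2r// /B; lra.
    have -> : (0, u.2) = pscale `|u.2| (0, -1) by rewrite ltr0_norm//; apply: pt_eq => /=; ring.
    by rewrite supportZ// mulrC ler_wpM2r// /B; lra.
  lra.
have lip (a b : R) : circ K a - circ K b <= B * (`|cos b - cos a| + `|sin b - sin a|).
  have -> : circ K a = support K (padd (cos b, sin b) (cos a - cos b, sin a - sin b)).
    by congr (support K _); apply: pt_eq => /=; ring.
  have := supportD (cos b, sin b) (cos a - cos b, sin a - sin b) bK.
  have := bnd (cos a - cos b, sin a - sin b).
  by rewrite /= (distrC (cos a)) (distrC (sin a)) /circ; lra.
move=> x; apply/cvgrPdist_lt => e e0.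
have e1 : 0 < e / (2 * B) by rewrite divr_gt0// mulr_gt0.
have /cvgrPdist_lt/(_ _ e1) hc := @continuous_cos R x.
have /cvgrPdist_lt/(_ _ e1) hs := @continuous_sin R x.
near=> y.
have h1 : `|cos x - cos y| < e / (2 * B) by near: y.
have h2 : `|sin x - sin y| < e / (2 * B) by near: y.
have l1 := lip x y; have l2 := lip y x.
rewrite (distrC (cos y)) (distrC (sin y)) in l1.
have : B * (`|cos x - cos y| + `|sin x - sin y|) < e.
  have -> : e = B * (e / (2 * B) + e / (2 * B)) by field; rewrite gt_eqF.
  by rewrite ltr_pM2l// ltrD.
by rewrite ltr_norml => h; apply/andP; split; lra.
Unshelve. all: end_near. Qed.

Lemma continuousM_circ K (g : R -> R) : convex_body K -> continuous g ->
  continuous (fun t => circ K t * g t).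
Proof. by move=> bK cg x; apply: cvgM; [exact: continuous_circ | exact: cg]. Qed.

Lemma steiner1 K : (steiner K).1 = pi^-1 * I (fun t => circ K t * cos t).
Proof. by []. Qed.

Lemma steiner2 K : (steiner K).2 = pi^-1 * I (fun t => circ K t * sin t).
Proof. by []. Qed.

(** The integral of <u, p> u over the circle is pi p, which explains the factor 1/pi in the Steiner
    point. *)
Lemma steiner_ktrans K p : convex_body K -> steiner (ktrans K p) = padd (steiner K) p.
Proof.
move=> bK; have pi0 : pi != 0 :> R by rewrite gt_eqF// pi_gt0.
have e t : circ (ktrans K p) t = circ K t + (cos t * p.1 + sin t * p.2).
  by rewrite /circ support_ktrans.
have cc : continuous (fun t : R => cos t * cos t).
  by move=> x; apply: cvgM; exact: continuous_cos.
have cs : continuous (fun t : R => cos t * sin t).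
  by move=> x; apply: cvgM; [exact: continuous_cos| exact: continuous_sin].
have ss : continuous (fun t : R => sin t * sin t).
  by move=> x; apply: cvgM; exact: continuous_sin.
have lc f g h (k l : R) : continuous f -> continuous g -> continuous h ->
    I (fun t => (f t + k * g t) + l * h t) = I f + k * I g + l * I h.
  move=> cf cg ch; rewrite integral_linear ?integral_linear//.
  by move=> x; apply: cvgD; [exact: cf | apply: cvgM; [exact: cvg_cst|exact: cg]].
have kc := continuousM_circ bK (@continuous_cos R).
have ks := continuousM_circ bK (@continuous_sin R).
apply: pt_eq.
- change ((steiner (ktrans K p)).1 = (steiner K).1 + p.1); rewrite !steiner1.
  transitivity (pi^-1 * I (fun t => circ K t * cos t + p.1 * (cos t * cos t) + p.2 * (cos t * sin t))).
    by congr (_ * _); apply: eq_Rintegral => t _; rewrite e; ring.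
  by rewrite lc// integral_cos2 integral_cossin mulr0 addr0 mulrDr [p.1 * _]mulrC mulKf.
- change ((steiner (ktrans K p)).2 = (steiner K).2 + p.2); rewrite !steiner2.
  transitivity (pi^-1 * I (fun t => circ K t * sin t + p.1 * (cos t * sin t) + p.2 * (sin t * sin t))).
    by congr (_ * _); apply: eq_Rintegral => t _; rewrite e; ring.
  by rewrite lc// integral_sin2 integral_cossin mulr0 addr0 mulrDr [p.2 * _]mulrC mulKf.
Qed.

(** Substituting t + al for t costs nothing, since the integrand has period 2 pi. *)
Lemma steiner_krot K (c s : R) : is_SO2 c s -> convex_body K ->
  steiner (krot c s K) = rot c s (steiner K).
Proof.
move=> cs bK; have [al [al0 alp ec es]] := angle_exists cs.
have e t : circ (krot c s K) (t + al) = circ K t.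
  rewrite /circ support_krot//; congr (support K _).
  have h := cs; rewrite /is_SO2 !expr2 in h.
  apply: pt_eq; rewrite /= cosD sinD ec es.
    by rewrite -[RHS]mulr1 -h; ring.
  by rewrite -[RHS]mulr1 -h; ring.
have kc := continuousM_circ bK (@continuous_cos R).
have ks := continuousM_circ bK (@continuous_sin R).
have bK' := body_krot c s bK.
have kc' := continuousM_circ bK' (@continuous_cos R).
have ks' := continuousM_circ bK' (@continuous_sin R).
have cp t : circ (krot c s K) (t + 2 * pi) = circ (krot c s K) t.
  by rewrite /circ mulr_natl cosD2pi sinD2pi.
apply: pt_eq.
- change ((steiner (krot c s K)).1 = c * (steiner K).1 - s * (steiner K).2).
  rewrite !steiner1 !steiner2.
  transitivity (pi^-1 * I (fun t => circ (krot c s K) (t + al) * cos (t + al))).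
    congr (_ * _); rewrite (@integral_periodic _ (fun t => circ (krot c s K) t * cos t))// => t.
    by rewrite cp mulr_natl cosD2pi.
  transitivity (pi^-1 * I (fun t => 0 + c * (circ K t * cos t) + (- s) * (circ K t * sin t))).
    by congr (_ * _); apply: eq_Rintegral => t _; rewrite e cosD ec es; ring.
  rewrite (@integral_linear _ (fun t => 0 + c * (circ K t * cos t)))//; last first.
    by move=> x; apply: cvgD; [exact: cvg_cst | apply: cvgM; [exact: cvg_cst|exact: kc]].
  rewrite (@integral_linear _ (cst 0))//; last by move=> x; exact: cvg_cst.
  by rewrite Rintegral_cst//= mul0r; ring.
- change ((steiner (krot c s K)).2 = s * (steiner K).1 + c * (steiner K).2).
  rewrite !steiner1 !steiner2.
  transitivity (pi^-1 * I (fun t => circ (krot c s K) (t + al) * sin (t + al))).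
    congr (_ * _); rewrite (@integral_periodic _ (fun t => circ (krot c s K) t * sin t))// => t.
    by rewrite cp mulr_natl sinD2pi.
  transitivity (pi^-1 * I (fun t => 0 + s * (circ K t * cos t) + c * (circ K t * sin t))).
    by congr (_ * _); apply: eq_Rintegral => t _; rewrite e sinD ec es; ring.
  rewrite (@integral_linear _ (fun t => 0 + s * (circ K t * cos t)))//; last first.
    by move=> x; apply: cvgD; [exact: cvg_cst | apply: cvgM; [exact: cvg_cst|exact: kc]].
  rewrite (@integral_linear _ (cst 0))//; last by move=> x; exact: cvg_cst.
  by rewrite Rintegral_cst//= mul0r; ring.
Qed.

(** In the plane the point reflection is a half-turn, so rotation covariance controls it. *)
Lemma krefl_krot K : krefl K = krot (-1) 0 K.
Proof.
by congr (_ @` K); apply/funext => p; apply: pt_eq => /=; ring.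
Qed.

Lemma steiner_cut u : cut_additive (fun K => pdot u (steiner K)).
Proof.
move=> K n c bK K1 K2; have [_ [_ vK]] := bK.
have b1 := body_half_le bK K1; have b2 := body_half_ge bK K2.
have b3 := body_line bK (cut_line_nonempty vK K1 K2).
have main (g : R -> R) : continuous g ->
    I (fun t => circ (K `&` half_le n c) t * g t) + I (fun t => circ (K `&` half_ge n c) t * g t) =
    I (fun t => circ K t * g t) + I (fun t => circ (K `&` line n c) t * g t).
  move=> cg; rewrite -[X in _ + X]mul1r -[X in _ = _ + X]mul1r.
  rewrite -!integral_linear//; try exact: continuousM_circ.
  by apply: eq_Rintegral => t _; rewrite !mul1r -!mulrDl /circ support_cut.
have hc := main _ (@continuous_cos R); have hs := main _ (@continuous_sin R).
rewrite /pdot !steiner1 !steiner2.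
transitivity (u.1 * pi^-1 * (I (fun t => circ (K `&` half_le n c) t * cos t) + I (fun t => circ (K `&` half_ge n c) t * cos t))
  + u.2 * pi^-1 * (I (fun t => circ (K `&` half_le n c) t * sin t) + I (fun t => circ (K `&` half_ge n c) t * sin t))).
  by ring.
by rewrite hc hs; ring.
Qed.

(** On the unit circle the support functions differ by at most 2r, because |cos| + |sin| <= 2.
    Integration over length 2 pi and division by pi give the constant 4. *)
Lemma steiner_close K L (r : R) u : convex_body K -> convex_body L -> close K L r ->
  `|pdot u (steiner K) - pdot u (steiner L)| <= r * (4 * (`|u.1| + `|u.2|)).
Proof.
move=> bK bL cl; have r0 : 0 <= r by case: cl.
have pi0 : 0 < pi :> R by exact: pi_gt0.
have pt2 : 0 <= 2 * pi :> R by rewrite mulr_ge0// ltW.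
have hb t : `|circ K t - circ L t| <= 2 * r.
  apply: le_trans (close_support (cos t, sin t) bK bL cl) _.
  rewrite mulrC ler_wpM2r//=; have := cos_max t; have := sin_max t; lra.
have main (g : R -> R) : continuous g -> (forall t, `|g t| <= 1) ->
    `|I (fun t => circ K t * g t) - I (fun t => circ L t * g t)| <= 4 * pi * r.
  move=> cg g1; rewrite -RintegralB//=; try (apply: integrable_continuous; exact: continuousM_circ).
  have cd : continuous (fun t => circ K t * g t - circ L t * g t).
    by move=> x; apply: cvgB; exact: continuousM_circ.
  apply: le_trans (le_normr_Rintegral _ _) _ => //.
    by apply: integrable_continuous.
  have -> : 4 * pi * r = I (cst (2 * r)).
    rewrite Rintegral_cst//= lebesgue_measure_itv/= lte_fin.
    by rewrite mulr_gt0//= subr0; ring.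
  apply: le_Rintegral => //=.
  - by apply: integrable_continuous => x; apply: cvg_norm; exact: cd.
  - by apply: integrable_continuous => x; exact: cvg_cst.
  move=> t _; rewrite -mulrBl normrM; apply: le_trans (hb t).
  by rewrite ler_piMr.
have hc := main _ (@continuous_cos R) (@cos_max R).
have hs := main _ (@continuous_sin R) (@sin_max R).
rewrite /pdot !steiner1 !steiner2.
have -> : u.1 * (pi^-1 * I (fun t => circ K t * cos t)) + u.2 * (pi^-1 * I (fun t => circ K t * sin t)) -
  (u.1 * (pi^-1 * I (fun t => circ L t * cos t)) + u.2 * (pi^-1 * I (fun t => circ L t * sin t))) =
  u.1 * (pi^-1 * (I (fun t => circ K t * cos t) - I (fun t => circ L t * cos t))) +
  u.2 * (pi^-1 * (I (fun t => circ K t * sin t) - I (fun t => circ L t * sin t))) by ring.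
apply: le_trans (ler_normD _ _) _.
have sc a : `|a| <= 4 * pi * r -> `|pi^-1 * a| <= 4 * r.
  move=> ha; rewrite normrM gtr0_norm ?invr_gt0// mulrC ler_pdivrMr//; lra.
have fin (a b x y k : R) : `|x| <= k -> `|y| <= k -> `|a * x| + `|b * y| <= k * (`|a| + `|b|).
  move=> hx hy; rewrite !normrM mulrDr; apply: lerD; rewrite mulrC ler_wpM2r//.
rewrite (_ : r * (4 * _) = 4 * r * (`|u.1| + `|u.2|)); last by ring.
by apply: fin; exact: sc.
Qed.

End Steiner.

(** * Area *)

Section Area.
Variable R : realType.
Implicit Types (K L : set (pt R)) (u p q : pt R).
Notation mu := (@lebesgue_measure R).

Lemma lebesgue_measure_translate (A : set R) (r : R) : measurable A ->
  mu ((fun y => y + r) @` A) = mu A.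
Proof.
move=> mA.
have mf : measurable_fun [set: R] (fun y : R => y - r : measurableTypeR R).
  by apply: continuous_measurable_fun => x; apply: cvgB; [exact: cvg_id | exact: cvg_cst].
have -> : (fun y => y + r) @` A = (fun y : R => y - r) @^-1` A.
  apply/seteqP; split => [_ [y Ay <-]|y Ay] /=; first by rewrite addrK.
  by exists (y - r) => //; rewrite subrK.
rewrite -[LHS]/(pushforward mu (fun y : R => y - r : measurableTypeR R) A).
apply/esym; apply: (@lebesgue_measure_unique R (pushforward mu _)) => //.
move=> _ [[a b]] _ <- /=; rewrite /pushforward /=.
have -> : (fun y : R => y - r) @^-1` `]a, b]%classic = `]a + r, b + r]%classic.
  by apply/seteqP; split => y /=; rewrite !in_itv/= ltrBrDr lerBlDr.
rewrite /= !lebesgue_measure_itv/= !lte_fin ltrD2r.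
by case: ifP => // _; congr (_%:E); ring.
Qed.

(** Each point of U lies in an open square inside U with rational centre and half-width, and such
    squares are countable. Squares that are not inside U are replaced by the empty set, so that the
    union runs over a whole countable type. *)
Lemma measurable_open_plane (U : set (pt R)) : open U ->
  measurable (U : set (measurableTypeR R * measurableTypeR R)).
Proof.
move=> oU.
pose B (z : rat * rat * rat) : set (pt R) :=
  `](ratr z.1.1 - ratr z.2), (ratr z.1.1 + ratr z.2)[%classic `*`
  `](ratr z.1.2 - ratr z.2), (ratr z.1.2 + ratr z.2)[%classic.
have -> : U = \bigcup_(z in [set: rat * rat * rat]) (if `[< B z `<=` U >] then B z else set0).
  apply/seteqP; split => [x Ux|x [z _]]; last by case: asboolP => // + h; exact.
  have /nbhs_ballP[e /= e0 he] := open_nbhs_nbhs (conj oU Ux).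
  have e2 : 0 < e / 2 by rewrite divr_gt0.
  have [r] := rat_in_itvoo e2; rewrite in_itv/= => /andP[r0 re].
  have l1 : x.1 - ratr r < x.1 + ratr r by lra.
  have l2 : x.2 - ratr r < x.2 + ratr r by lra.
  have [a] := rat_in_itvoo l1; rewrite in_itv/= => /andP[a1 a2].
  have [b] := rat_in_itvoo l2; rewrite in_itv/= => /andP[b1 b2].
  exists (a, b, r) => //; case: asboolP => [_|[]].
    by split; rewrite /= in_itv/=; apply/andP; split; lra.
  move=> y [] /=; rewrite !in_itv/= => /andP[y1 y2] /andP[y3 y4]; apply: he.
  by split; rewrite /ball/= ltr_norml; apply/andP; split; lra.
apply: countable_bigcupT_measurable => [|z]; first exact: countableP.
case: asboolP => // _; apply: measurableX; exact: measurable_itv.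
Qed.

Lemma compact_measurable_plane K : compact K ->
  measurable (K : set (measurableTypeR R * measurableTypeR R)).
Proof.
move=> cK; rewrite -(setCK K); apply: measurableC; apply: measurable_open_plane.
rewrite openC; apply: compact_closed => //; apply: norm_hausdorff.
Qed.

Lemma area_le K L : compact K -> compact L -> K `<=` L -> (area K <= area L)%E.
Proof.
move=> cK cL KL; apply: le_measure => //; rewrite inE; exact: compact_measurable_plane.
Qed.

Definition rect (a b c d : R) : set (pt R) := `[a, b]%classic `*` `[c, d]%classic.

Lemma compact_rect a b c d : compact (rect a b c d).
Proof. by apply: compact_setX; exact: segment_compact. Qed.

Lemma area_rect a b c d : a <= b -> c <= d -> area (rect a b c d) = ((b - a) * (d - c))%:E.
Proof.
move=> ab cd; rewrite /area /rect product_measure1E; try exact: measurable_itv.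
rewrite /= !lebesgue_measure_itv/= !lte_fin EFinM; congr (_ * _)%E.
  by case: ltP => // ba; rewrite (_ : b - a = 0)//; lra.
by case: ltP => // ba; rewrite (_ : d - c = 0)//; lra.
Qed.

Definition area_preserving (f : pt R -> pt R) :=
  forall K, compact K -> compact (f @` K) /\ area (f @` K) = area K.

Lemma area_preserving_comp f g : area_preserving f -> area_preserving g ->
  area_preserving (f \o g).
Proof.
move=> hf hg K cK; have [cgK egK] := hg K cK; have [cfK efK] := hf _ cgK.
by rewrite -image_comp efK egK.
Qed.

(** Cavalieri: each vertical section is merely translated. *)
Lemma area_preserving_vshear (l b : R) : area_preserving (fun p => (p.1, p.2 + (l * p.1 + b))).
Proof.
move=> K cK; split.
  apply: (@compact_affine_image _ _ 1 0 0 l 1 b) => // p.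
  by apply: pt_eq => /=; ring.
rewrite /area /product_measure1; apply: eq_integral => x _ /=.
have mx : measurable (xsection (K : set (measurableTypeR R * measurableTypeR R)) x).
  by apply: measurable_xsection; exact: compact_measurable_plane.
rewrite -(lebesgue_measure_translate (l * x + b) mx); congr (mu _).
apply/seteqP; split => y; rewrite /xsection/= inE.
  move=> [[a c] Kac [<- <-]] /=; exists c => //.
  by rewrite inE.
by move=> [c]; rewrite inE => Kxc <-; exists (x, c).
Qed.

(** Exchanging the coordinates exchanges the two iterated integrals, which agree by uniqueness of
    the product measure. *)
Lemma area_preserving_swap : area_preserving (fun p : pt R => (p.2, p.1)).
Proof.
move=> K cK; split.
  apply: (@compact_affine_image _ _ 0 1 0 1 0 0) => // p.
  by apply: pt_eq => /=; ring.
have mK := compact_measurable_plane cK.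
rewrite [RHS](@product_measure_unique _ _ _ _ R mu mu (product_measure2 mu mu))//; last first.
  by move=> A B mA mB /=; rewrite product_measure2E.
rewrite /area /product_measure1 /product_measure2; apply: eq_integral => x _ /=.
congr (mu _); apply/seteqP; split => y; rewrite /xsection /ysection/= !inE.
  by move=> [[a c] Kac [<- <-]].
by move=> Kyx; exists (y, x).
Qed.

Lemma area_preserving_hshear (l b : R) : area_preserving (fun p => (p.1 + (l * p.2 + b), p.2)).
Proof.
have -> : (fun p : pt R => (p.1 + (l * p.2 + b), p.2)) =
  (fun p => (p.2, p.1)) \o ((fun p => (p.1, p.2 + (l * p.1 + b))) \o (fun p => (p.2, p.1))).
  by apply/funext => p.
apply: area_preserving_comp; first exact: area_preserving_swap.
by apply: area_preserving_comp; [exact: area_preserving_vshear | exact: area_preserving_swap].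
Qed.

(* A rotation is a product of three shears, except for the half-turn, which is
   the square of a quarter-turn. *)
Lemma area_preserving_rot (c s : R) : is_SO2 c s -> area_preserving (rot c s).
Proof.
have main c' s' : is_SO2 c' s' -> 1 + c' != 0 -> area_preserving (rot c' s').
  (* Minus the tangent of half the angle, which is finite away from the half-turn. *)
  move=> cs c1; set t := - (s' / (1 + c')).
  have -> : rot c' s' = (fun p => (p.1 + (t * p.2 + 0), p.2)) \o
    ((fun p => (p.1, p.2 + (s' * p.1 + 0))) \o (fun p => (p.1 + (t * p.2 + 0), p.2))).
    have e1 : 1 + t * s' = c'.
      have e : s' * s' = (1 - c') * (1 + c') by move: cs; rewrite /is_SO2 !expr2; lra.
      by rewrite /t mulNr mulrAC e mulfK//; ring.
    have e2 : t + t * c' = - s' by rewrite /t; field.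
    apply/funext => p; apply: pt_eq => /=.
      transitivity ((1 + t * s') * p.1 + (t + t * (1 + t * s')) * p.2); last by ring.
      by rewrite e1 e2; ring.
    transitivity (s' * p.1 + (1 + t * s') * p.2); last by ring.
    by rewrite e1.
  apply: area_preserving_comp; first exact: area_preserving_hshear.
  by apply: area_preserving_comp; [exact: area_preserving_vshear | exact: area_preserving_hshear].
move=> cs; have [c1|c1] := eqVneq (1 + c) 0; last exact: main.
have ce : c = -1 by lra.
have se : s = 0.
  by move: cs; rewrite /is_SO2 ce sqrrN expr1n => /eqP; rewrite -subr_eq0 addrAC subrr add0r sqrf_eq0 => /eqP.
have -> : rot c s = rot 0 1 \o rot 0 1 by apply/funext => p; rewrite ce se; apply: pt_eq => /=; ring.
by apply: area_preserving_comp; apply: main; rewrite /is_SO2 ?addr0 ?oner_eq0//; ring.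
Qed.

End Area.

(** * Triangles *)

Section Triangles.
Variable R : realType.
Implicit Types (u p q x y z a b c d w : pt R).

Definition noncollinear a b c := cross (psub b a) (psub c a) != 0.

Lemma noncollinearC a b c : noncollinear a b c -> noncollinear b a c.
Proof.
rewrite /noncollinear => h; apply: contra h => /eqP h; apply/eqP.
by move: h; rewrite /cross/=; lra.
Qed.

Lemma noncollinearR a b c : noncollinear a b c -> noncollinear a c b.
Proof.
rewrite /noncollinear => h; apply: contra h => /eqP h; apply/eqP.
by move: h; rewrite /cross/=; lra.
Qed.

Definition dist2 a b : R := pdot (psub b a) (psub b a).

Lemma dist2_gt0 a b : a != b -> 0 < dist2 a b.
Proof.
move=> ab; have h1 := sqr_ge0 (b.1 - a.1); have h2 := sqr_ge0 (b.2 - a.2).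
rewrite lt_neqAle; apply/andP; split; last by rewrite /dist2 /pdot/= -!expr2 addr_ge0.
apply: contra ab => /eqP; rewrite /dist2 /pdot/= -!expr2 => e.
have e1 : (b.1 - a.1) ^+ 2 = 0 by lra.
have e2 : (b.2 - a.2) ^+ 2 = 0 by lra.
move/eqP: e1; rewrite sqrf_eq0 subr_eq0 => /eqP e1.
move/eqP: e2; rewrite sqrf_eq0 subr_eq0 => /eqP e2.
by apply/eqP; apply: pt_eq.
Qed.

Lemma noncollinear_neq a b c : noncollinear a b c -> b != c.
Proof.
apply: contraNN => /eqP->; rewrite /cross; apply/eqP; ring.
Qed.

Lemma perm_outer (P : pt R -> pt R -> pt R -> Prop) :
  (forall a b c, P a b c -> P b a c) -> (forall a b c, P a b c -> P a c b) ->
  forall a b c, P a b c -> P c b a.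
Proof. by move=> k1 k2 a b c h; apply/k1/k2/k1. Qed.

(* A triangle has two acute angles, and the altitude between them
   cuts it into two right triangles. *)
Lemma altitude_ind (P : pt R -> pt R -> pt R -> Prop) :
  (forall a b c, P a b c -> P b a c) -> (forall a b c, P a b c -> P a c b) ->
  (forall a b c, noncollinear a b c -> pdot (psub b a) (psub c a) = 0 -> P a b c) ->
  (forall a b c d, noncollinear a b c -> noncollinear a b d -> noncollinear a d c ->
    seg b c d -> P a b d -> P a d c -> P a b c) ->
  forall a b c, noncollinear a b c -> P a b c.
Proof.
move=> PC PR Pright Pcut.
have acute a b c : noncollinear a b c -> 0 < pdot (psub a b) (psub c b) ->
    0 < pdot (psub a c) (psub b c) -> P a b c.
  move=> nc hb hc.
  have n0 : 0 < dist2 b c by apply: dist2_gt0; exact: noncollinear_neq nc.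
  (* The weight of b in the foot d of the altitude from a; acute angles at c and b mean 0 < t and t
     < 1. *)
  pose t := pdot (psub a c) (psub b c) / dist2 b c.
  have t0 : 0 < t by exact: divr_gt0.
  have te : t * dist2 b c = pdot (psub a c) (psub b c) by rewrite divfK// gt_eqF.
  have t1 : t < 1.
    rewrite /t ltr_pdivrMr// mul1r; move: hb; rewrite /dist2 /pdot/=; lra.
  pose d := padd (pscale t b) (pscale (1 - t) c).
  have sd : seg b c d by exists t; rewrite !ltW.
  have perp : pdot (psub a d) (psub c b) = 0.
    have -> : pdot (psub a d) (psub c b) = t * dist2 b c - pdot (psub a c) (psub b c).
      by rewrite /dist2 /d /pdot/=; ring.
    by rewrite te subrr.
  have x1 : noncollinear a b d.
    rewrite /noncollinear (_ : cross _ _ = (1 - t) * cross (psub b a) (psub c a)).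
      by rewrite mulf_neq0// gt_eqF// subr_gt0.
    by rewrite /d /cross/=; ring.
  have x2 : noncollinear a d c.
    rewrite /noncollinear (_ : cross _ _ = t * cross (psub b a) (psub c a)).
      by rewrite mulf_neq0// gt_eqF.
    by rewrite /d /cross/=; ring.
  apply: (Pcut a b c d) => //.
    apply: (perm_outer PC PR); apply: Pright.
      apply: noncollinearC; apply: noncollinearR; exact: noncollinearC.
    have -> : pdot (psub b d) (psub a d) = - (1 - t) * pdot (psub a d) (psub c b).
      by rewrite /d /pdot/=; ring.
    by rewrite perp mulr0.
  apply: PC; apply: Pright; first exact: noncollinearC.
  have -> : pdot (psub a d) (psub c d) = t * pdot (psub a d) (psub c b).
    by rewrite /d /pdot/=; ring.
  by rewrite perp mulr0.
have obtuse a b c : noncollinear a b c -> pdot (psub b a) (psub c a) <= 0 -> P a b c.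
  move=> nc; rewrite le_eqVlt => /orP[/eqP h|h]; first exact: Pright.
  have ab : 0 < dist2 b a.
    by apply: dist2_gt0; exact: (noncollinear_neq (noncollinearR (noncollinearC (noncollinearR nc)))).
  have ac : 0 < dist2 c a.
    by apply: dist2_gt0; exact: (noncollinear_neq (noncollinearR (noncollinearC nc))).
  by apply: acute => //; move: h ab ac; rewrite /dist2 /pdot/=; lra.
move=> a b c nc.
have [h1|h1] := leP (pdot (psub a b) (psub c b)) 0.
  by apply: PC; apply: obtuse => //; exact: noncollinearC.
have [h2|h2] := leP (pdot (psub a c) (psub b c)) 0.
  by apply: PR; apply: PC; apply: obtuse => //; apply: noncollinearC; exact: noncollinearR.
exact: acute.
Qed.

Lemma body_tri a b c : convex_body (tri a b c).
Proof. exact: body_hull. Qed.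

Lemma body_seg a b : convex_body (seg a b).
Proof. by rewrite -hull_seg; exact: body_hull. Qed.

Lemma support_tri a b c u : support (tri a b c) u =
  Num.max (pdot a u) (Num.max (pdot b u) (pdot c u)).
Proof.
have dC p q : pdot p q = pdot q p by rewrite /pdot; ring.
apply/eqP; rewrite eq_le; apply/andP; split.
  apply: support_hull_ub => // x; rewrite !inE dC => /or3P[] /eqP->;
  by rewrite !le_max lexx ?orbT.
rewrite !ge_max ![pdot _ u]dC; apply/and3P.
by split; apply: support_ub; try exact: body_tri; apply: mem_hull; rewrite !inE eqxx ?orbT.
Qed.

(** With r = <b - a, x> and s = <c - a, x>, these are the maximum and the minimum of <., x> on the
    triangle abc translated so that a is the origin. *)
Definition mx3 (r s : R) := Num.max 0 (Num.max r s).
Definition mn3 (r s : R) := Num.min 0 (Num.min r s).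

(* F is additive on every cone where its even part is, so it is determined
   by its values on the six rays spanned by (1,0), (0,1), (1,1). *)
Lemma six_cones (F : R -> R -> R) :
  (forall r s r' s', F (r + r') (s + s') <= F r s + F r' s') ->
  (forall k r s, 0 <= k -> F (k * r) (k * s) = k * F r s) ->
  (forall r s, F r s + F (- r) (- s) = `|r| + `|s| + `|r - s|) ->
  exists A l m : R, -1 <= A <= 1 /\ forall r s,
    F r s = (1 - A) * mx3 r s - (1 + A) * mn3 r s + l * r + m * s.
Proof.
move=> FD FZ FE.
have absD (x y : R) : 0 <= x * y -> `|x + y| = `|x| + `|y|.
  have [x0|x0] := leP 0 x; have [y0|y0] := leP 0 y => xy.
  - by rewrite !ger0_norm// addr_ge0.
  - have -> : x = 0 by nra.
    by rewrite normr0 !add0r.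
  - have -> : y = 0 by nra.
    by rewrite normr0 !addr0.
  - by rewrite !ltr0_norm//; lra.
(* Subadditivity holds at the pair and at its opposite; since the even parts add up exactly, neither
   inequality can be strict. *)
have F2 r s r' s' : 0 <= r * r' -> 0 <= s * s' -> 0 <= (r - s) * (r' - s') ->
    F (r + r') (s + s') = F r s + F r' s'.
  move=> e1 e2 e3; have k1 := FD r s r' s'; have k2 := FD (- r) (- s) (- r') (- s').
  have j1 := FE r s; have j2 := FE r' s'; have j3 := FE (r + r') (s + s').
  rewrite !opprD (absD r)// (absD s)// in j3.
  rewrite (_ : r + r' + (- s - s') = (r - s) + (r' - s')) in j3; last by ring.
  rewrite (absD (r - s) (r' - s') e3) in j3.
  by lra.
have cone (r s p1 p2 q1 q2 : R) : 0 <= r -> 0 <= s -> 0 <= p1 * q1 -> 0 <= p2 * q2 ->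
    0 <= (p1 - p2) * (q1 - q2) ->
    F (r * p1 + s * q1) (r * p2 + s * q2) = r * F p1 p2 + s * F q1 q2.
  move=> r0 s0 e1 e2 e3; have rs := mulr_ge0 r0 s0; rewrite F2 ?FZ//.
  - by rewrite mulrACA mulr_ge0.
  - by rewrite mulrACA mulr_ge0.
  - by rewrite -!mulrBr mulrACA mulr_ge0.
have [e10 e01 e11] : [/\ F (-1) 0 = 2 - F 1 0, F 0 (-1) = 2 - F 0 1 & F (-1) (-1) = 2 - F 1 1].
  have e10 := FE 1 0; have e01 := FE 0 1; have e11 := FE 1 1.
  rewrite ?(subrr, oppr0, opprK, addr0, add0r, normrN1, normr1, normr0) in e10 e01 e11.
  by split; lra.
(* Solved from F(1,0) = 1 - A + l, F(0,1) = 1 - A + m and F(1,1) = 1 - A + l + m. Subadditivity at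
   (1,1) and at (-1,-1) gives A <= 1 and A >= -1. *)
exists (F 1 1 - F 1 0 - F 0 1 + 1), (F 1 1 - F 0 1), (F 1 1 - F 1 0); split.
  have k1 := FD 1 0 0 1; have k2 := FD (-1) 0 0 (-1).
  rewrite !addr0 !add0r in k1 k2; apply/andP; split; lra.
move=> r s; rewrite /mx3 /mn3.
have [rs|/ltW rs] := leP s r; have [r0|/ltW r0] := leP 0 r; have [s0|/ltW s0] := leP 0 s.
- have -> : F r s = F ((r - s) * 1 + s * 1) ((r - s) * 0 + s * 1) by congr F; ring.
  by rewrite cone ?e10 ?e01 ?e11; (ring || lra).
- have -> : F r s = F (r * 1 + (- s) * 0) (r * 0 + (- s) * (-1)) by congr F; ring.
  by rewrite cone ?e10 ?e01 ?e11; (ring || lra).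
- have -> : F r s = F ((r - s) * 1 + s * 1) ((r - s) * 0 + s * 1) by congr F; ring.
  have [re se] : r = 0 /\ s = 0 by split; lra.
  by rewrite cone ?e10 ?e01 ?e11 ?re ?se; (ring || lra).
- have -> : F r s = F ((- r) * (-1) + (r - s) * 0) ((- r) * (-1) + (r - s) * (-1)) by congr F; ring.
  by rewrite cone ?e10 ?e01 ?e11; (ring || lra).
- have -> : F r s = F ((s - r) * 0 + r * 1) ((s - r) * 1 + r * 1) by congr F; ring.
  by rewrite cone ?e10 ?e01 ?e11; (ring || lra).
- have -> : F r s = F ((s - r) * 0 + r * 1) ((s - r) * 1 + r * 1) by congr F; ring.
  have [re se] : r = 0 /\ s = 0 by split; lra.
  by rewrite cone ?e10 ?e01 ?e11 ?re ?se; (ring || lra).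
- have -> : F r s = F ((- r) * (-1) + s * 0) ((- r) * 0 + s * 1) by congr F; ring.
  by rewrite cone ?e10 ?e01 ?e11; (ring || lra).
- have -> : F r s = F ((- s) * (-1) + (s - r) * (-1)) ((- s) * (-1) + (s - r) * 0) by congr F; ring.
  by rewrite cone ?e10 ?e01 ?e11; (ring || lra).
Qed.

End Triangles.

(** * The values of a normalized functional on triangles *)

Section NormalizedFunctional.
Variable R : realType.
Implicit Types (K L : set (pt R)) (u p q x y z a b c d w l : pt R).

(** [f K x] stands for the support function of [Phi K] at the point that V sends to x. The values
    prescribed on segments and boxes are those of K + (-K). *)
Record normalized (f : set (pt R) -> pt R -> R) : Prop := Normalized {
  nf_cut : forall x, cut_additive (f ^~ x);
  nf_trans : forall K t x, convex_body K -> f (ktrans K t) x = f K x;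
  nf_rot : forall co si K x, is_SO2 co si -> convex_body K ->
    f (krot co si K) x = f K (rot co (- si) x);
  nf_sub : forall K x y, convex_body K -> f K (padd x y) <= f K x + f K y;
  nf_scale : forall K r x, 0 <= r -> convex_body K -> f K (pscale r x) = r * f K x;
  nf_cont : forall K x e, convex_body K -> 0 < e -> exists2 d, 0 < d & forall L r,
    convex_body L -> r < d -> close K L r -> `|f K x - f L x| < e;
  nf_seg : forall a b x, f (seg a b) x = `|pdot (psub b a) x|;
  nf_rect : forall s t x, 0 <= s -> 0 <= t -> f (rect 0 s 0 t) x = s * `|x.1| + t * `|x.2|
}.

Variable f : set (pt R) -> pt R -> R.
Hypothesis nf : normalized f.

Lemma nf_refl K x : convex_body K -> f (krefl K) x = f K (popp x).
Proof.
move=> bK; rewrite krefl_krot (nf_rot nf)//; last by rewrite /is_SO2; ring.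
by congr (f K _); apply: pt_eq => /=; ring.
Qed.

Lemma krot_tri co si a b c : krot co si (tri a b c) = tri (rot co si a) (rot co si b) (rot co si c).
Proof. exact: krot_hull. Qed.

Lemma krefl_tri a b c : krefl (tri a b c) = tri (popp a) (popp b) (popp c).
Proof. exact: krefl_hull. Qed.

Lemma ktrans_tri a b c t : ktrans (tri a b c) t = tri (padd a t) (padd b t) (padd c t).
Proof. exact: ktrans_hull. Qed.

Lemma nf_tri_cut a b c d x : noncollinear a b c -> seg b c d ->
  f (tri a b d) x + f (tri a d c) x = f (tri a b c) x + `|pdot (psub d a) x|.
Proof.
by move=> nc sd; rewrite -(nf_seg nf); exact: (tri_cut (nf_cut nf x) nc sd).
Qed.

Lemma rect_hull (s t : R) : 0 <= s -> 0 <= t ->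
  rect 0 s 0 t = hull [:: (0, 0); (s, 0); (0, t); (s, t)].
Proof.
move=> s0 t0; apply/seteqP; split; last first.
  apply: hull_sub => [x y r [/= x1 x2] [/= y1 y2] /andP[r0 r1]|x].
    move: x1 x2 y1 y2; rewrite /rect /= !in_itv/= => /andP[? ?] /andP[? ?] /andP[? ?] /andP[? ?].
    by split; apply/andP; split; nra.
  by rewrite !inE => /or4P[] /eqP->; split; rewrite /= in_itv/= ?lexx ?s0 ?t0.
move=> [x1 x2] []; rewrite /= !in_itv/= => /andP[x10 x1s] /andP[x20 x2t].
have coef (r m : R) : 0 <= r -> r <= m -> exists k, 0 <= k <= 1 /\ r = k * m.
  move=> r0 rm; have [m0|m0] := eqVneq m 0.
    by exists 0; rewrite lexx ler01; split => //; lra.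
  have mp : 0 < m by rewrite lt_neqAle eq_sym m0 (le_trans r0 rm).
  by exists (r / m); rewrite divr_ge0 ?(ltW mp)//= ler_pdivrMr// mul1r divfK.
have [k [k01 ->]] := coef _ _ x10 x1s; have [m [m01 ->]] := coef _ _ x20 x2t.
have hc := @hull_convex _ [:: (0, 0); (s, 0); (0, t); (s, t)].
have mem x : x \in [:: (0, 0); (s, 0); (0, t); (s, t)] -> hull [:: (0, 0); (s, 0); (0, t); (s, t)] x.
  exact: mem_hull.
have h1 : hull [:: (0, 0); (s, 0); (0, t); (s, t)] (k * s, 0).
  rewrite (_ : (k * s, 0) = padd (pscale k (s, 0)) (pscale (1 - k) (0, 0))).
    by apply: hc => //; apply: mem; rewrite !inE eqxx ?orbT.
  by apply: pt_eq => /=; ring.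
have h2 : hull [:: (0, 0); (s, 0); (0, t); (s, t)] (k * s, t).
  rewrite (_ : (k * s, t) = padd (pscale k (s, t)) (pscale (1 - k) (0, t))).
    by apply: hc => //; apply: mem; rewrite !inE eqxx ?orbT.
  by apply: pt_eq => /=; ring.
rewrite (_ : (k * s, m * t) = padd (pscale m (k * s, t)) (pscale (1 - m) (k * s, 0))).
  exact: hc.
by apply: pt_eq => /=; ring.
Qed.

(** The right-hand side is twice the width of the triangle in direction x, written edge by edge
    because this is the form that adds up under cuts. *)
Definition even_part a b c := forall x, f (tri a b c) x + f (tri a b c) (popp x) =
  `|pdot (psub b a) x| + `|pdot (psub c a) x| + `|pdot (psub c b) x|.

(** The diagonal splits a box into the triangle and a translate of its point reflection. Hence the
    cut relation is already a formula for f(x) + f(-x): the legs come from the box and the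
    hypotenuse from the diagonal. *)
Lemma even_part_axis (s t : R) : 0 < s -> 0 < t -> even_part (0, 0) (s, 0) (0, t).
Proof.
move=> s0 t0 x; pose T := tri (0, 0) (s, 0) (0, t).
have eT : tri (s, 0) (0, t) (s, t) = ktrans (krefl T) (s, t).
  rewrite krefl_tri ktrans_tri tri_permC tri_permR tri_permC.
  rewrite (_ : padd _ _ = (s, t)); last by apply: pt_eq => /=; ring.
  rewrite (_ : padd _ _ = (0, t)); last by apply: pt_eq => /=; ring.
  rewrite [in RHS](_ : padd _ _ = (s, 0)); last by apply: pt_eq => /=; ring.
  by apply/seteqP; split; apply: hull_incl => z; rewrite !inE => /or3P[]->; rewrite ?orbT.
have -> : f T (popp x) = f (tri (s, 0) (0, t) (s, t)) x.
  by rewrite eT (nf_trans nf) ?nf_refl//; [exact: body_tri | apply: body_krefl; exact: body_tri].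
have eR : rect 0 s 0 t = hull ([:: (0, 0); (s, 0); (0, t)] ++ [:: (s, 0); (0, t); (s, t)]).
  rewrite rect_hull ?ltW//; apply/seteqP.
  by split; apply: hull_incl => z; rewrite !inE; repeat case: eqP => //=.
have := @cut_hull _ _ (nf_cut nf x) [:: (0, 0); (s, 0); (0, t)] [:: (s, 0); (0, t); (s, t)]
  [:: (s, 0); (0, t)] (t, s) (s * t).
rewrite -eR hull_seg (nf_rect nf) ?(nf_seg nf) ?ltW// => -> //.
- have -> : pdot (psub (s, 0) (0, 0)) x = s * x.1 by rewrite /pdot/=; ring.
  have -> : pdot (psub (0, t) (0, 0)) x = t * x.2 by rewrite /pdot/=; ring.
  by rewrite !normrM (gtr0_norm s0) (gtr0_norm t0).
- by move=> z; rewrite !inE => /or3P[] /eqP->; rewrite /pdot/=; nra.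
- by move=> z; rewrite !inE => /or3P[] /eqP->; rewrite /pdot/=; nra.
- by move=> z; rewrite !inE => /orP[]->; rewrite ?orbT.
- by move=> z; rewrite !inE => /orP[]->; rewrite ?orbT.
move=> [z1 z2] [[]]; rewrite /line /pdot/= !in_itv/= => /andP[z10 z1s] /andP[z20 z2t] ez.
exists (z1 / s); split; first by rewrite divr_ge0 ?(ltW s0)//= ler_pdivrMr// mul1r.
apply: pt_eq => /=; first by field; rewrite gt_eqF.
rewrite mulr0 add0r mulrBl mul1r; apply: (mulfI (negbT (gt_eqF s0))).
by transitivity (s * t - t * z1); [lra | field; rewrite gt_eqF].
Qed.

Lemma sqrt_polar p : p != (0, 0) -> exists r co si, [/\ 0 < r, is_SO2 co si & p = (r * co, r * si)].
Proof.
move=> p0; have n0 : 0 < dist2 (0, 0) p by apply: dist2_gt0; rewrite eq_sym.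
have e : dist2 (0, 0) p = p.1 ^+ 2 + p.2 ^+ 2 by rewrite /dist2 /pdot/=; ring.
rewrite e in n0; pose r := Num.sqrt (p.1 ^+ 2 + p.2 ^+ 2).
have r0 : 0 < r by rewrite sqrtr_gt0.
have r2 : r ^+ 2 = p.1 ^+ 2 + p.2 ^+ 2 by rewrite sqr_sqrtr// ltW.
exists r, (p.1 / r), (p.2 / r); split => //; last first.
  by apply: pt_eq => /=; field; rewrite gt_eqF.
by rewrite /is_SO2 !exprMn -mulrDl -r2 exprVn mulfV// expf_neq0// gt_eqF.
Qed.

Lemma even_part_right a b c : noncollinear a b c -> pdot (psub b a) (psub c a) = 0 -> even_part a b c.
Proof.
have main b' c' : 0 < cross (psub b' a) (psub c' a) -> pdot (psub b' a) (psub c' a) = 0 ->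
    even_part a b' c'.
  set p := psub b' a; set q := psub c' a => pq0 pq.
  have p0 : p != (0, 0).
    by apply: contraTN pq0 => /eqP->; rewrite /cross/= !mul0r subrr ltxx.
  have [r [co [si [r0 cs pe]]]] := sqrt_polar p0.
  have cs' := cs; rewrite /is_SO2 !expr2 in cs'.
  pose t := co * q.2 - si * q.1.
  have rt : cross p q = r * t by rewrite pe /t /cross/=; ring.
  have t0 : 0 < t by move: pq0; rewrite rt pmulr_rgt0.
  have perp : co * q.1 + si * q.2 = 0.
    apply: (mulfI (negbT (gt_eqF r0))); rewrite mulr0 -pq pe /pdot/=; ring.
  have be : b' = padd (rot co si (r, 0)) a.
    by apply: pt_eq; move: pe => /(congr1 (fun z => (z.1, z.2))) [] /=; rewrite /p/=; lra.
  have ce : c' = padd (rot co si (0, t)) a.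
    have q1 : q.1 = - (si * t).
      transitivity ((co * co + si * si) * q.1); first by rewrite cs' mul1r.
      transitivity (co * (co * q.1 + si * q.2) - si * t); first by rewrite /t; ring.
      by rewrite perp; ring.
    have q2 : q.2 = co * t.
      transitivity ((co * co + si * si) * q.2); first by rewrite cs' mul1r.
      transitivity (si * (co * q.1 + si * q.2) + co * t); first by rewrite /t; ring.
      by rewrite perp; ring.
    by apply: pt_eq; move: q1 q2; rewrite /q/=; lra.
  have eT : tri a b' c' = ktrans (krot co si (tri (0, 0) (r, 0) (0, t))) a.
    rewrite krot_tri ktrans_tri -be -ce.
    by congr tri; apply: pt_eq => /=; ring.
  have bT := body_tri (0, 0) (r, 0) (0, t).
  have bT' := body_krot co si bT.
  move=> x; rewrite eT !(nf_trans nf)// !(nf_rot nf)//.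
  have -> : rot co (- si) (popp x) = popp (rot co (- si) x) by apply: pt_eq => /=; ring.
  rewrite even_part_axis// -/p -/q.
  have -> : psub c' b' = psub q p by rewrite /p /q; apply: pt_eq => /=; ring.
  by congr (_ + _ + _); congr `|_|; rewrite /p /q ?be ?ce /pdot/=; ring.
move=> nc; move: (nc); rewrite /noncollinear neq_lt => /orP[h pq|h pq]; last exact: main.
have : even_part a c b.
  by apply: main; [move: h; rewrite /cross/=; lra | move: pq; rewrite /pdot/=; lra].
move=> h' x; rewrite tri_permR h' [X in _ + X](_ : _ = `|pdot (psub c b) x|); first by ring.
by rewrite -normrN; congr `|_|; rewrite /pdot/=; ring.
Qed.

Lemma even_part_tri a b c : noncollinear a b c -> even_part a b c.
Proof.
apply: (altitude_ind (P := even_part)) => {a b c} [a b c h x|a b c h x|a b c nc pq|a b c d nc n1 n2 sd h1 h2 x].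
- rewrite tri_permC h [`|pdot (psub b a) x|](_ : _ = `|pdot (psub a b) x|); first by ring.
  by rewrite -normrN; congr `|_|; rewrite /pdot/=; ring.
- rewrite tri_permR h [`|pdot (psub c b) x|](_ : _ = `|pdot (psub b c) x|); first by ring.
  by rewrite -normrN; congr `|_|; rewrite /pdot/=; ring.
- exact: even_part_right.
have k1 := nf_tri_cut x nc sd; have k2 := nf_tri_cut (popp x) nc sd.
have e1 := h1 x; have e2 := h2 x.
have e3 : `|pdot (psub d a) (popp x)| = `|pdot (psub d a) x|.
  by rewrite -normrN; congr `|_|; rewrite /pdot/=; ring.
have e4 : `|pdot (psub c b) x| = `|pdot (psub d b) x| + `|pdot (psub c d) x|.
  have [t [/andP[t0 t1] ->]] := sd.
  have -> : pdot (psub (padd (pscale t b) (pscale (1 - t) c)) b) x = (1 - t) * pdot (psub c b) x.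
    by rewrite /pdot/=; ring.
  have -> : pdot (psub c (padd (pscale t b) (pscale (1 - t) c))) x = t * pdot (psub c b) x.
    by rewrite /pdot/=; ring.
  by rewrite !normrM (ger0_norm t0) ger0_norm ?subr_ge0//; ring.
by rewrite e4; lra.
Qed.

(** The linear part l may depend on the triangle in an unknown way; only A can be compared between
    triangles. *)
Definition blend (A : R) a b c := exists l, forall x, f (tri a b c) x =
  (1 - A) * support (tri a b c) x + (1 + A) * support (tri a b c) (popp x) + pdot l x.

Lemma blend_exists a b c : noncollinear a b c -> exists A, -1 <= A <= 1 /\ blend A a b c.
Proof.
move=> nc; set p := psub b a; set q := psub c a; set X := cross p q.
have X0 : X != 0 by [].
(* Cramer's rule for the inverse of x |-> (<p, x>, <q, x>). In these coordinates the even part is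
   |r| + |s| + |r - s|. *)
pose P (r s : R) : pt R := ((r * q.2 - s * p.2) / X, (s * p.1 - r * q.1) / X).
have bT := body_tri a b c.
have PD r s r' s' : P (r + r') (s + s') = padd (P r s) (P r' s').
  by apply: pt_eq => /=; ring.
have PZ k r s : P (k * r) (k * s) = pscale k (P r s) by apply: pt_eq => /=; ring.
have Pp r s : pdot p (P r s) = r.
  transitivity (r * X / X); last by rewrite mulfK.
  by rewrite /P /X /cross /pdot/=; ring.
have Pq r s : pdot q (P r s) = s.
  transitivity (s * X / X); last by rewrite mulfK.
  by rewrite /P /X /cross /pdot/=; ring.
have [||r s|A [l [m [A1 hA]]]] := @six_cones R (fun r s => f (tri a b c) (P r s)).
- by move=> r s r' s'; rewrite PD; exact: (nf_sub nf).
- by move=> k r s k0; rewrite PZ; exact: (nf_scale nf).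
- have -> : P (- r) (- s) = popp (P r s) by apply: pt_eq => /=; ring.
  rewrite even_part_tri// -/p -/q Pp Pq distrC; congr (_ + `|_|).
  transitivity (pdot q (P r s) - pdot p (P r s)); last by rewrite Pp Pq.
  by rewrite /p /q /pdot/=; ring.
exists A; split => //; exists (padd (pscale (2 * A) a) (padd (pscale l p) (pscale m q))) => x.
have xe : x = P (pdot p x) (pdot q x).
  by apply: pt_eq => /=; apply: (mulIf X0); rewrite divfK// /X /cross /pdot/=; ring.
rewrite {1}xe hA.
have -> : support (tri a b c) x = pdot a x + mx3 (pdot p x) (pdot q x).
  rewrite support_tri /mx3 !addr_maxr addr0.
  by congr (Num.max _ (Num.max _ _)); rewrite /p /q /pdot/=; ring.
have -> : support (tri a b c) (popp x) = - pdot a x - mn3 (pdot p x) (pdot q x).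
  rewrite support_tri /mn3 !oppr_min !addr_maxr oppr0 addr0.
  by congr (Num.max _ (Num.max _ _)); rewrite /p /q /pdot/=; ring.
set M := mx3 _ _; set N := mn3 _ _.
by rewrite /pdot/=; ring.
Qed.

(** The sum of the three values minus their median. At the values of the vertices it is twice the
    odd part of the support function of the triangle. *)
Definition mm (r s t : R) := Num.max r (Num.max s t) + Num.min r (Num.min s t).

Lemma odd_support_tri a b c x :
  support (tri a b c) x - support (tri a b c) (popp x) = mm (pdot a x) (pdot b x) (pdot c x).
Proof.
have dN p : pdot p (popp x) = - pdot p x by rewrite /pdot/=; ring.
by rewrite !support_tri !dN -!oppr_min opprK.
Qed.

Lemma mmD r s t k : mm (r + k) (s + k) (t + k) = mm r s t + 2 * k.
Proof. by rewrite /mm -!addr_maxl -!addr_minl; ring. Qed.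

(* Second differences across the rays (0,1) and (1,1) isolate the edges that
   the whole triangle shares with exactly one of its two pieces. *)
Lemma kinks (A A' A'' s l m : R) : 0 < s -> s < 1 ->
  (forall r t, A * mm r 0 t - A' * mm r 0 (s * t) - A'' * mm r (s * t) t = l * r + m * t) ->
  A = A' /\ A = A''.
Proof.
move=> s0 s1 h.
have mmE (r v t mx mn : R) : r <= mx -> v <= mx -> t <= mx -> mn <= r -> mn <= v -> mn <= t ->
    [|| mx == r, mx == v | mx == t] -> [|| mn == r, mn == v | mn == t] -> mm r v t = mx + mn.
  move=> r1 u1 t1 r2 u2 t2 e1 e2; congr (_ + _); apply/eqP; rewrite eq_le.
    rewrite !ge_max r1 u1 t1/= !le_max.
    by case/or3P: e1 => /eqP->; rewrite lexx ?orbT.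
  rewrite !le_min r2 u2 t2 !ge_min/= andbT.
  by case/or3P: e2 => /eqP->; rewrite lexx ?orbT.
split.
(* At r = 0 the vertices a and b tie for the minimum in abc and in abd, but b is absent from adc.
   The step s/2 stays below the value s of d. *)
- have e0 : 0 < s / 2 by rewrite divr_gt0.
  have h1 := h (s / 2) 1; have h2 := h (- (s / 2)) 1; have h3 := h 0 1.
  rewrite !mulr1 (mmE (s / 2) 0 1 1 0) ?(mmE (s / 2) 0 s s 0) ?(mmE (s / 2) s 1 1 (s / 2)) ?eqxx ?orbT// in h1; try lra.
  rewrite !mulr1 (mmE (- (s / 2)) 0 1 1 (- (s / 2))) ?(mmE (- (s / 2)) 0 s s (- (s / 2)))
    ?(mmE (- (s / 2)) s 1 1 (- (s / 2))) ?eqxx ?orbT// in h2; try lra.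
  rewrite !mulr1 (mmE 0 0 1 1 0) ?(mmE 0 0 s s 0) ?(mmE 0 s 1 1 0) ?eqxx ?orbT// in h3; try lra.
  apply: (mulIf (negbT (gt_eqF e0))); lra.
(* At r = t = 1 the vertices a and c tie for the maximum in abc and in adc, but c is absent from
   abd. The step keeps r above the value s of d. *)
- have e0 : 0 < (1 - s) / 2 by rewrite divr_gt0// subr_gt0.
  set e := (1 - s) / 2 in e0; have es : 2 * e = 1 - s by rewrite /e; field.
  have h1 := h (1 + e) 1; have h2 := h (1 - e) 1; have h3 := h 1 1.
  rewrite !mulr1 (mmE (1 + e) 0 1 (1 + e) 0) ?(mmE (1 + e) 0 s (1 + e) 0) ?(mmE (1 + e) s 1 (1 + e) s) ?eqxx ?orbT// in h1; try lra.
  rewrite !mulr1 (mmE (1 - e) 0 1 1 0) ?(mmE (1 - e) 0 s (1 - e) 0)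
    ?(mmE (1 - e) s 1 1 s) ?eqxx ?orbT// in h2; try lra.
  rewrite !mulr1 (mmE 1 0 1 1 0) ?(mmE 1 0 s 1 0) ?(mmE 1 s 1 1 s) ?eqxx ?orbT// in h3; try lra.
  apply: (mulIf (negbT (gt_eqF e0))); lra.
Qed.

(** Subtracting the cut relation at -x from the one at x removes the width of the cut. Up to linear
    functions a relation between the three odd parts remains, whose kinks separate the coefficients.
    Coordinates are taken from b, so that a, b, c, d have the values r, 0, s, (1 - t) s. *)
Lemma blend_cut A A' A'' (t : R) a b c d : noncollinear a b c -> 0 < t -> t < 1 ->
  d = padd (pscale t b) (pscale (1 - t) c) ->
  blend A a b c -> blend A' a b d -> blend A'' a d c -> A = A' /\ A = A''.
Proof.
move=> nc t0 t1 de [l hl] [l' hl'] [l'' hl''].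
have sd : seg b c d by exists t; rewrite !ltW.
pose p := psub a b; pose q := psub c b; pose X := cross p q.
have X0 : X != 0.
  by apply: contra nc => /eqP; rewrite /X /p /q /cross/= => e; apply/eqP; lra.
pose P (r s : R) : pt R := ((r * q.2 - s * p.2) / X, (s * p.1 - r * q.1) / X).
have Pp r s : pdot p (P r s) = r.
  transitivity (r * X / X); last by rewrite mulfK.
  by rewrite /P /X /cross /pdot/=; ring.
have Pq r s : pdot q (P r s) = s.
  transitivity (s * X / X); last by rewrite mulfK.
  by rewrite /P /X /cross /pdot/=; ring.
pose L := padd (psub l (padd l' l'')) (pscale (2 * (A' + A'' - A)) b).
apply: (@kinks A A' A'' (1 - t) (pdot L (P 1 0)) (pdot L (P 0 1))); rewrite ?subr_gt0//; first lra.
move=> r s; set x := P r s.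
have [B eB] : exists B, pdot b x = B by exists (pdot b x).
have xa : pdot a x = r + B by rewrite -eB -(Pp r s) /p /x /pdot/=; ring.
have xc : pdot c x = s + B by rewrite -eB -(Pq r s) /q /x /pdot/=; ring.
have xb : pdot b x = 0 + B by rewrite add0r.
have xd : pdot d x = (1 - t) * s + B.
  rewrite de (_ : pdot _ x = t * pdot b x + (1 - t) * pdot c x); last by rewrite /pdot/=; ring.
  by rewrite xc eB; ring.
have oT := odd_support_tri a b c x; have oT' := odd_support_tri a b d x.
have oT'' := odd_support_tri a d c x.
rewrite xa xb xc mmD in oT; rewrite xa xb xd mmD in oT'; rewrite xa xd xc mmD in oT''.
have k1 := nf_tri_cut x nc sd; have k2 := nf_tri_cut (popp x) nc sd.
have e3 : `|pdot (psub d a) (popp x)| = `|pdot (psub d a) x|.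
  by rewrite -normrN; congr `|_|; rewrite /pdot/=; ring.
have pp : popp (popp x) = x by apply: pt_eq => /=; ring.
rewrite !hl !hl' !hl'' ?pp e3 in k1 k2.
have := congr1 ( *%R A) oT; have := congr1 ( *%R A') oT'; have := congr1 ( *%R A'') oT''.
have -> : pdot L (P 1 0) * r + pdot L (P 0 1) * s = pdot L x.
  by rewrite /x /P /pdot/=; ring.
have -> : pdot L x = pdot l x - pdot l' x - pdot l'' x + 2 * (A' + A'' - A) * pdot b x.
  by rewrite /L /pdot/=; ring.
have dN v : pdot v (popp x) = - pdot v x by rewrite /pdot/=; ring.
rewrite !dN in k2; rewrite eB; lra.
Qed.

(** Both coefficients equal the one of the same half of the triangle. *)
Lemma blend_uniq A A' a b c : noncollinear a b c -> blend A a b c -> blend A' a b c -> A = A'.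
Proof.
move=> nc h h'; pose d := padd (pscale 2^-1 b) (pscale (1 - 2^-1) c).
have [B [_ hB]] : exists B, -1 <= B <= 1 /\ blend B a b d.
  apply: blend_exists; rewrite /noncollinear.
  rewrite (_ : cross _ _ = 2^-1 * cross (psub b a) (psub c a)); first by rewrite mulf_neq0 ?invr_neq0.
  by rewrite /d /cross/=; field.
have [C [_ hC]] : exists C, -1 <= C <= 1 /\ blend C a d c.
  apply: blend_exists; rewrite /noncollinear.
  rewrite (_ : cross _ _ = 2^-1 * cross (psub b a) (psub c a)); first by rewrite mulf_neq0 ?invr_neq0.
  by rewrite /d /cross/=; field.
have t0 : 0 < 2^-1 :> R by rewrite invr_gt0.
have t1 : 2^-1 < 1 :> R by lra.
have [e _] := blend_cut nc t0 t1 (erefl d) h hB hC.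
by have [-> _] := blend_cut nc t0 t1 (erefl d) h' hB hC.
Qed.

Lemma blendC A a b c : blend A a b c -> blend A b a c.
Proof. by rewrite /blend tri_permC. Qed.

Lemma blendR A a b c : blend A a b c -> blend A a c b.
Proof. by rewrite /blend tri_permR. Qed.

Lemma blend_trans A a b c t : blend A a b c -> blend A (padd a t) (padd b t) (padd c t).
Proof.
move=> [l hl]; exists (padd l (pscale (2 * A) t)) => x; have bT := body_tri a b c.
rewrite -ktrans_tri (nf_trans nf)// hl !support_ktrans//; rewrite /pdot/=; ring.
Qed.

Lemma blend_rot A co si a b c : is_SO2 co si -> blend A a b c ->
  blend A (rot co si a) (rot co si b) (rot co si c).
Proof.
move=> cs [l hl]; exists (rot co si l) => x; have bT := body_tri a b c.
rewrite -krot_tri (nf_rot nf)// hl !support_krot//.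
have -> : rot co (- si) (popp x) = popp (rot co (- si) x) by apply: pt_eq => /=; ring.
by congr (_ + _); rewrite /pdot/=; ring.
Qed.

(** For k < 1 the new triangle is a piece of the old one. For k > 1 the roles are exchanged, and
    uniqueness of the coefficient carries the conclusion back. *)
Lemma blend_move A a b c (k : R) : noncollinear a b c -> 0 < k -> blend A a b c ->
  blend A a b (padd b (pscale k (psub c b))).
Proof.
have shrink c' r A' : noncollinear a b c' -> 0 < r -> r < 1 -> blend A' a b c' ->
    blend A' a b (padd b (pscale r (psub c' b))).
  move=> nc r0 r1 h; pose d := padd (pscale (1 - r) b) (pscale (1 - (1 - r)) c').
  have -> : padd b (pscale r (psub c' b)) = d by apply: pt_eq => /=; ring.
  have [B [_ hB]] : exists B, -1 <= B <= 1 /\ blend B a b d.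
    apply: blend_exists; rewrite /noncollinear.
    rewrite (_ : cross _ _ = r * cross (psub b a) (psub c' a)).
      by rewrite mulf_neq0// gt_eqF.
    by rewrite /d /cross/=; ring.
  have [C [_ hC]] : exists C, -1 <= C <= 1 /\ blend C a d c'.
    apply: blend_exists; rewrite /noncollinear.
    rewrite (_ : cross _ _ = (1 - r) * cross (psub b a) (psub c' a)).
      by rewrite mulf_neq0// gt_eqF// subr_gt0.
    by rewrite /d /cross/=; ring.
  have t0 : 0 < 1 - r by lra.
  have t1 : 1 - r < 1 by lra.
  by have [-> _] := blend_cut nc t0 t1 (erefl d) h hB hC.
move=> nc k0 h; have [k1|k1|k1] := ltgtP k 1.
- exact: shrink.
- have ncd : noncollinear a b (padd b (pscale k (psub c b))).
    rewrite /noncollinear (_ : cross _ _ = k * cross (psub b a) (psub c a)).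
      by rewrite mulf_neq0// gt_eqF.
    by rewrite /cross/=; ring.
  have [B [_ hB]] := blend_exists ncd.
  have := shrink _ k^-1 B ncd; rewrite invr_gt0 invf_lt1// => /(_ k0 k1 hB).
  rewrite (_ : padd b (pscale k^-1 _) = c).
    by move=> hc; rewrite (blend_uniq nc h hc).
  by apply: pt_eq => /=; field; rewrite gt_eqF.
- by rewrite k1 (_ : padd _ _ = c)//; apply: pt_eq => /=; ring.
Qed.

(* Moving a vertex along the line of an edge, rotating and translating reaches
   every triangle, and each of these moves keeps the blending coefficient. *)
Lemma blend_const : exists A, -1 <= A <= 1 /\ forall a b c, noncollinear a b c -> blend A a b c.
Proof.
pose o : pt R := (0, 0).
have nce : noncollinear o (1, 0) (0, 1).
  rewrite /noncollinear (_ : cross _ _ = 1) ?oner_neq0//.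
  by rewrite /cross/=; ring.
have [A0 [A01 hA0]] := blend_exists nce; exists A0; split => //.
have nco p q : cross p q != 0 -> noncollinear o p q.
  by rewrite /noncollinear (_ : cross (psub p o) (psub q o) = cross p q)// /cross/=; ring.
have scale A p q k : 0 < k -> cross p q != 0 -> blend A o p q -> blend A o p (pscale k q).
  move=> k0 pq /blendC h.
  have -> : pscale k q = padd o (pscale k (psub q o)) by apply: pt_eq => /=; ring.
  by apply: blendC; apply: blend_move => //; apply: noncollinearC; exact: nco.
have shear_pos A p q k : 0 < k -> cross p q != 0 -> blend A o p q ->
    blend A o p (padd q (pscale k p)).
  move=> k0 pq h; have s0 : 0 < (1 + k)^-1 by rewrite invr_gt0; lra.
  (* q + k p is 1 + k times a point of the edge from p to q: one move along that edge, then one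
     along the ray through that point. *)
  have := @scale A p _ (1 + k) _ _ (@blend_move A o p q _ (nco _ _ pq) s0 h).
  rewrite (_ : pscale (1 + k) _ = padd q (pscale k p)).
    apply; first lra.
    rewrite (_ : cross _ _ = (1 + k)^-1 * cross p q); first by rewrite mulf_neq0// gt_eqF.
    by rewrite /cross/=; ring.
  by apply: pt_eq => /=; field; rewrite gt_eqF//; lra.
have shear A p q k : cross p q != 0 -> blend A o p q -> blend A o p (padd q (pscale k p)).
  move=> pq h; have [k0|k0|->] := ltgtP k 0.
  - pose q' := padd q (pscale k p).
    have pq' : cross p q' != 0 by rewrite (_ : cross p q' = cross p q)// /cross/=; ring.
    have [B [_ hB]] := blend_exists (nco _ _ pq').
    have := shear_pos B p q' (- k) _ pq' hB; rewrite oppr_gt0 => /(_ k0).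
    rewrite (_ : padd q' _ = q); last by apply: pt_eq => /=; ring.
    by move=> h'; rewrite (blend_uniq (nco _ _ pq) h h').
  - exact: shear_pos.
  - by rewrite (_ : padd _ _ = q)//; apply: pt_eq => /=; ring.
have main A p q : 0 < cross p q -> blend A o p q -> A = A0.
  move=> pq h; have pqn : cross p q != 0 by rewrite gt_eqF.
  have p0 : p != (0, 0).
    by apply: contraTN pq => /eqP->; rewrite /cross/= !mul0r subrr ltxx.
  have [r [co [si [r0 cs pe]]]] := sqrt_polar p0.
  have cs' := cs; rewrite /is_SO2 !expr2 in cs'.
  (* q = k p + t (-si, co): a shear by -k makes q orthogonal to p, and scaling both legs leaves a
     rotated copy of the standard right triangle. *)
  pose t := co * q.2 - si * q.1; pose k := (co * q.1 + si * q.2) / r.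
  have rt : cross p q = r * t by rewrite pe /t /cross/=; ring.
  have t0 : 0 < t by move: pq; rewrite rt pmulr_rgt0.
  have h1 := shear A p q (- k) pqn h.
  have e1 : padd q (pscale (- k) p) = (- (si * t), co * t).
    rewrite pe; apply: pt_eq => /=; rewrite /k.
      transitivity ((co * co + si * si) * q.1 - (co * q.1 + si * q.2) * co).
        by rewrite cs'; field; rewrite gt_eqF.
      by rewrite /t; ring.
    transitivity ((co * co + si * si) * q.2 - (co * q.1 + si * q.2) * si).
      by rewrite cs'; field; rewrite gt_eqF.
    by rewrite /t; ring.
  rewrite e1 in h1.
  have pq1 : cross p (- (si * t), co * t) != 0.
    rewrite (_ : cross _ _ = r * t * (co * co + si * si)); last by rewrite pe /cross/=; ring.
    by rewrite cs' mulr1 mulf_neq0// gt_eqF.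
  have h2 := scale A p _ t^-1 _ pq1 h1; rewrite invr_gt0 in h2; have {}h2 := h2 t0.
  have e2 : pscale t^-1 (- (si * t), co * t) = (- si, co).
    by apply: pt_eq => /=; field; rewrite gt_eqF.
  rewrite e2 in h2; have pq2 : cross p (- si, co) != 0.
    rewrite (_ : cross _ _ = r * (co * co + si * si)); last by rewrite pe /cross/=; ring.
    by rewrite cs' mulr1 gt_eqF.
  have pq2' : cross (- si, co) p != 0.
    apply: contra pq2 => /eqP e; apply/eqP; move: e; rewrite /cross/=; lra.
  have h3 := scale A (- si, co) p r^-1 _ pq2' (blendR h2); rewrite invr_gt0 in h3.
  have {h3} := h3 r0; have -> : pscale r^-1 p = (co, si).
    by rewrite pe; apply: pt_eq => /=; field; rewrite gt_eqF.
  move=> /blendR/(@blend_rot A co (- si) _ _ _).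
  have cs2 : is_SO2 co (- si) by rewrite /is_SO2 sqrrN.
  move=> /(_ cs2); rewrite (_ : rot _ _ o = o); last by apply: pt_eq => /=; ring.
  rewrite (_ : rot _ _ (co, si) = (1, 0)); last by apply: pt_eq => /=; rewrite -?cs'; ring.
  rewrite (_ : rot _ _ (- si, co) = (0, 1)); last by apply: pt_eq => /=; rewrite -?cs'; ring.
  by move=> h4; exact: (blend_uniq nce h4 hA0).
move=> a b c nc; have [A [_ hA]] := blend_exists nc.
have ho : blend A o (psub b a) (psub c a).
  have := blend_trans (popp a) hA; rewrite (_ : padd a (popp a) = o)//.
  by apply: pt_eq => /=; ring.
suff -> : A0 = A by [].
move: nc; rewrite /noncollinear neq_lt => /orP[h|h]; last by rewrite (main _ _ _ h ho).
rewrite (main _ _ _ _ (blendR ho))//.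
by move: h; rewrite /cross/=; lra.
Qed.

End NormalizedFunctional.

(** * The translation part *)

Section Defect.
Variable R : realType.
Implicit Types (K L : set (pt R)) (u p q x y z a b c d w l : pt R).
Variable f : set (pt R) -> pt R -> R.
Hypothesis nf : normalized f.
Variable A : R.
Hypothesis A_bound : -1 <= A <= 1.
Hypothesis f_blend : forall a b c, noncollinear a b c -> blend f A a b c.

(** Under a translation by t the two support terms of the blend change by -2A <x, t> in total; the
    Steiner term compensates exactly this. *)
Definition defect K x := f K x - (1 - A) * support K x - (1 + A) * support K (popp x)
  - 2 * A * pdot x (steiner K).

Lemma defect_cut x : cut_additive (defect ^~ x).
Proof.
move=> K n c bK K1 K2; have e1 := nf_cut nf x bK K1 K2.
have e2 := support_cut x bK K1 K2; have e3 := support_cut (popp x) bK K1 K2.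
have e4 := steiner_cut x bK K1 K2; rewrite /= in e1 e4; rewrite /defect.
have := congr1 ( *%R (1 - A)) e2; have := congr1 ( *%R (1 + A)) e3.
have := congr1 ( *%R (2 * A)) e4; lra.
Qed.

Lemma defect_trans K t x : convex_body K -> defect (ktrans K t) x = defect K x.
Proof.
move=> bK; rewrite /defect (nf_trans nf)// !support_ktrans// steiner_ktrans//.
by rewrite /pdot/=; ring.
Qed.

Lemma defect_rot co si K x : is_SO2 co si -> convex_body K ->
  defect (krot co si K) x = defect K (rot co (- si) x).
Proof.
move=> cs bK; rewrite /defect (nf_rot nf)// !support_krot// steiner_krot//.
have -> : rot co (- si) (popp x) = popp (rot co (- si) x) by apply: pt_eq => /=; ring.
by congr (_ - _ * _); rewrite /pdot/=; ring.
Qed.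

Lemma defect_refl K x : convex_body K -> defect (krefl K) x = defect K (popp x).
Proof.
move=> bK; rewrite krefl_krot defect_rot//; last by rewrite /is_SO2; ring.
by congr (defect K _); apply: pt_eq => /=; ring.
Qed.

Lemma defect_cont K x e : convex_body K -> 0 < e -> exists2 d, 0 < d & forall L r,
  convex_body L -> r < d -> close K L r -> `|defect K x - defect L x| < e.
Proof.
move=> bK e0; have e2 : 0 < e / 2 by rewrite divr_gt0.
have [d1 d10 h1] := nf_cont nf x bK e2.
pose N := `|x.1| + `|x.2|; have N0 : 0 <= N by rewrite addr_ge0.
(* The support terms contribute at most 2rN and the Steiner term at most 8rN, which 12rN covers; the
   summand 1 keeps the denominator positive when N = 0. *)
have d20 : 0 < e / (2 * (1 + 12 * N)) by rewrite divr_gt0// mulr_gt0//; lra.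
exists (Num.min d1 (e / (2 * (1 + 12 * N)))); first by rewrite lt_min d10.
move=> L r bL; rewrite lt_min => /andP[rd1 rd2] cl; have r0 : 0 <= r by case: cl.
have k1 := h1 L r bL rd1 cl.
have k2 := close_support x bK bL cl; have k3 := close_support (popp x) bK bL cl.
have k4 := steiner_close x bK bL cl.
rewrite /= !normrN in k3; rewrite -/N in k2 k3 k4.
have rN : r * (1 + 12 * N) < e / 2.
  rewrite -ltr_pdivlMr; last lra.
  by rewrite -mulrA -invfM.
move: A_bound => /andP[A1 A2].
have -> : defect K x - defect L x = (f K x - f L x) - (1 - A) * (support K x - support L x)
  - (1 + A) * (support K (popp x) - support L (popp x))
  - 2 * A * (pdot x (steiner K) - pdot x (steiner L)) by rewrite /defect; ring.
have m1 : `|(1 - A) * (support K x - support L x)| <= (1 - A) * (r * N).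
  by rewrite normrM ger0_norm ?ler_wpM2l//; lra.
have m2 : `|(1 + A) * (support K (popp x) - support L (popp x))| <= (1 + A) * (r * N).
  by rewrite normrM ger0_norm ?ler_wpM2l//; lra.
have m3 : `|2 * A * (pdot x (steiner K) - pdot x (steiner L))| <= 2 * (r * (4 * N)).
  rewrite normrM; apply: ler_pM => //.
  by rewrite normrM ger0_norm// ler_piMr// ler_norml; apply/andP; split; lra.
apply: le_lt_trans (ler_normB _ _) _; apply: le_lt_trans (lerD (ler_normB _ _) m3) _.
apply: le_lt_trans (lerD (lerD (ler_normB _ _) m2) (lexx _)) _.
apply: le_lt_trans (lerD (lerD (lerD (lexx _) m1) (lexx _)) (lexx _)) _.
by lra.
Qed.

(** A segment is a translate of its reflection, so its defect is even in x. The Steiner term drops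
    out of the even part, and what remains is the prescribed value of f minus the width of the
    segment. *)
Lemma defect_seg a b x : defect (seg a b) x = 0.
Proof.
have bS := body_seg a b.
have ev : defect (seg a b) (popp x) = defect (seg a b) x.
  rewrite -defect_refl//.
  have -> : krefl (seg a b) = ktrans (seg a b) (popp (padd a b)).
    rewrite -!hull_seg krefl_hull ktrans_hull.
    rewrite (_ : map _ [:: a; b] = [:: popp a; popp b])// (_ : map _ [:: a; b] = [:: popp b; popp a]).
      by rewrite !hull_seg seg_sym.
    by congr [:: _; _]; apply: pt_eq => /=; ring.
  by rewrite defect_trans.
have sE u : support (seg a b) u = Num.max (pdot u a) (pdot u b).
  apply/eqP; rewrite eq_le -hull_seg; apply/andP; split.
    by apply: support_hull_ub => // v; rewrite !inE => /orP[] /eqP->; rewrite le_max lexx ?orbT.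
  by rewrite ge_max hull_seg !support_ub//; [exact: segR | exact: segL].
have wd : support (seg a b) x + support (seg a b) (popp x) = `|pdot (psub b a) x|.
  rewrite !sE.
  have dN v : pdot (popp x) v = - pdot x v by rewrite /pdot/=; ring.
  have -> : pdot (psub b a) x = pdot x b - pdot x a by rewrite /pdot/=; ring.
  rewrite !dN; have [h|h] := leP (pdot x a) (pdot x b); have [k|k] := leP (- pdot x a) (- pdot x b).
  - by rewrite ger0_norm; lra.
  - by rewrite ger0_norm; lra.
  - by rewrite ltr0_norm; lra.
  - by rewrite ltr0_norm; lra.
have pp : popp (popp x) = x by apply: pt_eq => /=; ring.
have nn : `|pdot (psub b a) (popp x)| = `|pdot (psub b a) x|.
  by rewrite -normrN; congr `|_|; rewrite /pdot/=; ring.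
have := ev; rewrite /defect !(nf_seg nf) nn pp => e.
have dN : pdot (popp x) (steiner (seg a b)) = - pdot x (steiner (seg a b)).
  by rewrite /pdot/=; ring.
rewrite dN in e; rewrite -wd; rewrite -wd in e.
move: e; set S := support _ x; set S' := support _ (popp x); set q := pdot x _; lra.
Qed.

Lemma defect_line K (n : pt R) (m : R) x : n != (0, 0) -> convex_body K -> K `<=` line n m -> defect K x = 0.
Proof.
move=> n0 bK Kn; have [r [co [si [r0 cs ne]]]] := sqrt_polar n0.
have cs' : is_SO2 co (- si) by rewrite /is_SO2 sqrrN.
have [z hz|s [t [_ e]]] := @vertical_seg _ (krot co (- si) K) (m / r) (body_krot co (- si) bK).
  have [y Ky <-] := hz; have := Kn y Ky; rewrite /line /pdot ne/= => <-.
  by field; rewrite gt_eqF.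
have := defect_seg (m / r, s) (m / r, t) (rot co (- si) x); rewrite -e defect_rot//.
rewrite (_ : rot _ _ _ = x)//.
rewrite /is_SO2 !expr2 in cs.
by apply: pt_eq; rewrite /= -[RHS]mul1r -cs; ring.
Qed.

Lemma defect_collinear a b c x : ~~ noncollinear a b c -> defect (tri a b c) x = 0.
Proof.
rewrite /noncollinear negbK => /eqP h.
have bT := body_tri a b c.
have main (n : pt R) : n != (0, 0) -> pdot n b = pdot n a -> pdot n c = pdot n a -> defect (tri a b c) x = 0.
  move=> n0 eb ec; apply: (@defect_line _ n (pdot n a)) => //.
  apply: hull_sub => [y z t|y]; last by rewrite !inE => /or3P[] /eqP->.
  rewrite /line /= => ey ez _.
  rewrite (_ : pdot n _ = t * pdot n y + (1 - t) * pdot n z); last by rewrite /pdot/=; ring.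
  by rewrite ey ez; ring.
have [ab|ab] := eqVneq b a.
  have [ac|ac] := eqVneq c a.
    by apply: (main (1, 0)); rewrite ?ab ?ac// xpair_eqE oner_eq0.
  apply: (main (- (psub c a).2, (psub c a).1)); rewrite ?ab//; last by rewrite /pdot/=; ring.
  apply: contra ac => /eqP[/eqP]; rewrite oppr_eq0 => /eqP h1 h2; apply/eqP.
  by apply: pt_eq; move: h1 h2 => /=; lra.
apply: (main (- (psub b a).2, (psub b a).1)); last 2 first.
- by rewrite /pdot/=; ring.
- by move: h; rewrite /pdot /cross/=; lra.
apply: contra ab => /eqP[/eqP]; rewrite oppr_eq0 => /eqP h1 h2; apply/eqP.
by apply: pt_eq; move: h1 h2 => /=; lra.
Qed.

Definition dvec a b c : pt R := (defect (tri a b c) (1, 0), defect (tri a b c) (0, 1)).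
Arguments dvec : simpl never.

(** On a triangle the support terms of the defect cancel those of [blend], so that the defect is
    linear in x and is represented by a vector. *)
Lemma dvecE a b c x : defect (tri a b c) x = pdot (dvec a b c) x.
Proof.
have [nc|nc] := boolP (noncollinear a b c); last by rewrite /pdot /dvec/= !defect_collinear//; ring.
have [l hl] := f_blend nc.
have e y : defect (tri a b c) y = pdot (psub l (pscale (2 * A) (steiner (tri a b c)))) y.
  by rewrite /defect hl /pdot/=; ring.
by rewrite /pdot /dvec/= !e /pdot/=; ring.
Qed.

Lemma dvec_ext a b c p : (forall x, defect (tri a b c) x = pdot p x) -> dvec a b c = p.
Proof. by move=> h; apply: pt_eq; rewrite /dvec/= h /pdot/=; ring. Qed.

Lemma dvec_collinear a b c : ~~ noncollinear a b c -> dvec a b c = (0, 0).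
Proof. by move=> nc; rewrite /dvec !defect_collinear. Qed.

Lemma dvecC a b c : dvec a b c = dvec b a c.
Proof. by rewrite /dvec tri_permC. Qed.

Lemma dvecR a b c : dvec a b c = dvec a c b.
Proof. by rewrite /dvec tri_permR. Qed.

Lemma dvec_trans a b c t : dvec (padd a t) (padd b t) (padd c t) = dvec a b c.
Proof.
by apply: dvec_ext => x; rewrite -ktrans_tri defect_trans ?dvecE//; exact: body_tri.
Qed.

Lemma dvec_rot co si a b c : is_SO2 co si -> dvec (rot co si a) (rot co si b) (rot co si c) =
  rot co si (dvec a b c).
Proof.
move=> cs; apply: dvec_ext => x; rewrite -krot_tri defect_rot ?dvecE//; last exact: body_tri.
by rewrite /pdot/=; ring.
Qed.

Lemma dvec_refl a b c : dvec (popp a) (popp b) (popp c) = popp (dvec a b c).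
Proof.
apply: dvec_ext => x; rewrite -krefl_tri defect_refl ?dvecE//; last exact: body_tri.
by rewrite /pdot/=; ring.
Qed.

Lemma dvec_cut a b c d : seg b c d -> dvec a b c = padd (dvec a b d) (dvec a d c).
Proof.
move=> sd; have [nc|nc] := boolP (noncollinear a b c).
  have e x := tri_cut (defect_cut x) nc sd.
  by apply: pt_eq; rewrite /dvec/= e defect_seg addr0.
have [t [_ de]] := sd.
have h : cross (psub b a) (psub c a) = 0 by move: nc; rewrite /noncollinear negbK => /eqP.
rewrite !dvec_collinear//; first by apply: pt_eq => /=; ring.
- rewrite /noncollinear negbK (_ : cross _ _ = t * cross (psub b a) (psub c a)).
    by rewrite h mulr0.
  by rewrite de /cross/=; ring.
- rewrite /noncollinear negbK (_ : cross _ _ = (1 - t) * cross (psub b a) (psub c a)).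
    by rewrite h mulr0.
  by rewrite de /cross/=; ring.
Qed.

Lemma hull_close3 a b c a' b' c' r : 0 <= r -> sqdist a a' <= r ^+ 2 -> sqdist b b' <= r ^+ 2 ->
  sqdist c c' <= r ^+ 2 -> close (tri a b c) (tri a' b' c') r.
Proof.
move=> r0 h1 h2 h3.
apply: (@hull_close _ (pt R * pt R)%type [:: (a, a'); (b, b'); (c, c')] fst snd) => // i.
by rewrite !inE => /or3P[] /eqP->.
Qed.

Lemma dvec_cont a b c x e : 0 < e -> exists2 d, 0 < d & forall a' b' c' r, 0 <= r -> r < d ->
  sqdist a a' <= r ^+ 2 -> sqdist b b' <= r ^+ 2 -> sqdist c c' <= r ^+ 2 ->
  `|pdot (dvec a b c) x - pdot (dvec a' b' c') x| < e.
Proof.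
move=> e0; have [d d0 hd] := defect_cont x (body_tri a b c) e0.
exists d => // a' b' c' r r0 rd h1 h2 h3; rewrite -!dvecE.
by apply: (hd _ r) => //; [exact: body_tri | exact: hull_close3].
Qed.

End Defect.

(** * Vector-valued functions of triangles that add up under cuts *)

Section TriangleFunctional.
Variable R : realType.
Implicit Types (p q x a b c d k : pt R).
Variable Y : pt R -> pt R -> pt R -> pt R.
Hypothesis Y_collinear : forall a b c, ~~ noncollinear a b c -> Y a b c = (0, 0).
Hypothesis YC : forall a b c, Y a b c = Y b a c.
Hypothesis YR : forall a b c, Y a b c = Y a c b.
Hypothesis Y_trans : forall a b c t, Y (padd a t) (padd b t) (padd c t) = Y a b c.
Hypothesis Y_rot : forall co si a b c, is_SO2 co si ->
  Y (rot co si a) (rot co si b) (rot co si c) = rot co si (Y a b c).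
Hypothesis Y_refl : forall a b c, Y (popp a) (popp b) (popp c) = popp (Y a b c).
Hypothesis Y_cut : forall a b c d, seg b c d -> Y a b c = padd (Y a b d) (Y a d c).
Hypothesis Y_cont : forall a b c x e, 0 < e -> exists2 d, 0 < d & forall a' b' c' r,
  0 <= r -> r < d -> sqdist a a' <= r ^+ 2 -> sqdist b b' <= r ^+ 2 -> sqdist c c' <= r ^+ 2 ->
  `|pdot (Y a b c) x - pdot (Y a' b' c') x| < e.

Lemma seg_between p (s t : R) : 0 <= s -> 0 <= t -> seg (0, 0) (pscale (s + t) p) (pscale s p).
Proof.
move=> s0 t0; have [st|st] := eqVneq (s + t) 0.
  have [-> ->] : s = 0 /\ t = 0 by split; lra.
  rewrite addr0 (_ : pscale 0 p = (0, 0)); first exact: segL.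
  by apply: pt_eq => /=; ring.
have st0 : 0 < s + t by rewrite lt_neqAle eq_sym st addr_ge0.
exists (t / (s + t)); split; first by rewrite divr_ge0 ?(ltW st0)//= ler_pdivrMr//; lra.
by apply: pt_eq => /=; field.
Qed.

(* Besides the two smaller copies, the subdivision leaves two triangles that are
   point reflections of each other, so their values cancel. *)
Lemma Y_add p q (s t : R) : 0 <= s -> 0 <= t ->
  Y (0, 0) (pscale (s + t) p) (pscale (s + t) q) =
  padd (Y (0, 0) (pscale s p) (pscale s q)) (Y (0, 0) (pscale t p) (pscale t q)).
Proof.
move=> s0 t0; set o : pt R := (0, 0); set P := pscale (s + t) p; set Q := pscale (s + t) q.
(* D, E, G lie on the sides oQ, oP, PQ. EPGD is a parallelogram, split by its diagonal PD. *)
set D := pscale s q; set E := pscale s p; pose G := padd (pscale t p) (pscale s q).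
have c1 : Y o P Q = padd (Y P o D) (Y P D Q) by rewrite YC; apply: Y_cut; exact: seg_between.
have c2 : Y P o D = padd (Y D o E) (Y D E P).
  by rewrite [Y P o D]YC [Y o P D]YR [Y o D P]YC; apply: Y_cut; exact: seg_between.
have c3 : Y P D Q = padd (Y D P G) (Y D G Q).
  rewrite [Y P D Q]YC; apply: Y_cut; have [l [l01 e]] := @seg_between (psub q p) s t s0 t0.
  exists l; split => //; move: e => /(congr1 (@padd R ^~ (pscale (s + t) p))) e.
  transitivity (padd (pscale s (psub q p)) (pscale (s + t) p)).
    by apply: pt_eq => /=; ring.
  by rewrite e; apply: pt_eq => /=; ring.
have c4 : Y D P G = popp (Y D E P).
  rewrite -Y_refl -(Y_trans (popp D) (popp E) (popp P) (padd D P)).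
  rewrite (_ : padd (popp D) _ = P); last by apply: pt_eq => /=; ring.
  rewrite (_ : padd (popp E) _ = G); last by apply: pt_eq => /=; ring.
  rewrite (_ : padd (popp P) _ = D); last by apply: pt_eq => /=; ring.
  by rewrite [RHS]YR [RHS]YC.
have c5 : Y D G Q = Y o (pscale t p) (pscale t q).
  rewrite -(Y_trans o _ _ D).
  by congr Y; apply: pt_eq => /=; ring.
have c6 : Y D o E = Y o E D by rewrite YC YR.
by rewrite c1 c2 c3 c4 c5 c6; apply: pt_eq => /=; ring.
Qed.

(** Cauchy's equation for [Y_add]; the smallness near 0 is continuity at the triangle that
    degenerates to a point. *)
Lemma Y_scale p q (t : R) : 0 <= t ->
  Y (0, 0) (pscale t p) (pscale t q) = pscale t (Y (0, 0) p q).
Proof.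
set o : pt R := (0, 0).
have one r : pscale 1 r = r by apply: pt_eq => /=; ring.
have main x : forall t, 0 <= t -> pdot (Y o (pscale t p) (pscale t q)) x = t * pdot (Y o p q) x.
  have := @additive_linear R (fun t => pdot (Y o (pscale t p) (pscale t q)) x).
  rewrite /= !one; apply => [s' t' s0 t0|e e0].
    by rewrite Y_add// /pdot/=; ring.
  have [d d0 hd] := Y_cont o o o x e0.
  pose N := 1 + (`|p.1| + `|p.2| + `|q.1| + `|q.2|).
  have N0 : 0 < N by rewrite ltr_pwDl// !addr_ge0.
  exists (d / N) => [|s s0]; first exact: divr_gt0.
  rewrite ltr_pdivlMr// => sd.
  have hN (v : pt R) : `|v.1| + `|v.2| <= N -> sqdist o (pscale s v) <= (s * N) ^+ 2.
    move=> hv; rewrite /sqdist /o/= !sub0r !sqrrN !exprMn -mulrDr ler_wpM2l ?sqr_ge0//.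
    have n1 := normr_ge0 v.1; have n2 := normr_ge0 v.2.
    rewrite -(real_normK (num_real v.1)) -(real_normK (num_real v.2)).
    by rewrite !expr2; nra.
  have sN : 0 <= s * N by rewrite mulr_ge0// ltW.
  have := hd o (pscale s p) (pscale s q) (s * N) sN sd.
  rewrite [Y o o o]Y_collinear; last by rewrite /noncollinear negbK; apply/eqP; rewrite /cross/=; ring.
  have -> : pdot (0, 0) x = 0 by rewrite /pdot/=; ring.
  rewrite sub0r normrN; apply.
  - by rewrite /sqdist !subrr expr0n/= addr0 sqr_ge0.
  - by apply: hN; rewrite /N; have := normr_ge0 q.1; have := normr_ge0 q.2; lra.
  - by apply: hN; rewrite /N; have := normr_ge0 p.1; have := normr_ge0 p.2; lra.
move=> t0; apply: pt_eq.
  by have := main (1, 0) t t0; rewrite /pdot/= !mulr1 !mulr0 !addr0.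
by have := main (0, 1) t t0; rewrite /pdot/= !mulr1 !mulr0 !add0r.
Qed.

(* rot k.1 k.2 is multiplication by the complex number k. *)
Lemma Y_sim k p q : Y (0, 0) (rot k.1 k.2 p) (rot k.1 k.2 q) = rot k.1 k.2 (Y (0, 0) p q).
Proof.
have [->|k0] := eqVneq k (0, 0).
  rewrite Y_collinear; first by apply: pt_eq => /=; ring.
  by rewrite /noncollinear negbK; apply/eqP; rewrite /cross/=; ring.
have [r [co [si [r0 cs ->]]]] := sqrt_polar k0.
have e v : rot (r * co) (r * si) v = pscale r (rot co si v) by apply: pt_eq => /=; ring.
rewrite !e Y_scale ?ltW// -Y_rot//; congr (pscale r (Y _ _ _)).
by apply: pt_eq => /=; ring.
Qed.

Lemma Y_base a b c : Y a b c = Y (0, 0) (psub b a) (psub c a).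
Proof.
rewrite -(Y_trans a b c (popp a)).
by congr Y; apply: pt_eq => /=; ring.
Qed.

(* The right triangle with hypotenuse [0,1] and angle t at 0, where (co, si) = (cos t, sin t). *)
Definition zeta (co si : R) : pt R := Y (0, 0) (1, 0) (co * co, co * si).

(** The half-turn about the midpoint of the hypotenuse exchanges its end points, hence the two acute
    angles. *)
Lemma zeta_below co si : is_SO2 co si -> Y (0, 0) (1, 0) (co * co, - (co * si)) = popp (zeta si co).
Proof.
rewrite /is_SO2 !expr2 => cs; rewrite /zeta -Y_refl -[RHS](Y_trans _ _ _ (1, 0)).
rewrite YC; congr Y; apply: pt_eq => /=; try ring.
by move: cs; lra.
Qed.

(** The altitude from W to the hypotenuse leaves two triangles similar to the whole one. As complex
    multiples of [zeta si co] their values have the factors -W and W - 1, which sum to -1. *)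
Lemma zeta_complement co si : is_SO2 co si -> 0 <= co -> 0 <= si -> zeta co si = popp (zeta si co).
Proof.
move=> cs c0 s0; have cs' := cs; rewrite /is_SO2 !expr2 in cs'.
set W : pt R := (co * co, co * si); pose H : pt R := (co * co, 0).
have cut : zeta co si = padd (Y W (0, 0) H) (Y W H (1, 0)).
  rewrite /zeta -/W [LHS]YR [LHS]YC; apply: Y_cut.
  by exists (si * si); split; [apply/andP; split; nra | apply: pt_eq => /=; lra].
have e1 : Y W (0, 0) H = rot W.1 W.2 (popp (zeta si co)).
  rewrite -zeta_below// -Y_sim YC; congr Y; apply: pt_eq => /=; try ring.
  by rewrite -[LHS]mulr1 -cs'; ring.
have e2 : Y W H (1, 0) = rot (- (si * si)) (co * si) (zeta si co).
  rewrite /zeta -(Y_sim (- (si * si), co * si)) -(Y_trans W _ _ (-1, 0)).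
  rewrite [LHS]YR [LHS]YC [in LHS]YR [LHS]YR.
  congr Y; apply: pt_eq => /=; try ring; try lra.
  rewrite (_ : co * co + -1 = - (si * si) * 1); last by lra.
  by rewrite -cs'; ring.
rewrite cut e1 e2; move: (zeta si co) => z; apply: pt_eq => /=.
  by transitivity (- z.1 * (co * co + si * si)); [ring | rewrite cs' mulr1].
by transitivity (- z.2 * (co * co + si * si)); [ring | rewrite cs' mulr1].
Qed.

(** Reflections in a line are not among the symmetries of Y; this one is obtained from the half-turn
    and the complement rule. *)
Lemma zeta_mirror co si : is_SO2 co si -> 0 <= co -> 0 <= si ->
  Y (0, 0) (1, 0) (co * co, - (co * si)) = zeta co si.
Proof. by move=> cs c0 s0; rewrite zeta_below// -zeta_complement. Qed.

(* Compares the dissections of the isosceles triangle with legs 1 and apex angle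
   2t along two of its altitudes. *)
Lemma zeta_double co si : is_SO2 co si -> 0 <= si -> si <= co ->
  zeta (co * co - si * si) (2 * co * si) = pscale 2 (zeta co si).
Proof.
move=> cs s0 sc; have c0 : 0 <= co by lra.
have cs' := cs; rewrite /is_SO2 !expr2 in cs'.
set c2 := co * co - si * si; set s2 := 2 * co * si.
(* Since si <= co the apex angle is at most a right angle, so the foot F of the altitude from B lies
   on the leg oC. *)
have c20 : 0 <= c2 by rewrite /c2; nra.
have s20 : 0 <= s2 by rewrite /s2 !mulr_ge0.
have cs2 : is_SO2 c2 s2.
  rewrite /is_SO2 (_ : c2 ^+ 2 + s2 ^+ 2 = (co * co + si * si) ^+ 2).
    by rewrite cs' expr1n.
  by rewrite /c2 /s2; ring.
pose B : pt R := (co, si); pose C : pt R := (co, - si); set o : pt R := (0, 0).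
have cut1 : Y o B C = padd (Y o B (co, 0)) (Y o (co, 0) C).
  by apply: Y_cut; exists 2^-1; split; [lra | apply: pt_eq => /=; field].
have k1 : co * (co * co) + si * (co * si) = co by rewrite -[RHS]mulr1 -cs'; ring.
have e1 : Y o B (co, 0) = rot co si (zeta co si).
  rewrite -zeta_mirror// -(Y_sim B).
  by congr Y; apply: pt_eq => /=; (ring || lra).
have e2 : Y o (co, 0) C = rot co (- si) (zeta co si).
  rewrite /zeta -(Y_sim C) YR.
  by congr Y; apply: pt_eq => /=; (ring || lra).
pose F := pscale c2 C.
have cut2 : Y o B C = padd (Y B o F) (Y B F C).
  rewrite YC; apply: Y_cut; exists (1 - c2); split.
    by apply/andP; split; [|lra]; rewrite subr_ge0 /c2; nra.
  by apply: pt_eq => /=; ring.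
have e3 : Y B o F = rot co si (zeta c2 s2).
  rewrite -zeta_mirror// -(Y_sim B) YC.
  have d1 : co * c2 + si * s2 = co.
    transitivity (co * (co * co + si * si)); first by rewrite /c2 /s2; ring.
    by rewrite cs' mulr1.
  have d2 : co * s2 - si * c2 = si.
    transitivity (si * (co * co + si * si)); first by rewrite /c2 /s2; ring.
    by rewrite cs' mulr1.
  congr Y; apply: pt_eq => /=; try ring.
    by rewrite -{1}d1; ring.
  by rewrite -{1}d2; ring.
have e4 : Y B F C = rot 0 (2 * si) (zeta si co).
  rewrite /zeta -(Y_sim (0, 2 * si)) -(Y_trans B _ _ (popp C)).
  rewrite [LHS]YR [LHS]YC.
  have c2e : c2 = 1 - 2 * (si * si) by rewrite /c2; lra.
  congr Y; apply: pt_eq => /=; rewrite ?c2e; try ring.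
have cs3 : is_SO2 si co by move: cs; rewrite /is_SO2 addrC.
rewrite [zeta si co]zeta_complement// in e4.
have := cut1; rewrite cut2 e1 e2 e3 e4 => /[dup] /(congr1 fst) /= h1 /(congr1 snd) /= h2.
set u1 := (zeta co si).1 in h1 h2; set u2 := (zeta co si).2 in h1 h2.
(* In complex notation the dissections give B zeta(2t) - 2i si zeta(t) = (B + C) zeta(t) = 2 co
   zeta(t), hence B zeta(2t) = 2B zeta(t). The factor B is then removed by its conjugate. *)
have g1 : co * (zeta c2 s2).1 - si * (zeta c2 s2).2 = 2 * (co * u1 - si * u2) by lra.
have g2 : si * (zeta c2 s2).1 + co * (zeta c2 s2).2 = 2 * (si * u1 + co * u2) by lra.
apply: pt_eq => /=.
  transitivity ((co * co + si * si) * (zeta c2 s2).1); first by rewrite cs' mul1r.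
  transitivity (co * (co * (zeta c2 s2).1 - si * (zeta c2 s2).2) +
    si * (si * (zeta c2 s2).1 + co * (zeta c2 s2).2)); first by ring.
  rewrite g1 g2; transitivity (2 * u1 * (co * co + si * si)); first by ring.
  by rewrite cs' mulr1.
transitivity ((co * co + si * si) * (zeta c2 s2).2); first by rewrite cs' mul1r.
transitivity (co * (si * (zeta c2 s2).1 + co * (zeta c2 s2).2) -
  si * (co * (zeta c2 s2).1 - si * (zeta c2 s2).2)); first by ring.
rewrite g1 g2; transitivity (2 * u2 * (co * co + si * si)); first by ring.
by rewrite cs' mulr1.
Qed.

(** The absolute values let the angle run over the whole line while only the first quadrant occurs,
    so the maximum can be taken on an interval. *)
Lemma zeta_continuous x : continuous (fun al : R => pdot (zeta `|cos al| `|sin al|) x).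
Proof.
pose F1 (al : R) := `|cos al| * `|cos al|; pose F2 (al : R) := `|cos al| * `|sin al|.
have cc : continuous (fun al : R => `|cos al|).
  by move=> al; apply: cvg_norm; exact: continuous_cos.
have cs : continuous (fun al : R => `|sin al|).
  by move=> al; apply: cvg_norm; exact: continuous_sin.
have c1 : continuous F1 by move=> al; apply: cvgM; exact: cc.
have c2 : continuous F2 by move=> al; apply: cvgM; [exact: cc | exact: cs].
move=> al; apply/cvgrPdist_lt => e e0.
have [d d0 hd] := Y_cont (0, 0) (1, 0) (F1 al, F2 al) x e0.
have d2 : 0 < d / 2 by rewrite divr_gt0.
have /cvgrPdist_lt/(_ _ d2) h1 := c1 al; have /cvgrPdist_lt/(_ _ d2) h2 := c2 al.
near=> be.
have k1 : `|F1 al - F1 be| < d / 2 by near: be.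
have k2 : `|F2 al - F2 be| < d / 2 by near: be.
apply: (hd (0, 0) (1, 0) (F1 be, F2 be) (`|F1 al - F1 be| + `|F2 al - F2 be|)).
- by rewrite addr_ge0.
- lra.
- by rewrite /sqdist !subrr expr0n/= addr0 sqr_ge0.
- by rewrite /sqdist !subrr expr0n/= addr0 sqr_ge0.
- rewrite /sqdist -(real_normK (num_real ((F1 al, F2 al).1 - _))) -(real_normK (num_real ((F1 al, F2 al).2 - _))).
  rewrite sqrrD lerD2r lerDl mulrn_wge0// mulr_ge0//.
Unshelve. all: end_near. Qed.

(* The doubling law makes twice every value of zeta again a value of zeta, so
   the maximum of its modulus vanishes. *)
Lemma zeta_eq0 co si : is_SO2 co si -> 0 <= co -> 0 <= si -> zeta co si = (0, 0).
Proof.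
have main x (c' s' : R) : is_SO2 c' s' -> 0 <= c' -> 0 <= s' -> pdot (zeta c' s') x = 0.
  pose h (al : R) := `|pdot (zeta `|cos al| `|sin al|) x|.
  have ch : continuous h by move=> al; apply: cvg_norm; exact: zeta_continuous.
  have pi0 : 0 <= 2 * pi :> R by rewrite mulr_ge0// pi_ge0.
  have [al _ hal] := EVT_max pi0 (continuous_subspaceT ch).
  have bnd co' si' : is_SO2 co' si' -> 0 <= co' -> 0 <= si' -> `|pdot (zeta co' si') x| <= h al.
    move=> cs c0 s0; have [be [b0 b1 eb1 eb2]] := angle_exists cs.
    have := hal be; rewrite in_itv/= b0 b1 => /(_ isT).
    by rewrite {1}/h eb1 eb2 (ger0_norm c0) (ger0_norm s0).
  have dbl co' si' : is_SO2 co' si' -> 0 <= si' -> si' <= co' -> 2 * `|pdot (zeta co' si') x| <= h al.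
    move=> cs s0 sc; have c0 : 0 <= co' by lra.
    rewrite -[2](@ger0_norm R)// -normrM.
    have -> : 2 * pdot (zeta co' si') x = pdot (pscale 2 (zeta co' si')) x by rewrite /pdot/=; ring.
    rewrite -zeta_double//; have cs' := cs; rewrite /is_SO2 !expr2 in cs'; apply: bnd.
    - rewrite /is_SO2 (_ : _ + _ = (co' * co' + si' * si') ^+ 2); last by ring.
      by rewrite cs' expr1n.
    - by rewrite subr_ge0 ler_pM.
    - by rewrite !mulr_ge0.
  have dbl' co' si' : is_SO2 co' si' -> 0 <= co' -> 0 <= si' -> 2 * `|pdot (zeta co' si') x| <= h al.
    move=> cs c0 s0; have [sc|/ltW sc] := leP si' co'; first exact: dbl.
    rewrite zeta_complement// (_ : pdot (popp _) x = - pdot (zeta si' co') x); last by rewrite /pdot/=; ring.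
    by rewrite normrN; apply: dbl => //; rewrite /is_SO2 addrC.
  have al0 : h al <= 0.
    have := dbl' `|cos al| `|sin al|; rewrite -/(h al) => k.
    have : 2 * h al <= h al by apply: k; rewrite // /is_SO2 !real_normK ?num_real// cos2Dsin2.
    lra.
  move=> cs c0 s0; apply/eqP; rewrite -normr_le0.
  by have := bnd c' s' cs c0 s0; lra.
move=> cs c0 s0; apply: pt_eq.
  by have := main (1, 0) co si cs c0 s0; rewrite /pdot/= mulr1 mulr0 addr0.
by have := main (0, 1) co si cs c0 s0; rewrite /pdot/= mulr1 mulr0 add0r.
Qed.

(** A similarity moves the hypotenuse bc to [0, 1]. By Thales the right angle w then lies on the
    circle w1^2 + w2^2 = w1, so w = (co^2, co si) or its mirror image. *)
Lemma Y_right a b c : noncollinear a b c -> pdot (psub b a) (psub c a) = 0 -> Y a b c = (0, 0).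
Proof.
move=> nc h; have n0 := dist2_gt0 (noncollinear_neq nc).
rewrite YC YR Y_base; set k := psub c b; set q := psub a b.
have kk : dist2 b c = k.1 * k.1 + k.2 * k.2 by [].
rewrite kk in n0; set m := k.1 * k.1 + k.2 * k.2 in n0.
(* The complex quotient q / k. *)
pose w : pt R := ((k.1 * q.1 + k.2 * q.2) / m, (k.1 * q.2 - k.2 * q.1) / m).
have m0 : m != 0 by rewrite gt_eqF.
have eq : q = rot k.1 k.2 w by apply: pt_eq; move: m0; rewrite /w /= /m /k /= => m0; field.
have ek : k = rot k.1 k.2 (1, 0) by apply: pt_eq => /=; ring.
have w2 : w.2 != 0.
  rewrite /w /= mulf_neq0 ?invr_neq0//; apply: contra nc => /eqP e; apply/eqP.
  by move: e; rewrite /k /q /cross/=; lra.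
have ww : w.1 * w.1 + w.2 * w.2 = w.1.
  have hh : q.1 * q.1 + q.2 * q.2 = k.1 * q.1 + k.2 * q.2 by move: h; rewrite /k /q /pdot/=; lra.
  transitivity ((q.1 * q.1 + q.2 * q.2) / m); last by rewrite hh.
  by move: m0; rewrite /w /= /m /k /= => m0; field.
have w1 : 0 < w.1.
  have := sqr_ge0 w.1; have : 0 < w.2 ^+ 2 by rewrite lt_neqAle eq_sym sqrf_eq0 w2 sqr_ge0.
  rewrite !expr2; lra.
have -> : Y (0, 0) k q = rot k.1 k.2 (Y (0, 0) (1, 0) w) by rewrite -Y_sim -ek -eq.
suff -> : Y (0, 0) (1, 0) w = (0, 0) by apply: pt_eq => /=; ring.
clearbody w.
pose co := Num.sqrt w.1; have co0 : 0 < co by rewrite sqrtr_gt0.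
have co2 : co * co = w.1 by rewrite -expr2 sqr_sqrtr// ltW.
pose si := `|w.2| / co; have si0 : 0 <= si by rewrite divr_ge0// ltW.
have cosi : co * si = `|w.2| by rewrite /si mulrC divfK// gt_eqF.
have cs : is_SO2 co si.
  rewrite /is_SO2 !expr2; apply: (mulfI (negbT (gt_eqF w1))); rewrite -{1}co2.
  have -> : co * co * (co * co + si * si) = (co * co) * (co * co) + (co * si) * (co * si) by ring.
  by rewrite cosi co2 -normrM ger0_norm ?ww ?mulr1// -expr2 sqr_ge0.
have [p0|p0] := leP 0 w.2.
  by have := zeta_eq0 cs (ltW co0) si0; rewrite /zeta co2 cosi (ger0_norm p0) -surjective_pairing.
have := zeta_mirror cs (ltW co0) si0.
by rewrite (zeta_eq0 cs (ltW co0) si0) co2 cosi (ltr0_norm p0) opprK -surjective_pairing.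
Qed.

Lemma Y_eq0 a b c : Y a b c = (0, 0).
Proof.
have [nc|] := boolP (noncollinear a b c); last exact: Y_collinear.
apply: (altitude_ind (P := fun a b c => Y a b c = (0, 0))) nc => {a b c}.
- by move=> a b c; rewrite YC.
- by move=> a b c; rewrite YR.
- exact: Y_right.
move=> a b c d _ _ _ sd e1 e2; rewrite (Y_cut a sd) e1 e2.
by apply: pt_eq => /=; ring.
Qed.

End TriangleFunctional.

Lemma normalized_classification (R : realType) (f : set (pt R) -> pt R -> R) : normalized f ->
  exists A : R, -1 <= A <= 1 /\ forall K x, convex_body K ->
    f K x = (1 - A) * support K x + (1 + A) * support K (popp x) + 2 * A * pdot x (steiner K).
Proof.
move=> nf; have [A [A1 hA]] := blend_const nf; exists A; split => // K x bK.
have Y0 a b c : dvec f A a b c = (0, 0).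
  apply: (Y_eq0 (Y := dvec f A)).
  - exact: dvec_collinear.
  - exact: dvecC.
  - exact: dvecR.
  - exact: dvec_trans.
  - exact: dvec_rot.
  - exact: dvec_refl.
  - exact: dvec_cut.
  - exact: dvec_cont.
have : defect f A K x = 0.
  apply: (vanish_body (v := fun K => defect f A K x)) => //.
  - exact: defect_cut.
  - by move=> a b; exact: defect_seg.
  - by move=> a b c; rewrite (dvecE nf hA) Y0 /pdot/=; ring.
  - by move=> e e0; exact: defect_cont.
by rewrite /defect; lra.
Qed.

(** * From the valuation to its formula *)

Section SymmetricArea.
Variable R : realType.
Implicit Types (K L M : set (pt R)) (u v p q x y z w : pt R).

Lemma body_rect (a b c d : R) : a <= b -> c <= d -> convex_body (rect a b c d).
Proof.
move=> ab cd; split; first by exists (a, c); split; rewrite /= in_itv/= lexx.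
split; first exact: compact_rect.
move=> x y t [/= x1 x2] [/= y1 y2] /andP[t0 t1].
move: x1 x2 y1 y2; rewrite /rect /= !in_itv/= => /andP[? ?] /andP[? ?] /andP[? ?] /andP[? ?].
by split; apply/andP; split; nra.
Qed.

Definition norm1 p : R := `|p.1| + `|p.2|.

Lemma norm1_ge0 p : 0 <= norm1 p.
Proof. by rewrite addr_ge0. Qed.

Lemma pdot_norm1 p q : `|pdot p q| <= norm1 p * norm1 q.
Proof.
rewrite /pdot /norm1; apply: le_trans (ler_normD _ _) _; rewrite !normrM.
have := normr_ge0 p.1; have := normr_ge0 p.2; have := normr_ge0 q.1; have := normr_ge0 q.2.
by nra.
Qed.

(** M contains the parallelogram with vertices x, y, -x, -y, and this contains the square with
    half-side r. By Cramer's rule X u is a combination of <u, x> and <u, y>, which bounds the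
    support function of the square by that of M. *)
Lemma symmetric_area M x y : convex_body M -> (forall z, M z -> M (popp z)) -> M x -> M y ->
  ((4 * (cross x y / (norm1 x + norm1 y)) ^+ 2)%:E <= area M)%E.
Proof.
move=> bM sM Mx My; set X := cross x y; set S := norm1 x + norm1 y.
have S0 : 0 <= S by rewrite addr_ge0// norm1_ge0.
pose r := `|X| / S; have r0 : 0 <= r by rewrite divr_ge0.
have rr : - r <= r by lra.
have -> : 4 * (X / S) ^+ 2 = (r - - r) * (r - - r).
  have -> : (r - - r) * (r - - r) = 4 * r ^+ 2 by ring.
  by rewrite /r !exprMn real_normK// num_real.
rewrite -area_rect//; apply: area_le; [exact: compact_rect | by case: bM => _ [] |].
apply: support_sub => //; first exact: body_rect.
move=> u; have [z [/= z1 z2] ->] := support_max u (body_rect rr rr).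
rewrite !in_itv/= in z1 z2.
have zn (t s : R) : - r <= t <= r -> s * t <= `|s| * r.
  rewrite -ler_norml => h; apply: le_trans (ler_norm _) _; rewrite normrM.
  exact: ler_wpM2l.
set h := support M u.
have bnd p : M p -> `|pdot u p| <= h.
  move=> Mp; rewrite ler_norml; apply/andP; split; last exact: support_ub.
  rewrite lerNl; have := support_ub u bM (sM _ Mp); rewrite /h; congr (_ <= _).
  by rewrite /pdot/=; ring.
have hx := bnd x Mx; have hy := bnd y My.
have h0 : 0 <= h by exact: le_trans (normr_ge0 _) hx.
have key : r * norm1 u <= h.
  (* For x = y = 0 division by zero gives r = 0. *)
  have [S_eq0|S_neq0] := eqVneq S 0; first by rewrite /r S_eq0 invr0 mulr0 mul0r.
  have S_gt0 : 0 < S by rewrite lt_neqAle eq_sym S_neq0.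
  rewrite /r mulrAC ler_pdivrMr// /norm1 mulrDr -!normrM.
  have -> : X * u.1 = pdot u x * y.2 - pdot u y * x.2 by rewrite /X /cross /pdot; ring.
  have -> : X * u.2 = pdot u y * x.1 - pdot u x * y.1 by rewrite /X /cross /pdot; ring.
  apply: le_trans (lerD (ler_normB _ _) (ler_normB _ _)) _; rewrite !normrM /S /norm1.
  have k (s : R) : `|pdot u x| * `|s| <= h * `|s| by exact: ler_wpM2r.
  have k' (s : R) : `|pdot u y| * `|s| <= h * `|s| by exact: ler_wpM2r.
  by have := k y.2; have := k' x.2; have := k' x.1; have := k y.1; lra.
apply: le_trans key; rewrite /pdot /norm1 mulrDr.
by have := zn _ u.1 z1; have := zn _ u.2 z2; lra.
Qed.

Lemma symmetric_area0 M x y : convex_body M -> (forall z, M z -> M (popp z)) ->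
  (area M <= 0)%E -> M x -> M y -> cross x y = 0.
Proof.
move=> bM sM a0 Mx My; have := le_trans (symmetric_area bM sM Mx My) a0.
rewrite lee_fin pmulr_rle0// => h; have := sqr_ge0 (cross x y / (norm1 x + norm1 y)).
move=> h'; have : (cross x y / (norm1 x + norm1 y)) ^+ 2 = 0 by lra.
move/eqP; rewrite sqrf_eq0 mulf_eq0 invr_eq0 => /orP[/eqP//|/eqP n0].
have n1 := norm1_ge0 x; have n2 := norm1_ge0 y.
have : norm1 x = 0 by lra.
rewrite /norm1 => nx; have x1 := normr_ge0 x.1; have x2 := normr_ge0 x.2.
have /eqP : `|x.1| = 0 by lra.
have /eqP : `|x.2| = 0 by lra.
by rewrite !normr_eq0 /cross => /eqP-> /eqP->; rewrite !mul0r subr0.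
Qed.

(** Without area all points of M are parallel to any nonzero x in M; an end point w is one that
    maximizes <x, .>. *)
Lemma symmetric_segment M : convex_body M -> (forall z, M z -> M (popp z)) ->
  (area M <= 0)%E -> exists w, forall u, support M u = `|pdot w u|.
Proof.
move=> bM sM a0; have par x y := symmetric_area0 bM sM a0 (x := x) (y := y).
have hn x y : M y -> `|pdot x y| <= support M x.
  move=> My; rewrite ler_norml; apply/andP; split; last exact: support_ub.
  rewrite lerNl; have := support_ub x bM (sM _ My); congr (_ <= _).
  by rewrite /pdot/=; ring.
have [[x [Mx x0]]|h] := pselect (exists x, M x /\ x != (0, 0)); last first.
  exists (0, 0) => u; have [z Mz ->] := support_max u bM.
  have -> : z = (0, 0) by apply/eqP; apply: contra_notT h => z0; exists z.
  by rewrite /pdot/= !mulr0 !mul0r !addr0 normr0.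
have [w Mw ew] := support_max x bM; exists w => u.
have xx : 0 < pdot x x.
  rewrite /pdot -!expr2 lt_neqAle addr_ge0 ?sqr_ge0// andbT eq_sym.
  apply: contra x0; rewrite paddr_eq0 ?sqr_ge0// !sqrf_eq0 => /andP[/eqP h1 /eqP h2].
  by apply/eqP; exact: pt_eq.
have key y : M y -> pdot x x * pdot u y = pdot x y * pdot x u.
  move=> My; have := par _ _ Mx My => e.
  transitivity (pdot x y * pdot x u + cross x y * cross x u); last by rewrite e mul0r addr0.
  by rewrite /pdot /cross; ring.
apply/eqP; rewrite eq_le; apply/andP; split; last first.
  by rewrite (_ : pdot w u = pdot u w) ?hn// /pdot; ring.
have [y My ->] := support_max u bM.
rewrite -(ler_pM2l xx) key// -[X in X * `|_|](ger0_norm (ltW xx)) -normrM.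
rewrite (_ : pdot w u = pdot u w); last by rewrite /pdot; ring.
rewrite key// normrM; apply: le_trans (ler_norm _) _; rewrite normrM ler_wpM2r//.
by rewrite -ew; apply: le_trans (hn x y My) _; rewrite ew ler_norm.
Qed.

End SymmetricArea.

Section SteinerBlend.
Variable R : realType.

Definition steiner_blend (c s a b : R) (K : set (pt R)) : set (pt R) := ksum
  (kscale a (krot c s (ktrans K (popp (steiner K)))))
  (kscale b (krot c s (ktrans (krefl K) (steiner K)))).

Lemma body_steiner_blend c s a b K : convex_body K -> convex_body (steiner_blend c s a b K).
Proof.
move=> bK; apply: body_ksum; apply: body_kscale; apply: body_krot; apply: body_ktrans => //.
exact: body_krefl.
Qed.

Lemma support_steiner_blend c s a b K u : 0 <= a -> 0 <= b -> convex_body K ->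
  support (steiner_blend c s a b K) u =
  a * (support K (rot c (- s) u) - pdot (rot c (- s) u) (steiner K)) +
  b * (support K (popp (rot c (- s) u)) + pdot (rot c (- s) u) (steiner K)).
Proof.
move=> a0 b0 bK; have bK' := body_krefl bK.
have t1 := body_ktrans (popp (steiner K)) bK; have t2 := body_ktrans (steiner K) bK'.
have k1 := body_krot c s t1; have k2 := body_krot c s t2.
rewrite support_ksum; try exact: body_kscale.
rewrite !support_kscale// !support_krot// !support_ktrans// support_krefl//.
by congr (_ * (_ + _) + _); rewrite /pdot/=; ring.
Qed.

End SteinerBlend.

(** * Images of boxes and the factorization of V *)

Section Forward.
Variable R : realType.
Implicit Types (K L : set (pt R)) (u v p q x y z w : pt R).
Variable Phi : set (pt R) -> set (pt R).
Hypothesis mP : maps_bodies Phi.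
Hypothesis cP : hcontinuous Phi.
Hypothesis tP : translation_invariant Phi.
Hypothesis vP : minkowski_valuation Phi.
Hypothesis soP : SO2_covariant Phi.
Variables c0 C0 : R.
Hypothesis c0_gt0 : 0 < c0.
Hypothesis C0_gt0 : 0 < C0.
Hypothesis area_lower : forall K, convex_body K -> (c0%:E * area K <= area (Phi K))%E.
Hypothesis area_upper : forall K, convex_body K -> (area (Phi K) <= C0%:E * area K)%E.

Notation bx s t := (rect 0 s 0 t).

Lemma krot_rect (s t : R) : krot 0 1 (bx s t) = ktrans (bx t s) (- t, 0).
Proof.
apply/seteqP; split => [_ [[x y] [/= h1 h2] <-]|_ [[x y] [/= h1 h2] <-]];
  rewrite !in_itv/= in h1 h2.
  exists (t - y, x); last by apply: pt_eq => /=; ring.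
  by split; rewrite /= in_itv/= //; apply/andP; split; lra.
exists (y, t - x); last by apply: pt_eq => /=; ring.
by split; rewrite /= in_itv/= //; apply/andP; split; lra.
Qed.

Lemma krefl_rect (s t : R) : krefl (bx s t) = ktrans (bx s t) (- s, - t).
Proof.
apply/seteqP; split => [_ [[x y] [/= h1 h2] <-]|_ [[x y] [/= h1 h2] <-]];
  rewrite !in_itv/= in h1 h2.
  exists (s - x, t - y); last by apply: pt_eq => /=; ring.
  by split; rewrite /= in_itv/= //; apply/andP; split; lra.
exists (s - x, t - y); last by apply: pt_eq => /=; ring.
by split; rewrite /= in_itv/= //; apply/andP; split; lra.
Qed.

Lemma Phi_rect_sym (s t : R) z : 0 <= s -> 0 <= t -> Phi (bx s t) z -> Phi (bx s t) (popp z).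
Proof.
move=> s0 t0 hz; have bB := body_rect s0 t0.
have so : is_SO2 (-1 : R) 0 by rewrite /is_SO2; ring.
rewrite -(tP (- s, - t) bB) -krefl_rect krefl_krot soP//.
by exists z => //; apply: pt_eq => /=; ring.
Qed.

Lemma Phi_square_rot (s : R) z : 0 <= s -> Phi (bx s s) z -> Phi (bx s s) (rot 0 1 z).
Proof.
move=> s0 hz; have bB := body_rect s0 s0.
rewrite -(tP (- s, 0) bB) -krot_rect soP//; last by rewrite /is_SO2; ring.
by exists z.
Qed.

Lemma area_Phi_rect (s t : R) : 0 <= s -> 0 <= t -> (area (Phi (bx s t)) <= (C0 * (s * t))%:E)%E.
Proof.
move=> s0 t0; apply: le_trans (area_upper (body_rect s0 t0)) _.
by rewrite area_rect// !subr0 EFinM.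
Qed.

Definition hrect (s t : R) u := support (Phi (bx s t)) u.

(** The image of a point has no area and is invariant under quarter-turns, and the cross product of
    z with its quarter-turn is the squared norm of z. *)
Lemma hrect00 u : hrect 0 0 u = 0.
Proof.
have l0 : 0 <= 0 :> R by [].
have bB := body_rect l0 l0; have bP := mP bB.
have a0 : (area (Phi (bx 0 0)) <= 0)%E.
  by have := area_Phi_rect l0 l0; rewrite !mulr0.
rewrite /hrect; have [z Mz ->] := support_max u bP.
have := symmetric_area0 bP (fun z => Phi_rect_sym (z := z) l0 l0) a0 Mz (Phi_square_rot l0 Mz).
rewrite /cross/= => e; have h1 := sqr_ge0 z.1; have h2 := sqr_ge0 z.2.
rewrite !expr2 in h1 h2.
have /eqP : z.1 * z.1 = 0 by lra.
have /eqP : z.2 * z.2 = 0 by lra.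
rewrite !mulf_eq0 !orbb => /eqP e2 /eqP e1.
by rewrite /pdot e1 e2; ring.
Qed.

Lemma hrect_add (s s' t : R) u : 0 <= s -> 0 <= s' -> 0 <= t ->
  hrect (s + s') t u + hrect 0 t u = hrect s t u + hrect s' t u.
Proof.
move=> s0 s'0 t0; have ss0 : 0 <= s + s' by rewrite addr_ge0.
have bB := body_rect ss0 t0; have pd x : pdot (1, 0) x = x.1 by rewrite /pdot/=; ring.
have e1 : bx (s + s') t `&` half_le (1, 0) s = bx s t.
  apply/seteqP; split => [[x y] [[/= h1 h2]]|[x y] [/= h1 h2]];
    rewrite /half_le/= pd /=; rewrite !in_itv/= in h1 h2.
    by move=> h3; split; rewrite /= in_itv/=; lra.
  by split; [split; rewrite /= in_itv/=; lra | lra].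
have e2 : bx (s + s') t `&` half_ge (1, 0) s = ktrans (bx s' t) (s, 0).
  apply/seteqP; split => [[x y] [[/= h1 h2]]|_ [[x y] [/= h1 h2] <-]];
    rewrite /half_ge/= pd /=; rewrite !in_itv/= in h1 h2.
    move=> h3; exists (x - s, y); last by apply: pt_eq => /=; ring.
    by split; rewrite /= in_itv/=; lra.
  by split; [split; rewrite /= in_itv/=; lra | lra].
have e3 : bx (s + s') t `&` line (1, 0) s = ktrans (bx 0 t) (s, 0).
  apply/seteqP; split => [[x y] [[/= h1 h2]]|_ [[x y] [/= h1 h2] <-]];
    rewrite /line/= pd /=; rewrite !in_itv/= in h1 h2.
    move=> h3; exists (0, y); last by apply: pt_eq; rewrite /= ?h3; ring.
    by split; rewrite /= in_itv/=; lra.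
  have -> : x = 0 by lra.
  by split; [split; rewrite /= in_itv/=; lra | lra].
have l0 : 0 <= 0 :> R by [].
have := @valuation_cut _ Phi _ (1, 0) s u mP vP bB.
rewrite e1 e2 e3 !tP; try exact: body_rect.
move=> <- //; first by have [] := body_rect s0 t0.
by have [] := body_ktrans (s, 0) (body_rect s'0 t0).
Qed.

Lemma hrect_swap (s t : R) u : 0 <= s -> 0 <= t -> hrect t s u = hrect s t (rot 0 (-1) u).
Proof.
move=> s0 t0; have bB := body_rect s0 t0; have bB' := body_rect t0 s0.
rewrite /hrect -(tP (- t, 0) bB') -krot_rect soP//; last by rewrite /is_SO2; ring.
by rewrite support_krot//; exact: mP.
Qed.

Lemma hrect_linear (s t : R) u : 0 <= s -> 0 <= t -> hrect s t u = hrect 0 t u + s * (hrect 1 t u - hrect 0 t u).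
Proof.
move=> s0 t0; have l0 : 0 <= 0 :> R by [].
have := @additive_linear R (fun s => hrect s t u - hrect 0 t u) _ _ s s0 => /= <-.
- by ring.
- by move=> a b a0 b0; have := hrect_add u a0 b0 t0; lra.
move=> e e0; have [d d0 hd] := hcontinuous_support u mP cP (body_rect l0 t0) e0.
exists d => // r r0 rd; rewrite distrC; apply: (hd _ r) => //.
  by apply: body_rect => //; exact: ltW.
split; first exact: ltW.
  move=> x [/= h1 h2]; rewrite !in_itv/= in h1 h2; exists x.
    by split; rewrite /= in_itv/=; lra.
  by rewrite /sqdist !subrr expr0n/= addr0 sqr_ge0.
move=> x [/= h1 h2]; rewrite !in_itv/= in h1 h2; exists (0, x.2).
  by split; rewrite /= in_itv/=; lra.
by rewrite /sqdist /= subrr subr0 expr0n/= addr0 !expr2; nra.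
Qed.

(** Affine in s by Cauchy's equation, hence affine in t by a quarter-turn; the constant term is the
    image of a point. *)
Lemma hrect_bilinear (s t : R) u : 0 <= s -> 0 <= t ->
  hrect s t u = s * hrect 1 0 u + t * hrect 0 1 u + s * t * (hrect 1 1 u - hrect 1 0 u - hrect 0 1 u).
Proof.
move=> s0 t0; have l0 : 0 <= 0 :> R by []; have l1 : 0 <= 1 :> R by [].
have vert r v : 0 <= r -> hrect 0 r v = r * hrect 0 1 v.
  move=> r0; rewrite (hrect_swap v r0 l0) hrect_linear// hrect00 (hrect_swap v l1 l0); ring.
have e1 : hrect 1 t u = hrect 1 0 u + t * (hrect 1 1 u - hrect 1 0 u).
  by rewrite (hrect_swap u t0 l1) hrect_linear// -!hrect_swap.
by rewrite hrect_linear// vert// e1; ring.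
Qed.

(* The bilinear part scales like an area, hence its support function would
   make the area of the image of a square grow like the fourth power. *)
Lemma hrect11 u : hrect 1 1 u = hrect 1 0 u + hrect 0 1 u.
Proof.
pose D := hrect 1 1 u - hrect 1 0 u - hrect 0 1 u; pose B := hrect 1 0 u + hrect 0 1 u.
(* The area bound gives [norm1 z ^+ 2 <= 4 C0 s^2], and the modulus of <u, z> is at most [norm1 u]
   times [norm1 z]; the common factor s^2 cancels. *)
pose Q := 4 * norm1 u ^+ 2 * C0.
have bnd (s : R) : 0 < s -> (B + s * D) ^+ 2 <= Q.
  move=> sp; have s0 := ltW sp; have bP := mP (body_rect s0 s0).
  have [z Mz ez] := support_max u bP.
  have Fz : s * (B + s * D) = pdot u z.
    by rewrite -ez -/(hrect s s u) hrect_bilinear// /B /D; ring.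
  have := le_trans (symmetric_area bP (fun z => Phi_rect_sym (z := z) s0 s0) Mz (Phi_square_rot s0 Mz)) (area_Phi_rect s0 s0).
  rewrite lee_fin.
  have -> : norm1 (rot 0 1 z) = norm1 z.
    by rewrite /norm1 /= !mul0r !mul1r addr0 sub0r normrN addrC.
  set n := norm1 z; have n0 : 0 <= n by exact: norm1_ge0.
  have -> : cross z (rot 0 1 z) = z.1 ^+ 2 + z.2 ^+ 2 by rewrite /cross/=; ring.
  set X := z.1 ^+ 2 + z.2 ^+ 2 => h.
  have nX : n ^+ 2 <= 2 * X.
    rewrite /n /norm1 /X -(real_normK (num_real z.1)) -(real_normK (num_real z.2)).
    by have := sqr_ge0 (`|z.1| - `|z.2|); lra.
  have h' : n ^+ 2 <= 4 * (C0 * (s * s)).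
    have [ne0|nn0] := eqVneq n 0.
      by rewrite ne0 expr0n/= !mulr_ge0// ltW.
    have np : 0 < n by rewrite lt_neqAle eq_sym nn0.
    (* X is the squared Euclidean norm of z, hence at least n^2/2. *)
    have k : n / 4 <= X / (n + n).
      by rewrite ler_pdivlMr; [lra | lra].
    have : (n / 4) ^+ 2 <= (X / (n + n)) ^+ 2.
      have k0 : 0 <= n / 4 by rewrite divr_ge0.
      by rewrite ler_pXn2r// nnegrE// (le_trans k0 k).
    have -> : (n / 4) ^+ 2 = n ^+ 2 / 16 by field.
    lra.
  have := pdot_norm1 u z; rewrite -Fz -/n => k.
  have k2 : (s * (B + s * D)) ^+ 2 <= (norm1 u * n) ^+ 2.
    rewrite -(real_normK (num_real (s * _))) ler_pXn2r// nnegrE//.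
    by rewrite mulr_ge0// norm1_ge0.
  rewrite -(ler_pM2l (_ : 0 < s ^+ 2)) ?exprn_gt0// -exprMn; apply: le_trans k2 _.
  rewrite exprMn /Q; have := ler_wpM2l (sqr_ge0 (norm1 u)) h'.
  by rewrite (expr2 s); lra.
have [D0|D0] := eqVneq D 0; first by move: D0; rewrite /D; lra.
have Dp : 0 < `|D| by rewrite normr_gt0.
have Q0 : 0 <= Q by rewrite /Q mulr_ge0 ?(ltW C0_gt0)// mulr_ge0// sqr_ge0.
(* So large that the modulus of B + sD is at least Q + 2, whose square exceeds Q. *)
pose s := (`|B| + Q + 2) / `|D|.
have s0 : 0 < s by rewrite divr_gt0//; have := normr_ge0 B; lra.
have sD : s * `|D| = `|B| + Q + 2 by rewrite divfK// gt_eqF.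
have := bnd s s0; rewrite -(real_normK (num_real (B + _))).
have : Q + 2 <= `|B + s * D|.
  have := lerB_normD (s * D) B; rewrite normrM (gtr0_norm s0) sD [s * D + B]addrC.
  lra.
move=> h1 h2; exfalso; move: h2; rewrite expr2; nra.
Qed.

Lemma support_Phi_rect (s t : R) u : 0 <= s -> 0 <= t -> hrect s t u = s * hrect 1 0 u + t * hrect 0 1 u.
Proof. by move=> s0 t0; rewrite hrect_bilinear// hrect11; ring. Qed.

Lemma forward : exists c s a b : R, is_SO2 c s /\ 0 <= a /\ 0 <= b /\ 0 < a + b /\
  forall K, convex_body K -> Phi K = steiner_blend c s a b K.
Proof.
have l0 : 0 <= 0 :> R by []; have l1 : 0 <= 1 :> R by [].
have a0 : (area (Phi (bx 1 0)) <= 0)%E by have := area_Phi_rect l1 l0; rewrite !mulr0.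
have [w hw] := symmetric_segment (mP (body_rect l1 l0)) (fun z => Phi_rect_sym (z := z) l1 l0) a0.
(* The transpose of complex multiplication by w, where the image of the unit segment is the segment
   from -w to w. *)
pose V u : pt R := rot w.1 (- w.2) u.
have F10 u : hrect 1 0 u = `|(V u).1| by rewrite /hrect hw; congr `|_|; rewrite /pdot/=; ring.
have F01 u : hrect 0 1 u = `|(V u).2|.
  by rewrite (hrect_swap u l1 l0) F10; congr `|_|; rewrite /=; ring.
(* If w = 0, the image of the unit square would be a point, against the lower area bound. *)
have w0 : w != (0, 0).
  apply/eqP => w0; have V0 u : V u = (0, 0) by rewrite /V w0; apply: pt_eq => /=; ring.
  have bP := mP (body_rect l1 l1).
  have sub : Phi (bx 1 1) `<=` rect 0 0 0 0.
    apply: support_sub => //; first exact: body_rect.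
    move=> u; rewrite -/(hrect 1 1 u) hrect11 F10 F01 V0 /= normr0 addr0.
    have h0 : rect 0 0 0 0 ((0, 0) : pt R) by split; rewrite /= in_itv/= lexx.
    by apply: le_trans (support_ub u (body_rect l0 l0) h0); rewrite /pdot/=; lra.
  have := area_lower (body_rect l1 l1); rewrite area_rect// => h.
  have := le_trans h (area_le _ _ sub); rewrite area_rect// -EFinM lee_fin => /(_ _ _) h'.
  have : c0 * ((1 - 0) * (1 - 0)) <= (0 - 0) * (0 - 0) :> R.
    by apply: h'; [by case: bP => _ [] | exact: compact_rect].
  by have := c0_gt0; lra.
have [r [co [si [r0 cs we]]]] := sqrt_polar w0.
have cs' := cs; rewrite /is_SO2 !expr2 in cs'.
pose W x : pt R := rot (co / r) (si / r) x.
have rn0 : r != 0 by rewrite gt_eqF.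
have VE u : V u = pscale r (rot co (- si) u) by rewrite /V we; apply: pt_eq => /=; ring.
have WV u : W (V u) = u.
  rewrite VE; apply: pt_eq; rewrite /W /=.
    by rewrite -[RHS]mulr1 -cs'; field.
  by rewrite -[RHS]mulr1 -cs'; field.
have VW x : V (W x) = x.
  rewrite VE; apply: pt_eq; rewrite /W /=.
    by rewrite -[RHS]mulr1 -cs'; field.
  by rewrite -[RHS]mulr1 -cs'; field.
pose f K x := support (Phi K) (W x).
have seg_axis t : 0 <= t -> seg (0, 0) (t, 0) = bx t 0.
  move=> t0; rewrite rect_hull// -hull_seg; apply/seteqP.
  by split; apply: hull_incl => z; rewrite !inE; repeat case: eqP => //=.
have nf : normalized f.
  split.
  - by move=> x K n c bK K1 K2; exact: valuation_cut.
  - by move=> K t x bK; rewrite /f tP.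
  (* W is a complex multiplication and commutes with rotations. *)
  - move=> c s K x cs1 bK; rewrite /f soP// support_krot; last exact: mP.
    by congr support; apply: pt_eq => /=; ring.
  - move=> K x y bK; have -> : f K (padd x y) = support (Phi K) (padd (W x) (W y)).
      by congr support; apply: pt_eq => /=; ring.
    by apply: supportD; exact: mP.
  - move=> K t x t0 bK; have -> : f K (pscale t x) = support (Phi K) (pscale t (W x)).
      by congr support; apply: pt_eq => /=; ring.
    by apply: supportZ => //; exact: mP.
  - by move=> K x e bK e0; exact: hcontinuous_support.
  - move=> p q x; have [pq|pq] := eqVneq (psub q p) (0, 0).
      have -> : seg p q = ktrans (bx 0 0) p.
        have -> : q = p by apply: pt_eq; move: pq => /(congr1 (fun z => (z.1, z.2))) [] /=; lra.
        rewrite -seg_axis// -!hull_seg ktrans_hull /=; congr (hull [:: _; _]).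
          by apply: pt_eq => /=; ring.
        by apply: pt_eq => /=; ring.
      rewrite /f tP; last exact: body_rect.
      by rewrite -/(hrect 0 0 _) hrect00 pq /pdot/= !mul0r addr0 normr0.
    have [t [c [s [t0 cs1 pqe]]]] := sqrt_polar pq.
    have -> : seg p q = ktrans (krot c s (bx t 0)) p.
      rewrite -seg_axis ?ltW// -!hull_seg krot_hull ktrans_hull.
      rewrite (_ : [seq padd i p | i <- _] = [:: p; q])//.
      congr [:: _; _]; apply: pt_eq => /=; try ring.
        by move: pqe => /(congr1 fst) /=; lra.
      by move: pqe => /(congr1 snd) /=; lra.
    have bT := body_rect (ltW t0) l0.
    rewrite /f tP; last exact: body_krot.
    rewrite soP// support_krot; last exact: mP.
    rewrite -/(hrect t 0 _) support_Phi_rect// ?ltW// mul0r addr0 F10.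
    rewrite -[X in X * `|_|](gtr0_norm t0) -normrM; congr `|_|.
    have -> : V (rot c (- s) (W x)) = rot c (- s) x.
      rewrite -{2}(VW x); apply: pt_eq => /=; ring.
    by rewrite pqe /pdot/=; ring.
  - by move=> s t x s0 t0; rewrite /f -/(hrect s t _) support_Phi_rect// F10 F01 VW.
have [A [/andP[A1 A2] hA]] := normalized_classification nf.
(* V is the inverse rotation scaled by r; the two coefficients sum to 2r > 0. *)
exists co, si, ((1 - A) * r), ((1 + A) * r); split => //.
have a10 : 0 <= (1 - A) * r by rewrite mulr_ge0 ?(ltW r0)//; lra.
have a20 : 0 <= (1 + A) * r by rewrite mulr_ge0 ?(ltW r0)//; lra.
split => //; split => //; split.
  rewrite (_ : _ + _ = 2 * r); last by ring.
  by rewrite mulr_gt0.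
move=> K bK; apply: support_inj; [exact: mP | exact: body_steiner_blend |] => u.
have -> : support (Phi K) u = f K (V u) by rewrite /f WV.
rewrite hA// support_steiner_blend// VE (supportZ _ (ltW r0) bK).
have -> : popp (pscale r (rot co (- si) u)) = pscale r (popp (rot co (- si) u)).
  by apply: pt_eq => /=; ring.
by rewrite (supportZ _ (ltW r0) bK) /pdot/=; ring.
Qed.

End Forward.

(** * From the formula to the valuation *)

Section Backward.
Variable R : realType.
Implicit Types (K L : set (pt R)) (u p q z : pt R).

(* The shear makes the leftmost and the rightmost point of K level; the inner
   box is inscribed in the triangle spanned by them and the point of K farthest
   from the line through them. *)
Lemma shear_box K : convex_body K -> exists l t1 t2 wd h x0 y0 : R, [/\ 0 <= wd, 0 <= h,
  forall p, K p -> 0 <= p.1 + t1 <= wd /\ - h <= p.2 + l * p.1 + t2 <= h &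
  forall x y, x0 <= x <= x0 + wd / 2 -> y0 <= y <= y0 + h / 2 ->
    exists p, [/\ K p, x = p.1 + t1 & y = p.2 + l * p.1 + t2]].
Proof.
move=> bK; have [_ [_ vK]] := bK.
have [q1 Kq1 e1] := support_max (-1, 0) bK; have [q2' Kq2' e2] := support_max (1, 0) bK.
have lo p : K p -> q1.1 <= p.1.
  by move=> Kp; have := support_ub (-1, 0) bK Kp; rewrite e1 /pdot/=; lra.
have hi p : K p -> p.1 <= q2'.1.
  by move=> Kp; have := support_ub (1, 0) bK Kp; rewrite e2 /pdot/=; lra.
(* If K lies on a vertical line, q2 must be q1: the slope l is then 0 by division by zero and could
   not level two different points. *)
have [q2 [Kq2 q2E q2q1]] : exists q2, [/\ K q2, q2.1 = q2'.1 & q2.1 = q1.1 -> q2 = q1].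
  have [e|ne] := eqVneq q2'.1 q1.1; first by exists q1.
  by exists q2'; split => // e; rewrite e eqxx in ne.
pose wd := q2.1 - q1.1; have wd0 : 0 <= wd by rewrite subr_ge0; exact: lo.
pose l := - ((q2.2 - q1.2) / wd); pose t1 := - q1.1; pose t2 := - (q1.2 + l * q1.1).
pose S p : pt R := (p.1 + t1, p.2 + l * p.1 + t2).
have Sq1 : S q1 = (0, 0) by apply: pt_eq => /=; rewrite /t1 /t2; ring.
have Sq2 : S q2 = (wd, 0).
  apply: pt_eq => /=; first by rewrite /t1 /wd.
  rewrite /t2 (_ : _ + _ = q2.2 - q1.2 + l * wd); last by rewrite /wd; ring.
  rewrite /l; have [w0|w0] := eqVneq wd 0.
    rewrite w0 mulr0 addr0 q2q1 ?subrr//.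
    by move: w0; rewrite /wd; lra.
  by rewrite mulNr divfK// subrr.
have SC p q (t : R) : S (padd (pscale t p) (pscale (1 - t) q)) =
    padd (pscale t (S p)) (pscale (1 - t) (S q)) by apply: pt_eq => /=; ring.
have base x : 0 <= x <= wd -> exists2 p, K p & S p = (x, 0).
  move=> /andP[x0 x1]; have [w0|w0] := eqVneq wd 0.
    by exists q1 => //; rewrite Sq1; congr (_, _); lra.
  have wp : 0 < wd by rewrite lt_neqAle eq_sym w0.
  exists (padd (pscale (x / wd) q2) (pscale (1 - x / wd) q1)).
    by apply: vK => //; rewrite divr_ge0//= ler_pdivrMr// mul1r.
  by rewrite SC Sq1 Sq2; apply: pt_eq => /=; field.
pose n : pt R := (l, 1).
have Sn p : (S p).2 = pdot n p + t2 by rewrite /pdot /S/=; ring.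
have [a Ka ea] := support_max n bK; have [b Kb eb] := support_max (popp n) bK.
have top p : K p -> (S p).2 <= (S a).2.
  by move=> Kp; have := support_ub n bK Kp; rewrite ea !Sn; lra.
have bot p : K p -> (S b).2 <= (S p).2.
  by move=> Kp; have := support_ub (popp n) bK Kp; rewrite eb !Sn /pdot/=; lra.
have [P [KP hP]] : exists P, K P /\ forall p, K p -> `|(S p).2| <= `|(S P).2|.
  have b0 : (S b).2 <= 0 by have := bot _ Kq1; rewrite Sq1.
  have a0 : 0 <= (S a).2 by have := top _ Kq1; rewrite Sq1.
  have [ab|ab] := leP (- (S b).2) (S a).2.
    exists a; split => // p Kp; have := top p Kp; have := bot p Kp.
    by rewrite (ger0_norm a0) ler_norml => h1 h2; apply/andP; split; lra.
  exists b; split => // p Kp; have := top p Kp; have := bot p Kp.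
  by rewrite (ler0_norm b0) ler_norml => h1 h2; apply/andP; split; lra.
pose h := `|(S P).2|; have P10 : 0 <= (S P).1 by have := lo _ KP; rewrite /S /t1/=; lra.
have P1w : (S P).1 <= wd by have := hi _ KP; rewrite /S /t1 /wd q2E/=; lra.
(* At the fraction th of the height of P, the triangle has the slice from th P1 to th P1 + (1 - th)
   wd. For th <= 1/2 and 0 <= P1 <= wd it contains the interval from P1/2 to P1/2 + wd/2. *)
have slice x th : (S P).1 / 2 <= x <= (S P).1 / 2 + wd / 2 -> 0 <= th <= 2^-1 ->
    exists2 p, K p & S p = (x, th * (S P).2).
  move=> /andP[x0 x1] /andP[th0 th1]; have th2 : 0 < 1 - th by lra.
  have [|p Kp Sp] := @base ((x - th * (S P).1) / (1 - th)).
    have th3 : 0 <= 2^-1 - th by lra.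
    have w1 := mulr_ge0 th3 P10.
    have w2 : 0 <= (2^-1 - th) * (wd - (S P).1) by rewrite mulr_ge0// subr_ge0.
    apply/andP; split; first by apply: divr_ge0; lra.
    by rewrite ler_pdivrMr//; lra.
  exists (padd (pscale th P) (pscale (1 - th) p)); first by apply: vK => //; lra.
  by rewrite SC Sp; apply: pt_eq => /=; [field; rewrite gt_eqF | ring].
(* The inner box lies above or below the base according to the side of P. *)
exists l, t1, t2, wd, h, ((S P).1 / 2), (if 0 <= (S P).2 then 0 else - (h / 2)); split => //.
- by rewrite /h.
- move=> p Kp; split.
    by have := lo p Kp; have := hi p Kp; rewrite /wd /t1 q2E; lra.
  by have := hP p Kp; rewrite ler_norml.
move=> x y hx hy.
have [th [th01 ye]] : exists th, 0 <= th <= 2^-1 /\ y = th * (S P).2.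
  have [h0|h0] := eqVneq (S P).2 0.
    exists 0; split; first by apply/andP; split; lra.
    by move: hy; rewrite /h h0 normr0 lexx mul0r; lra.
  exists (y / (S P).2); split; last by rewrite divfK.
  move: hy; rewrite /h; case: (leP 0 (S P).2) => hs.
    have hs' : 0 < (S P).2 by rewrite lt_neqAle eq_sym h0.
    rewrite ger0_norm// => /andP[y1 y2]; apply/andP; split; first exact: divr_ge0.
    by rewrite ler_pdivrMr//; lra.
  rewrite ltr0_norm// => /andP[y1 y2].
  rewrite ler_ndivrMr// ler_ndivlMr//; apply/andP; split; lra.
have [p Kp Sp] := slice x th hx th01; exists p; split => //.
  by have := congr1 fst Sp.
by have := congr1 snd Sp; rewrite /= ye.
Qed.

(** The boxes of [shear_box] give wd h / 4 <= area K <= 2 wd h. After undoing the rotation and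
    shearing, the image lies between boxes of areas (a + b)^2 wd h / 4 and 2 (a + b)^2 wd h; the
    quotients are the constants 1/8 and 8. *)
Lemma area_steiner_blend (c s a b : R) K : is_SO2 c s -> 0 <= a -> 0 <= b -> convex_body K ->
  (((a + b) ^+ 2 / 8)%:E * area K <= area (steiner_blend c s a b K))%E /\
  (area (steiner_blend c s a b K) <= (8 * (a + b) ^+ 2)%:E * area K)%E.
Proof.
move=> cs a0 b0 bK; have [l [t1 [t2 [wd [h [x0 [y0 [wd0 h0 inK outK]]]]]]]] := shear_box bK.
have cK : compact K by case: bK => _ [].
have ab0 : 0 <= a + b by rewrite addr_ge0.
have cs' := cs; rewrite /is_SO2 !expr2 in cs'.
have cs2 : is_SO2 c (- s) by rewrite /is_SO2 sqrrN.
pose shear p : pt R := (p.1, p.2 + (l * p.1 + 0)).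
have [cG eG] := area_preserving_comp (area_preserving_vshear l 0) (area_preserving_rot cs2)
  (proj1 (proj2 (body_steiner_blend c s a b bK))).
rewrite -eG; set G := _ \o _ in cG *.
have areaK : (area K <= (2 * (wd * h))%:E)%E /\ ((wd * h / 4)%:E <= area K)%E.
  have [cS eS] := area_preserving_vshear l 0 cK; rewrite -eS; split.
    rewrite (_ : 2 * (wd * h) = (wd - t1 - (- t1)) * (h - t2 - (- h - t2))); last by ring.
    rewrite -area_rect; [|lra|lra].
    apply: area_le => //; first exact: compact_rect.
    move=> _ [p Kp <-]; have [i1 i2] := inK p Kp; split; rewrite /= in_itv/=; lra.
  rewrite (_ : wd * h / 4 = (x0 + wd / 2 - t1 - (x0 - t1)) * (y0 + h / 2 - t2 - (y0 - t2))); last by field.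
  rewrite -area_rect; [|lra|lra].
  apply: area_le => //; first exact: compact_rect.
  move=> [x y] [/= i1 i2]; rewrite !in_itv/= in i1 i2.
  have [||p [Kp ex ey]] := outK (x + t1) (y + t2); try lra.
  by exists p => //; apply: pt_eq => /=; lra.
(* The Steiner point contributes a translation only, and the image is that of the points a k - b k'
   after the shear. *)
have GE q k k' : G (padd (pscale a (rot c s (padd k (popp q))))
    (pscale b (rot c s (padd (popp k') q)))) =
    padd (padd (pscale a (shear k)) (pscale (- b) (shear k'))) (pscale (b - a) (shear q)).
  apply: pt_eq; rewrite /G /=; last first.
    transitivity ((c * c + s * s) * (a * (k.2 - q.2) + b * (- k'.2 + q.2)
      + l * (a * (k.1 - q.1) + b * (- k'.1 + q.1)))); first by ring.
    by rewrite cs'; ring.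
  transitivity ((c * c + s * s) * (a * (k.1 - q.1) + b * (- k'.1 + q.1))).
    by ring.
  by rewrite cs'; ring.
have {}GE := GE (steiner K).
set o := pscale (b - a) (shear (steiner K)) in GE.
clearbody o.
have upper : (area (G @` steiner_blend c s a b K) <= (2 * (a + b) ^+ 2 * (wd * h))%:E)%E.
  pose X := b * t1 - a * t1 + o.1; pose Y := b * t2 - a * t2 + o.2.
  rewrite (_ : 2 * (a + b) ^+ 2 * (wd * h) =
    (X + a * wd - (X - b * wd)) * (Y + (a + b) * h - (Y - (a + b) * h))); last by ring.
  rewrite -area_rect; last 2 first.
  - by have := mulr_ge0 a0 wd0; have := mulr_ge0 b0 wd0; lra.
  - by have := mulr_ge0 ab0 h0; lra.
  apply: area_le => //; first exact: compact_rect.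
  move=> _ [_ [_ [_ [[_ [_ [k Kk <-] <-] <-] [[_ [_ [_ [k' Kk' <-] <-] <-] <-] ->]]]] <-].
  rewrite GE; have [/andP[i1 i2] /andP[i3 i4]] := inK k Kk.
  have [/andP[j1 j2] /andP[j3 j4]] := inK k' Kk'.
  have e1 := ler_wpM2l a0 i1; have e2 := ler_wpM2l a0 i2.
  have e3 := ler_wpM2l a0 i3; have e4 := ler_wpM2l a0 i4.
  have f1 := ler_wpM2l b0 j1; have f2 := ler_wpM2l b0 j2.
  have f3 := ler_wpM2l b0 j3; have f4 := ler_wpM2l b0 j4.
  by split; rewrite /= in_itv/= /X /Y; apply/andP; split; lra.
have lower : (((a + b) ^+ 2 * (wd * h) / 4)%:E <= area (G @` steiner_blend c s a b K))%E.
  pose X := a * (x0 - t1) - b * (x0 + wd / 2 - t1) + o.1.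
  pose Y := a * (y0 - t2) - b * (y0 + h / 2 - t2) + o.2.
  rewrite (_ : (a + b) ^+ 2 * (wd * h) / 4 =
    (X + (a + b) * (wd / 2) - X) * (Y + (a + b) * (h / 2) - Y)); last by field.
  have w2 : 0 <= wd / 2 by lra.
  have h2 : 0 <= h / 2 by lra.
  have abw := mulr_ge0 ab0 w2; have abh := mulr_ge0 ab0 h2.
  rewrite -area_rect; [|lra|lra].
  apply: area_le => //; first exact: compact_rect.
  have param (m v r z : R) : 0 <= m -> v <= z <= v + (a + b) * m ->
      exists th, 0 <= th <= m /\ z = v + (a + b) * th.
    move=> m0 /andP[z0 z1]; have [e|ne] := eqVneq (a + b) 0.
      by exists 0; rewrite lexx m0 e; split => //; move: z1; rewrite e; lra.
    have abp : 0 < a + b by rewrite lt_neqAle eq_sym ne.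
    exists ((z - v) / (a + b)); split; last by field.
    by rewrite divr_ge0 ?subr_ge0//= ler_pdivrMr//; lra.
  move=> [x y] [/= i1 i2]; rewrite !in_itv/= in i1 i2.
  have [th [/andP[th0 th1] xe]] := param _ _ 0 _ w2 i1.
  have [ph [/andP[ph0 ph1] ye]] := param _ _ 0 _ h2 i2.
  (* k and k' move in opposite directions through the inner box, so that a k - b k' moves by (a + b)
     times the parameters. *)
  have [||k [Kk kx ky]] := outK (x0 + th) (y0 + ph); try lra.
  have [||k' [Kk' kx' ky']] := outK (x0 + wd / 2 - th) (y0 + h / 2 - ph); try lra.
  exists (padd (pscale a (rot c s (padd k (popp (steiner K)))))
    (pscale b (rot c s (padd (popp k') (steiner K))))).
    exists (pscale a (rot c s (padd k (popp (steiner K))))),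
      (pscale b (rot c s (padd (popp k') (steiner K)))); split.
      by exists (rot c s (padd k (popp (steiner K)))) => //; exists (padd k (popp (steiner K))) => //; exists k.
    split => //; exists (rot c s (padd (popp k') (steiner K))) => //.
    exists (padd (popp k') (steiner K)) => //; exists (popp k') => //; by exists k'.
  have k1 : k.1 = x0 + th - t1 by lra.
  have k2 : k.2 + l * k.1 = y0 + ph - t2 by lra.
  have k1' : k'.1 = x0 + wd / 2 - th - t1 by lra.
  have k2' : k'.2 + l * k'.1 = y0 + h / 2 - ph - t2 by lra.
  rewrite GE; apply: pt_eq; rewrite /= ?xe ?ye /X /Y ?addr0.
    by rewrite k1 k1'; ring.
  by rewrite k2 k2'; ring.
have [u1 u2] := areaK; have ab2 : 0 <= (a + b) ^+ 2 by exact: sqr_ge0.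
split.
  apply: le_trans lower; apply: le_trans (lee_wpmul2l _ u1) _; first by rewrite lee_fin divr_ge0.
  by rewrite -EFinM lee_fin; lra.
apply: le_trans upper _; apply: le_trans (lee_wpmul2l _ u2); last by rewrite lee_fin mulr_ge0.
by rewrite -EFinM lee_fin; lra.
Qed.

(** Rotations of the plane commute, and the Steiner point is rotation covariant. *)
Lemma krot_steiner_blend (co si c s a b : R) K : is_SO2 co si -> 0 <= a -> 0 <= b -> convex_body K ->
  steiner_blend c s a b (krot co si K) = krot co si (steiner_blend c s a b K).
Proof.
move=> cs a0 b0 bK; have bK' := body_krot co si bK.
have bS := body_steiner_blend c s a b bK.
apply: support_inj; [exact: body_steiner_blend | exact: body_krot |] => u.
rewrite support_krot// !support_steiner_blend// !support_krot// steiner_krot//.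
have e1 : rot co (- si) (rot c (- s) u) = rot c (- s) (rot co (- si) u).
  by apply: pt_eq => /=; ring.
have e2 : rot co (- si) (popp (rot c (- s) u)) = popp (rot c (- s) (rot co (- si) u)).
  by apply: pt_eq => /=; ring.
have e3 : pdot (rot c (- s) u) (rot co si (steiner K)) =
    pdot (rot c (- s) (rot co (- si) u)) (steiner K) by rewrite /pdot/=; ring.
by rewrite e1 e2 e3.
Qed.

End Backward.

Theorem theorem6p4 (R : realType) (Phi : set (pt R) -> set (pt R)) :
  maps_bodies Phi -> hcontinuous Phi -> translation_invariant Phi ->
  minkowski_valuation Phi ->
  ((volume_comparable Phi /\ SO2_covariant Phi) <->
   exists (c s a b : R), is_SO2 c s /\ 0 <= a /\ 0 <= b /\ 0 < a + b /\
     forall K, convex_body K ->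
       Phi K = ksum
         (kscale a (krot c s (ktrans K (popp (steiner K)))))
         (kscale b (krot c s (ktrans (krefl K) (steiner K))))).
Proof.
move=> mP cP tP vP; split=> [[[c0 [C0 [c0p [C0p vc]]]] soP]|[c [s [a [b [cs [a0 [b0 [ab PhiE]]]]]]]]].
  apply: (forward mP cP tP vP soP c0p C0p) => K bK; first exact: (vc K bK).1.
  exact: (vc K bK).2.
have ab2 : 0 < (a + b) ^+ 2 by rewrite exprn_gt0.
split.
  exists ((a + b) ^+ 2 / 8), (8 * (a + b) ^+ 2).
  split; first by rewrite divr_gt0.
  split; first by rewrite mulr_gt0.
  by move=> K bK; rewrite PhiE//; exact: area_steiner_blend.
move=> co si cs1 K bK; rewrite !PhiE//; last exact: body_krot.
exact: krot_steiner_blend.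
Qed.
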